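(* Let $V$ be a non-zero finite dimensional $\mathbb{F}_q$-vector space. The variety $Q_V$ is integral, Cohen-Macaulay, and projectively normal.
   Context: $\mathbb{F}_q$ is a finite field with $q$ elements. Let $S_V$ be the symmetric algebra of $V$ over $\mathbb{F}_q$, $K_V$ its field of quotients, and $R_V\subset K_V$ the $\mathbb{F}_q$-subalgebra generated by $\frac1v$ for all $v\in V\setminus\{0\}$, graded such that each $\frac1v$ is homogeneous of degree $-1$. Set $Q_V:=\operatorname{Proj}R_V$, where $\operatorname{Proj}$ is formed after inverting the sign of the grading. With $r=\dim V$, the surjection from the polynomial ring in indeterminates $Y_v$ ($v\in V\setminus\{0\}$) to $R_V$ given by $Y_v\mapsto\frac1v$ describes $Q_V$ as a closed subvariety of $\mathbb{P}^{q^r-2}_{\mathbb{F}_q}$ with homogeneous coordinate ring $R_V$; projective normality refers to this embedding, i.e. it means that the homogeneous coordinate ring $R_V$ is integrally closed. *)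

(* Defs.v *)
From HB Require Import structures.
From mathcomp Require Import all_boot all_order all_algebra.
From mathcomp Require Import mpoly ring.
From mathcomp.classical Require Import boolp.

Set Implicit Arguments.
Unset Strict Implicit.
Unset Printing Implicit Defensive.

Import GRing.Theory.
Local Open Scope ring_scope.
Local Open Scope quotient_scope.


Section CommutativeAlgebra.
Variable A : comNzRingType.

Definition is_unit (x : A) : Prop := exists y, x * y = 1.

Definition is_local : Prop :=
  forall x y : A, ~ is_unit x -> ~ is_unit y -> ~ is_unit (x + y).

Definition ideal_gen (s : seq A) (x : A) : Prop :=
  exists c : nat -> A, x = \sum_(i < size s) c i * s`_i.

(* [idealr] bundles the proper ideals; the unit ideal is generated by 1. *)
Definition noetherian : Prop :=
  forall I : idealr A, exists s : seq A, forall x, x \in I <-> ideal_gen s x.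

Definition prime_chain (n : nat) (P : nat -> prime_idealr A) : Prop :=
  forall i, (i < n)%N ->
    {subset P i <= P i.+1} /\ exists2 x, x \in P i.+1 & x \notin P i.

Definition krull_dim (n : nat) : Prop :=
  (exists P, prime_chain n P) /\
  (forall m P, prime_chain m P -> (m <= n)%N).

(* Regular sequences contained in the set of non-units, that is, in the
   maximal ideal when [A] is local; A / (s) is then nonzero. *)
Definition regular_seq (s : seq A) : Prop :=
  (forall x, x \in s -> ~ is_unit x) /\
  (forall i, (i < size s)%N -> forall y,
     ideal_gen (take i s) (s`_i * y) -> ideal_gen (take i s) y).

Definition depth (n : nat) : Prop :=
  (exists2 s, regular_seq s & size s = n) /\
  (forall s, regular_seq s -> (size s <= n)%N).

Definition cohen_macaulay_local : Prop :=
  [/\ is_local, noetherian & exists2 d, krull_dim d & depth d].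

End CommutativeAlgebra.

Definition integrally_closed (A : idomainType) : Prop :=
  forall x : {fraction A},
    integralOver (@FracField.tofrac A) x -> exists a : A, x = FracField.tofrac a.


(* The structure sheaf is given through its germs: a section over [U] is a
   family of elements of the stalks, and [section U] tells which families are
   sections.  Ring operations on sections are pointwise. *)
Record ringed_space := RingedSpace {
  point :> Type;
  is_open : (point -> Prop) -> Prop;
  stalk : point -> comNzRingType;
  section : forall U : point -> Prop,
    (forall x : {x | U x}, stalk (sval x)) -> Prop }.

Arguments section {r} U _.

(* O(U) <> 0 for nonempty U, as the stalks are nonzero rings. *)
Definition integral (X : ringed_space) : Prop :=
  (exists x : X, True) /\
  forall U : X -> Prop, is_open U -> (exists x, U x) ->
  forall s t : (forall x : {x | U x}, stalk (sval x)),
    section U s -> section U t -> (forall x, s x * t x = 0) ->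
    (forall x, s x = 0) \/ (forall x, t x = 0).

Definition cohen_macaulay (X : ringed_space) : Prop :=
  forall x : X, cohen_macaulay_local (stalk x).


Record grading (A : comNzRingType) := Grading {
  gpart :> nat -> A -> Prop;
  gpartB : forall d a b, gpart d a -> gpart d b -> gpart d (a - b);
  gpart1 : gpart 0 1;
  gpartM : forall d e a b, gpart d a -> gpart e b -> gpart (d + e) (a * b);
  gpart_dec : forall a, exists n (c : nat -> A),
    (forall i, gpart i (c i)) /\ a = \sum_(i < n) c i;
  gpart_uniq : forall n (c : nat -> A),
    (forall i, gpart i (c i)) -> \sum_(i < n) c i = 0 ->
    forall i, (i < n)%N -> c i = 0 }.

Section GradingTheory.
Variables (A : comNzRingType) (G : grading A).


Lemma gpart0 d : G d 0.
Proof.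
have [n [c [hc E]]] := gpart_dec G 0.
by rewrite -(subrr (c d)); apply: gpartB.
Qed.

Lemma gpartN d a : G d a -> G d (- a).
Proof. by move=> ha; rewrite -sub0r; apply: gpartB => //; apply: gpart0. Qed.

Lemma gpartD d a b : G d a -> G d b -> G d (a + b).
Proof. by move=> ha hb; rewrite -[b]opprK; apply: gpartB => //; apply: gpartN. Qed.
End GradingTheory.

Section Proj.
Variables (A : comNzRingType) (G : grading A).

Record proj_point := ProjPoint {
  proj_ideal :> prime_idealr A;
  _ : forall n (c : nat -> A), (forall i, G i (c i)) ->
        \sum_(i < n) c i \in proj_ideal ->
        forall i, (i < n)%N -> c i \in proj_ideal;
  _ : exists d a, [/\ (0 < d)%N, G d a & a \notin proj_ideal] }.

Definition proj_open (U : proj_point -> Prop) : Prop :=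
  exists E : A -> Prop, (forall a, E a -> exists d, G d a) /\
    forall p : proj_point, U p <-> exists2 a, E a & a \notin p.

Section LocalRing.
Variable p : proj_point.

(* Fractions num / den of homogeneous elements of the same degree, with
   denominator outside [p]. *)
Record hfrac := HFrac {
  num : A;
  den : A;
  hfracP : (exists2 d, G d num & G d den) /\ den \notin p }.

HB.instance Definition _ := gen_eqMixin hfrac.
HB.instance Definition _ := gen_choiceMixin hfrac.

Definition hfrac_eqv (x y : hfrac) : bool :=
  `[< exists h, [/\ exists d, G d h, h \notin p &
        h * (num x * den y - num y * den x) = 0] >].

Let notinM (a b : A) : a \notin p -> b \notin p -> a * b \notin p.
Proof. by move=> ha hb; rewrite prime_idealrM negb_or ha. Qed.

Let notin1 : 1 \notin p.
Proof. by rewrite idealr1. Qed.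

Lemma hfrac_refl : reflexive hfrac_eqv.
Proof.
move=> x; apply/asboolP; exists 1; split=> //; first by exists 0; apply: gpart1.
by rewrite subrr mulr0.
Qed.

Lemma hfrac_sym : ssrbool.symmetric hfrac_eqv.
Proof.
have H x y : hfrac_eqv x y -> hfrac_eqv y x.
  move=> /asboolP [h [hh hp e]]; apply/asboolP; exists h; split=> //.
  by rewrite -opprB mulrN e oppr0.
by move=> x y; apply/idP/idP; apply: H.
Qed.

Lemma hfrac_trans : transitive hfrac_eqv.
Proof.
move=> y x z /asboolP [h [[d hh] hp e]] /asboolP [k [[d' hk] kp e']].
have [[f fn fd] fp] := hfracP y.
apply/asboolP; exists (h * k * den y); split.
- by exists (d + d' + f)%N; do 2?apply: gpartM.
- by do 2?apply: notinM.
- have -> : h * k * den y * (num x * den z - num z * den x) =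
    k * den z * (h * (num x * den y - num y * den x)) +
    h * den x * (k * (num y * den z - num z * den y)) by ring.
  by rewrite e e' !mulr0 addr0.
Qed.

Canonical hfrac_equiv := EquivRel hfrac_eqv hfrac_refl hfrac_sym hfrac_trans.

(* The homogeneous localization A_(p). *)
Definition hloc := {eq_quot hfrac_eqv}.
HB.instance Definition _ : EqQuotient _ hfrac_eqv hloc := EqQuotient.on hloc.
HB.instance Definition _ := Choice.on hloc.

Lemma hloc_eq (x y : hfrac) :
  \pi_hloc x = \pi_hloc y <->
  exists h, [/\ exists d, G d h, h \notin p &
        h * (num x * den y - num y * den x) = 0].
Proof.
split=> [/eqmodP /asboolP //|H]; by apply/eqmodP/asboolP.
Qed.

Lemma hfrac_add_subproof (x y : hfrac) :
  (exists2 d, G d (num x * den y + num y * den x) & G d (den x * den y)) /\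
  den x * den y \notin p.
Proof.
have [[d xn xd] xp] := hfracP x; have [[e yn yd] yp] := hfracP y.
split; last exact: notinM.
exists (d + e)%N; last exact: gpartM.
by apply: gpartD; [|rewrite addnC]; apply: gpartM.
Qed.

Lemma hfrac_opp_subproof (x : hfrac) :
  (exists2 d, G d (- num x) & G d (den x)) /\ den x \notin p.
Proof.
have [[d xn xd] xp] := hfracP x.
by split=> //; exists d => //; apply: gpartN.
Qed.

Lemma hfrac_mul_subproof (x y : hfrac) :
  (exists2 d, G d (num x * num y) & G d (den x * den y)) /\
  den x * den y \notin p.
Proof.
have [[d xn xd] xp] := hfracP x; have [[e yn yd] yp] := hfracP y.
by split; [exists (d + e)%N; apply: gpartM|apply: notinM].
Qed.

Lemma hfrac0_subproof :
  (exists2 d, G d 0 & G d 1) /\ (1 : A) \notin p.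
Proof. by split=> //; exists 0 => //; [apply: gpart0|apply: gpart1]. Qed.

Lemma hfrac1_subproof :
  (exists2 d, G d 1 & G d 1) /\ (1 : A) \notin p.
Proof. by split=> //; exists 0 => //; apply: gpart1. Qed.

Definition hfrac_add x y := HFrac (hfrac_add_subproof x y).
Definition hfrac_opp x := HFrac (hfrac_opp_subproof x).
Definition hfrac_mul x y := HFrac (hfrac_mul_subproof x y).

Definition hloc0 : hloc := \pi_hloc (HFrac hfrac0_subproof).
Definition hloc1 : hloc := \pi_hloc (HFrac hfrac1_subproof).
Definition hloc_add := lift_op2 hloc hfrac_add.
Definition hloc_opp := lift_op1 hloc hfrac_opp.
Definition hloc_mul := lift_op2 hloc hfrac_mul.

Lemma pi_hloc_add : {morph \pi : x y / hfrac_add x y >-> hloc_add x y}.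
Proof.
move=> x y; unlock hloc_add.
have /hloc_eq [h [[d hh] hp e]] : \pi_hloc x = \pi_hloc (repr (\pi_hloc x)) by rewrite reprK.
have /hloc_eq [k [[d' hk] kp e']] : \pi_hloc y = \pi_hloc (repr (\pi_hloc y)) by rewrite reprK.
move: (repr _) (repr _) e e' => y' x' e e'.
apply/hloc_eq; exists (h * k); split; [by exists (d + d')%N; apply: gpartM | exact: notinM |].
rewrite /=.
have -> : h * k * ((num x * den y + num y * den x) * (den x' * den y') -
   (num x' * den y' + num y' * den x') * (den x * den y)) =
   k * den y * den y' * (h * (num x * den x' - num x' * den x)) +
   h * den x * den x' * (k * (num y * den y' - num y' * den y)) by ring.
by rewrite e e' !mulr0 addr0.
Qed.
Canonical pi_hloc_add_morph := PiMorph2 pi_hloc_add.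

Lemma pi_hloc_opp : {morph \pi : x / hfrac_opp x >-> hloc_opp x}.
Proof.
move=> x; unlock hloc_opp.
have /hloc_eq [h [hh hp e]] : \pi_hloc x = \pi_hloc (repr (\pi_hloc x)) by rewrite reprK.
move: (repr _) e => x' e.
apply/hloc_eq; exists h; split=> //=.
have -> : h * (- num x * den x' - - num x' * den x) =
  - (h * (num x * den x' - num x' * den x)) by ring.
by rewrite e oppr0.
Qed.
Canonical pi_hloc_opp_morph := PiMorph1 pi_hloc_opp.

Lemma pi_hloc_mul : {morph \pi : x y / hfrac_mul x y >-> hloc_mul x y}.
Proof.
move=> x y; unlock hloc_mul.
have /hloc_eq [h [[d hh] hp e]] : \pi_hloc x = \pi_hloc (repr (\pi_hloc x)) by rewrite reprK.
have /hloc_eq [k [[d' hk] kp e']] : \pi_hloc y = \pi_hloc (repr (\pi_hloc y)) by rewrite reprK.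
move: (repr _) (repr _) e e' => y' x' e e'.
apply/hloc_eq; exists (h * k); split; [by exists (d + d')%N; apply: gpartM | exact: notinM |].
rewrite /=.
have -> : h * k * (num x * num y * (den x' * den y') -
   num x' * num y' * (den x * den y)) =
   k * num y * den y' * (h * (num x * den x' - num x' * den x)) +
   h * den x * num x' * (k * (num y * den y' - num y' * den y)) by ring.
by rewrite e e' !mulr0 addr0.
Qed.
Canonical pi_hloc_mul_morph := PiMorph2 pi_hloc_mul.

Lemma hfrac_eq_pi (x y : hfrac) :
  num x * den y = num y * den x -> \pi_hloc x = \pi_hloc y.
Proof.
move=> e; apply/hloc_eq; exists 1; split=> //.
  by exists 0; apply: gpart1.
by rewrite e subrr mulr0.
Qed.

Lemma hloc_addA : associative hloc_add.
Proof.
elim/quotW=> x; elim/quotW=> y; elim/quotW=> z.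
by rewrite -!pi_hloc_add; apply: hfrac_eq_pi => /=; ring.
Qed.

Lemma hloc_addC : commutative hloc_add.
Proof.
elim/quotW=> x; elim/quotW=> y.
by rewrite -!pi_hloc_add; apply: hfrac_eq_pi => /=; ring.
Qed.

Lemma hloc_add0 : left_id hloc0 hloc_add.
Proof.
by elim/quotW=> x; rewrite -pi_hloc_add; apply: hfrac_eq_pi => /=; ring.
Qed.

Lemma hloc_addN : left_inverse hloc0 hloc_opp hloc_add.
Proof.
elim/quotW=> x; rewrite -pi_hloc_opp -pi_hloc_add.
by apply: hfrac_eq_pi => /=; ring.
Qed.

HB.instance Definition _ :=
  GRing.isZmodule.Build hloc hloc_addA hloc_addC hloc_add0 hloc_addN.

Lemma hloc_mulA : associative hloc_mul.
Proof.
elim/quotW=> x; elim/quotW=> y; elim/quotW=> z.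
by rewrite -!pi_hloc_mul; apply: hfrac_eq_pi => /=; ring.
Qed.

Lemma hloc_mulC : commutative hloc_mul.
Proof.
elim/quotW=> x; elim/quotW=> y.
by rewrite -!pi_hloc_mul; apply: hfrac_eq_pi => /=; ring.
Qed.

Lemma hloc_mul1 : left_id hloc1 hloc_mul.
Proof.
by elim/quotW=> x; rewrite -pi_hloc_mul; apply: hfrac_eq_pi => /=; ring.
Qed.

Lemma hloc_mulDl : left_distributive hloc_mul hloc_add.
Proof.
elim/quotW=> x; elim/quotW=> y; elim/quotW=> z.
rewrite -pi_hloc_add -!pi_hloc_mul -pi_hloc_add.
by apply: hfrac_eq_pi => /=; ring.
Qed.

Lemma hloc_1neq0 : hloc1 != hloc0.
Proof.
apply/eqP => /hloc_eq [h [_ hp]] /=; rewrite !mulr1 subr0 mulr1 => h0.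
by move: hp; rewrite h0 rpred0.
Qed.

HB.instance Definition _ := GRing.Zmodule_isComNzRing.Build hloc
  hloc_mulA hloc_mulC hloc_mul1 hloc_mulDl hloc_1neq0.

End LocalRing.

Definition proj_section (U : proj_point -> Prop)
    (s : forall x : {x | U x}, hloc (sval x)) : Prop :=
  forall x : {x | U x}, exists W : proj_point -> Prop,
    [/\ proj_open W, W (sval x) & exists d f g, [/\ G d f, G d g &
      forall y : {x | U x}, W (sval y) ->
        exists h : hfrac (sval y),
          [/\ num h = f, den h = g & s y = \pi h]]].

Definition Proj : ringed_space :=
  @RingedSpace proj_point proj_open (fun p => hloc p : comNzRingType) proj_section.

End Proj.


Section RV.
Variables (F : finFieldType) (V : vectType F).

(* The symmetric algebra of [V], as a polynomial ring in a basis of [V];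
   [SV_universal] below is its universal property. *)
Local Notation SV := {mpoly F[\dim {:V}]}.

Definition SV_in (v : V) : SV := \sum_i coord (vbasis {:V}) i v *: 'X_i.

Lemma SV_in_is_linear : linear SV_in.
Proof.
move=> a u v; rewrite /SV_in scaler_sumr -big_split /=.
by apply: eq_bigr => i _; rewrite linearP scalerDl scalerA.
Qed.
HB.instance Definition _ := GRing.isLinear.Build F V SV _ SV_in SV_in_is_linear.

Lemma SV_in_inj : injective SV_in.
Proof.
apply: raddf_inj => v /mpolyP e.
rewrite (coord_vbasis (memvf v)) big1 // => i _.
move: (e U_(i)%MM); rewrite mcoeff0 /SV_in raddf_sum (bigD1 i) //=.
rewrite mcoeffZ mcoeffX eqxx mulr1 big1 ?addr0 => [->|j ji]; first by rewrite scale0r.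
by rewrite mcoeffZ mcoeffX eq_mnm1 (negbTE ji) mulr0.
Qed.

Lemma SV_universal (B : comAlgType F) (f : {linear V -> B}) :
  exists g : {lrmorphism SV -> B}, g \o SV_in =1 f /\
    forall g' : {lrmorphism SV -> B}, g' \o SV_in =1 f -> g' =1 g.
Proof.
pose h (i : 'I_(\dim {:V})) := f (vbasis {:V})`_i.
pose g (p : SV) : B := mmap (in_alg B) h p.
have g_lin : linear g.
  by move=> a p q; rewrite /g mmapD mmapZ /= mulr_algl.
have g_mul : monoid_morphism g.
  by split; [apply: rmorph1|apply: rmorphM].
pose gL := GRing.isLinear.Build F SV B *:%R g g_lin.
pose gM := GRing.isMonoidMorphism.Build SV B g g_mul.
pose gg : {lrmorphism SV -> B} := HB.pack g gL gM.
have ggE : gg \o SV_in =1 f.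
  move=> v; rewrite -[LHS]/(g (SV_in v)) [in RHS](coord_vbasis (memvf v)).
  rewrite /g /SV_in !raddf_sum.
  apply: eq_bigr => i _.
  by rewrite /= mmapZ mmapX mmap1U /= mulr_algl linearZ.
exists gg; split=> //.
have gE (u : {lrmorphism SV -> B}) p :
    u p = \sum_(m <- msupp p) p@_m *: \prod_i u 'X_i ^+ m i.
  rewrite {1}(mpolyE p) raddf_sum; apply: eq_bigr => m _ /=.
  rewrite linearZ /=; congr (_ *: _).
  by rewrite mpolyXE_id rmorph_prod; apply: eq_bigr => i _; rewrite rmorphXn.
move=> g' hg' p; rewrite !gE; apply: eq_bigr => m _; congr (_ *: _).
apply: eq_bigr => i _; congr (_ ^+ _).
have -> : 'X_i = SV_in (vbasis {:V})`_i.
  rewrite /SV_in (bigD1 i) //= coord_free ?(basis_free (vbasisP _)) // eqxx scale1r.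
  rewrite big1 ?addr0 // => j ji.
  by rewrite coord_free ?(basis_free (vbasisP _)) // eq_sym (negbTE ji) scale0r.
by rewrite -[LHS]/((g' \o SV_in) _) hg' -[RHS]/((gg \o SV_in) _) ggE.
Qed.

Local Notation KV := {fraction SV}.

Definition KV_const (a : F) : KV := FracField.tofrac a%:MP.
Definition KV_in (v : V) : KV := FracField.tofrac (SV_in v).

Definition RV_pred : {pred KV} := fun x => `[< forall S : {pred KV},
  subring_closed S -> (forall a, KV_const a \in S) ->
  (forall v, v != 0 -> (KV_in v)^-1 \in S) -> x \in S >].

Lemma RV_pred_subring : subring_closed RV_pred.
Proof.
split.
- by apply/asboolP => S [].
- move=> x y /asboolP hx /asboolP hy; apply/asboolP => S hS hc hv.
  by case: (hS) => _ hB _; apply: hB; [apply: hx|apply: hy].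
- move=> x y /asboolP hx /asboolP hy; apply/asboolP => S hS hc hv.
  by case: (hS) => _ _ hM; apply: hM; [apply: hx|apply: hy].
Qed.
HB.instance Definition _ := GRing.isSubringClosed.Build KV RV_pred RV_pred_subring.

Record RV := MkRV { RV_val :> KV; _ : RV_val \in RV_pred }.
HB.instance Definition _ := [isSub for RV_val].
HB.instance Definition _ := [Choice of RV by <:].
HB.instance Definition _ := [SubChoice_isSubComNzRing of RV by <:].

Definition RV_unit : {pred RV} := fun x => `[< exists y, y * x = 1 >].
Definition RV_inv (x : RV) : RV :=
  if pselect (exists y, y * x = 1) is left h then projT1 (cid h) else x.

Lemma RV_mulVr : {in RV_unit, left_inverse 1 RV_inv *%R}.
Proof.
move=> x /asboolP hx; rewrite /RV_inv.
by case: pselect => // h; case: (cid h).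
Qed.
Lemma RV_unitP x y : y * x = 1 -> RV_unit x.
Proof. by move=> e; apply/asboolP; exists y. Qed.
Lemma RV_inv_out : {in [predC RV_unit], RV_inv =1 id}.
Proof.
move=> x; rewrite inE => /negP hx; rewrite /RV_inv.
by case: pselect => // h; case: hx; apply/asboolP.
Qed.
HB.instance Definition _ :=
  GRing.ComNzRing_hasMulInverse.Build RV RV_mulVr RV_unitP RV_inv_out.

Lemma RV_integral : GRing.integral_domain_axiom RV.
Proof.
move=> x y /(congr1 val); rewrite rmorphM rmorph0 => /eqP.
by rewrite mulf_eq0 -!(rmorph0 (val : RV -> KV)) !(inj_eq val_inj).
Qed.
HB.instance Definition _ := GRing.ComUnitRing_isIntegral.Build RV RV_integral.

Definition RV_term (t : F * seq V) : KV :=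
  KV_const t.1 * \prod_(v <- t.2) (KV_in v)^-1.

(* The elements of degree [-d], that is, of degree [d] after inverting the
   sign of the grading. *)
Definition RV_homog (d : nat) (x : RV) : Prop :=
  exists2 s : seq (F * seq V),
    (forall t, t \in s -> size t.2 = d /\ 0 \notin t.2) &
    RV_val x = \sum_(t <- s) RV_term t.

Lemma RV_spanP x : x \in RV_pred -> exists2 s : seq (F * seq V),
  (forall t, t \in s -> 0 \notin t.2) & x = \sum_(t <- s) RV_term t.
Proof.
pose S : {pred KV} := fun x => `[< exists2 s : seq (F * seq V),
  (forall t, t \in s -> 0 \notin t.2) & x = \sum_(t <- s) RV_term t >].
move=> /asboolP /(_ S) H; apply/asboolP; apply: H.
- split.
  + apply/asboolP; exists [:: (1, [::])]; first by move=> t; rewrite inE => /eqP ->.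
    by rewrite big_seq1 /RV_term /KV_const big_nil mulr1 mpolyC1 rmorph1.
  + move=> a b /asboolP [s hs ->] /asboolP [u hu ->]; apply/asboolP.
    exists (s ++ [seq (- t.1, t.2) | t <- u]).
      move=> t; rewrite mem_cat => /orP [/hs //|/mapP [w wu ->]]; exact: (hu w wu).
    rewrite big_cat /= big_map -sumrN; congr (_ + _); apply: eq_bigr => t _.
    by rewrite /RV_term /= /KV_const mpolyCN rmorphN mulNr.
  + move=> a b /asboolP [s hs ->] /asboolP [u hu ->]; apply/asboolP.
    exists [seq (t.1 * w.1, t.2 ++ w.2) | t <- s, w <- u].
      move=> t /allpairsP [[t1 t2] [h1 h2 ->]] /=.
      by rewrite mem_cat negb_or hs ?hu.
    rewrite big_allpairs_dep /= mulr_suml; apply: eq_bigr => t _.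
    rewrite mulr_sumr; apply: eq_bigr => w _.
    by rewrite /RV_term /= /KV_const mpolyCM rmorphM big_cat /= mulrACA.
- move=> a; apply/asboolP; exists [:: (a, [::])].
    by move=> t; rewrite inE => /eqP ->.
  by rewrite big_seq1 /RV_term big_nil mulr1.
- move=> v v0; apply/asboolP; exists [:: (1, [:: v])].
    by move=> t; rewrite inE => /eqP -> /=; rewrite inE eq_sym.
  by rewrite big_seq1 /RV_term big_seq1 /KV_const mpolyC1 rmorph1 mul1r.
Qed.

Lemma RV_term_in t : 0 \notin t.2 -> RV_term t \in RV_pred.
Proof.
move=> t0; apply/asboolP => S hS hc hv; case: (hS) => h1 _ hM.
apply: (hM) => //; elim: t.2 t0 => [|v w IH]; first by rewrite big_nil.
rewrite inE negb_or big_cons => /andP [v0 w0].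
by apply: hM; [apply: hv; rewrite eq_sym|apply: IH].
Qed.

Lemma RV_homogB d x y : RV_homog d x -> RV_homog d y -> RV_homog d (x - y).
Proof.
move=> [s hs ex] [u hu ey].
exists (s ++ [seq (- t.1, t.2) | t <- u]).
  move=> t; rewrite mem_cat => /orP [/hs //|/mapP [w wu ->]]; exact: (hu w wu).
rewrite [LHS](_ : _ = RV_val x - RV_val y) // big_cat big_map.
rewrite ex ey -sumrN; congr (_ + _); apply: eq_bigr => t _.
by rewrite /RV_term /= /KV_const mpolyCN rmorphN mulNr.
Qed.

Lemma RV_homog1 : RV_homog 0 1.
Proof.
exists [:: (1, [::])]; first by move=> t; rewrite inE => /eqP ->.
by rewrite big_seq1 /RV_term /KV_const big_nil mulr1 mpolyC1 rmorph1.
Qed.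

Lemma RV_homogM d e x y :
  RV_homog d x -> RV_homog e y -> RV_homog (d + e) (x * y).
Proof.
move=> [s hs ex] [u hu ey].
exists [seq (t.1 * w.1, t.2 ++ w.2) | t <- s, w <- u].
  move=> t /allpairsP [[t1 t2] [/hs [h1 h1'] /hu [h2 h2'] ->]] /=.
  by rewrite size_cat h1 h2 mem_cat negb_or h1'.
rewrite [LHS](_ : _ = RV_val x * RV_val y) // big_allpairs_dep /=.
rewrite ex ey mulr_suml; apply: eq_bigr => t _.
rewrite mulr_sumr; apply: eq_bigr => w _.
by rewrite /RV_term /= /KV_const mpolyCM rmorphM big_cat /= mulrACA.
Qed.

Lemma RV_homog_dec x : exists n (c : nat -> RV),
  (forall i, RV_homog i (c i)) /\ x = \sum_(i < n) c i.
Proof.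
have [s hs ex] := RV_spanP (valP x).
pose si i := [seq t <- s | size t.2 == i].
have hsi i t : t \in si i -> size t.2 = i /\ 0 \notin t.2.
  by rewrite mem_filter => /andP [/eqP -> /hs].
have hin i : \sum_(t <- si i) RV_term t \in RV_pred.
  rewrite big_seq; apply: rpred_sum => t /hsi [_]; exact: RV_term_in.
pose c i := MkRV (hin i).
pose n := (\max_(t <- s) size t.2).+1.
exists n, c; split; first by move=> i; exists (si i) => //; apply: hsi.
apply: val_inj; rewrite rmorph_sum /= ex.
under [RHS]eq_bigr => i _ do rewrite big_filter big_mkcond.
rewrite exchange_big /= big_seq [RHS]big_seq; apply: eq_bigr => t ts.
have tn : (size t.2 < n)%N by rewrite ltnS; apply: (@leq_bigmax_seq _ s xpredT (fun t => size t.2)).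
rewrite (bigD1 (Ordinal tn)) //= eqxx big1 ?addr0 // => i.
by rewrite -val_eqE /= eq_sym => /negbTE ->.
Qed.

Lemma SV_in_homog v : SV_in v \is 1.-homog.
Proof.
apply: rpred_sum => i _; apply: rpredZ; rewrite dhomogX; exact/eqP/mdeg1.
Qed.

Definition RV_shape (d : nat) (x : KV) : Prop :=
  exists m e (p q : {mpoly F[\dim {:V}]}),
    [/\ p \is m.-homog, q \is e.-homog, q != 0, p != 0 -> e = (m + d)%N &
      x * FracField.tofrac q = FracField.tofrac p].

Lemma RV_shape_term t : 0 \notin t.2 -> RV_shape (size t.2) (RV_term t).
Proof.
case: t => a w /= w0.
exists 0, (size w), (a%:MP), (\prod_(v <- w) SV_in v); split.
- rewrite -[a%:MP]mulr1 mul_mpolyC; exact/rpredZ/dhomog1.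
- elim: w {w0} => [|v w IH] /=; first by rewrite big_nil dhomog1.
  by rewrite big_cons -add1n; apply: dhomogM => //; apply: SV_in_homog.
- rewrite prodf_seq_neq0; apply/allP => v vw /=.
  rewrite -(raddf0 SV_in) (inj_eq SV_in_inj).
  by apply: contraNneq w0 => <-.
- by rewrite add0n.
rewrite /RV_term /= rmorph_prod -mulrA -big_split /= big_seq big1 ?mulr1 //.
move=> v vw; rewrite mulVf // tofrac_eq0 -(raddf0 SV_in) (inj_eq SV_in_inj).
by apply: contraNneq w0 => <-.
Qed.

Lemma RV_shapeD d x y : RV_shape d x -> RV_shape d y -> RV_shape d (x + y).
Proof.
move=> [m [e [p [q [hp hq q0 hpq Ex]]]]] [m' [e' [p' [q' [hp' hq' q0' hpq' Ey]]]]].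
have [p0|pn0] := eqVneq p 0.
  exists m', e', p', q'; split=> //.
  rewrite mulrDl Ey; have -> : x = 0; last by rewrite mul0r add0r.
  move/eqP: Ex; rewrite p0 tofrac0 mulf_eq0 tofrac_eq0 => /orP [/eqP //|].
  by rewrite (negbTE q0).
have [p0'|pn0'] := eqVneq p' 0.
  exists m, e, p, q; split=> //.
  rewrite mulrDl Ex; have -> : y = 0; last by rewrite mul0r addr0.
  move/eqP: Ey; rewrite p0' tofrac0 mulf_eq0 tofrac_eq0 => /orP [/eqP //|].
  by rewrite (negbTE q0').
move: (hpq pn0) (hpq' pn0') => Ee Ee'.
exists (m + e')%N, (e + e')%N, (p * q' + p' * q), (q * q'); split.
- apply: rpredD; first exact: dhomogM.
  have -> : (m + e' = m' + e)%N by rewrite Ee Ee' addnCA.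
  exact: dhomogM.
- exact: dhomogM.
- by rewrite mulf_neq0.
- by rewrite Ee addnAC.
rewrite rmorphD !rmorphM /= -Ex -Ey; ring.
Qed.

Lemma RV_homog_shape d x : RV_homog d x -> RV_shape d (RV_val x).
Proof.
case=> s hs ->; elim: s hs => [|t s IH] hs.
  rewrite big_nil; exists 0, 0, 0, 1; split.
  - exact: rpred0.
  - exact: dhomog1.
  - exact: oner_neq0.
  - by rewrite eqxx.
  by rewrite mul0r tofrac0.
rewrite big_cons; apply: RV_shapeD.
  have [<- t0] := hs t (mem_head _ _); exact: RV_shape_term.
by apply: IH => u us; apply: hs; rewrite inE us orbT.
Qed.

Lemma RV_homog_uniq n (c : nat -> RV) :
  (forall i, RV_homog i (c i)) -> \sum_(i < n) c i = 0 ->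
  forall i, (i < n)%N -> c i = 0.
Proof.
move=> hc e0.
have /choice [m /choice [e /choice [p /choice [q H]]]] i := RV_homog_shape (hc i).
pose Q (i : 'I_n) : SV := \prod_(j < n | j != i) (q j).
pose M (i : 'I_n) := (m i + \sum_(j < n | j != i) e j)%N.
have hQ i : Q i \is (\sum_(j < n | j != i) e j).-homog.
  rewrite /Q; apply: (big_ind2 (fun (x : SV) d => x \is d.-homog)).
  - exact: dhomog1.
  - by move=> *; apply: dhomogM.
  - by move=> j _; case: (H j).
have hM (i : 'I_n) : p i != 0 -> (M i + i = \sum_(j < n) e j)%N.
  move=> pi0; rewrite [RHS](bigD1 i) //=; case: (H i) => _ _ _ /(_ pi0) -> _.
  by rewrite /M addnAC.
have S0 : \sum_(i < n) (p i * Q i) = 0.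
  apply/eqP; rewrite -tofrac_eq0 rmorph_sum /=; apply/eqP.
  have e1 : \sum_(i < n) RV_val (c i) = 0.
    by rewrite -(rmorph_sum (val : RV -> KV)) e0 rmorph0.
  transitivity ((\sum_(i < n) RV_val (c i)) * \prod_(j < n) FracField.tofrac (q j)).
    rewrite mulr_suml; apply: eq_bigr => i _.
    rewrite rmorphM rmorph_prod [in RHS](bigD1 i) //= mulrA; congr (_ * _).
    by case: (H i) => _ _ _ _ <-.
  by rewrite e1 mul0r.
move=> i0 lt_i0; pose i := Ordinal lt_i0.
have [pi0|pi0] := eqVneq (p i) 0.
  apply: val_inj; case: (H i) => _ _ q0 _ /eqP.
  rewrite pi0 tofrac0 mulf_eq0 tofrac_eq0 (negbTE q0) orbF => /eqP ci0.
  exact: ci0.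
have hpQ (j : 'I_n) : (p j * Q j) \is (M j).-homog.
  by apply: dhomogM; [case: (H j)|apply: hQ].
have := congr1 (pihomog mdeg (M i)) S0.
rewrite raddf0 raddf_sum (bigD1 i) //= (pihomog_dE (hpQ i)) big1 ?addr0.
  move/eqP; rewrite mulf_eq0 (negbTE pi0) /= => /eqP.
  have : Q i != 0.
    by apply/prodf_neq0 => j _; case: (H j).
  by move=> /eqP.
move=> j ji; have [->|pj0] := eqVneq (p j) 0; first by rewrite mul0r raddf0.
apply: pihomog_ne0 (hpQ j); apply: contra ji => /eqP Mji.
have := hM j pj0; rewrite Mji -(hM i pi0) => /eqP.
by rewrite eqn_add2l -val_eqE.
Qed.

Definition RV_grading : grading RV :=
  Grading RV_homogB RV_homog1 RV_homogM RV_homog_dec RV_homog_uniq.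

Definition QV : ringed_space := Proj RV_grading.

(* Projective normality with respect to the embedding of Q_V whose homogeneous
   coordinate ring is R_V. *)
Definition QV_projectively_normal : Prop := integrally_closed RV.

End RV.

(* Main.v *)
From HB Require Import structures.
From mathcomp Require Import all_boot all_algebra.
From mathcomp Require Import mpoly ring zify.
From mathcomp.classical Require Import boolp classical_sets.
Require Import Defs.

(** Everything rests on one description.  For a subspace [U] of [V] let [R_U] be
    the algebra generated by the [1/u].  If [x] is a vector outside [U], the
    relation
      [1/(x+u) * 1/(x+u') = 1/(u'-u) * (1/(x+u) - 1/(x+u'))]
    shows that [R_(U + <x>)] consists of the partial fractions in the
    transcendental element [x], with poles at the [-u] and coefficients in [R_U];
    these expansions are unique, so the ring is free over [R_U].

    Integrality holds because every non-empty open set contains the point of the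
    zero ideal, whose stalk is a domain ([Proj_integral]).

    Normality.  Call [y] almost integral over a ring if some [c <> 0] satisfies
    [c y^n] in the ring for all [n]; integral elements are almost integral
    ([integral_almost]).  By induction on [U] the ring [R_U] contains the elements
    almost integral over it ([completely_closed_invU]): over the fraction field of
    [R_U] such a [y] is again a partial fraction ([poles_field_completely_closed]),
    and comparing the leading coefficients of [c y^n] at a pole shows that those
    of [y] are almost integral over [R_U] ([poles_completely_closed]).

    Cohen-Macaulay property.  The ring at a point [p] is local with residue field
    [k], and it is Noetherian because it is a localization of a finitely generated
    algebra.  An element of a prime ideal outside a smaller prime is transcendental
    modulo the smaller one over any family independent modulo the larger one, so a
    chain of [m] strict inclusions together with [e] elements independent in [k]
    gives [e + m] algebraically independent rational functions of degree zero
    ([chain_indep]).  There are at most [dim V - 1] of these, by a count of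
    polynomials of bounded degree over the finite field ([indep_bound]).  A regular
    sequence produces a chain of primes of the same length
    ([weakly_regular_chain]).  It therefore suffices to find a regular sequence
    and [e] independent residues that are [dim V - 1] elements in all
    ([cohen_macaulay_criterion]).

    These are built along a flag ([params_full]).  The vectors [v] such that [1/v]
    does not vanish at [p] form a subspace; take [x1 <> 0] in it, and let the flag
    run from the line of [x1] to this subspace and then to [V].  Each step adjoins
    partial fractions in [X = x/x1] and localizes.  As long as the flag stays in
    the subspace only the pole at [X = 0] matters: the residue of [1/X] is either
    transcendental over those obtained before, or annihilated by a monic polynomial,
    and the value at [1/X] of a lift of the latter is a new parameter.  Afterwards all the [1/(X - a)] lie in the
    maximal ideal, and their sum is the new parameter.  In both cases the parameter
    is monic at every pole, and such an element is regular modulo every ideal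
    extended from below, again by comparison of leading coefficients
    ([poles_regular_monic]). *)

Set Implicit Arguments.
Unset Strict Implicit.
Unset Printing Implicit Defensive.

Import GRing.Theory.
Local Open Scope ring_scope.
Local Open Scope quotient_scope.

(** * Ideals, regular sequences and chains of primes *)

Section Ideals.
Variable A : comNzRingType.
Implicit Types (I : A -> Prop) (s t : seq A).

Definition is_ideal I :=
  [/\ I 0, forall x y, I x -> I y -> I (x + y) & forall a x, I x -> I (a * x)].

(** Unlike the predicate on bundled ideals this includes the unit ideal, which is
    what induction on the number of variables needs. *)
Definition ideals_fg := forall I, is_ideal I -> exists s, forall x, I x <-> ideal_gen s x.

Lemma ideal_sum I n (F : nat -> A) : is_ideal I ->
  (forall i, (i < n)%N -> I (F i)) -> I (\sum_(i < n) F i).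
Proof.
move=> [I0 ID _] h; elim: n h => [|n IH] h; first by rewrite big_ord0.
by rewrite big_ord_recr; apply: ID; [apply: IH => i /ltnW; exact: h|exact: h].
Qed.

Lemma ideal_genP s : is_ideal (ideal_gen s).
Proof.
split.
- by exists (fun=> 0); rewrite big1 // => i _; rewrite mul0r.
- move=> x y [c ->] [d ->]; exists (fun i => c i + d i).
  by rewrite -big_split; apply: eq_bigr => i _; rewrite mulrDl.
- move=> a x [c ->]; exists (fun i => a * c i).
  by rewrite mulr_sumr; apply: eq_bigr => i _; rewrite mulrA.
Qed.

Lemma mem_ideal_gen s x : x \in s -> ideal_gen s x.
Proof.
move=> xs; exists (fun i => (i == index x s)%:R).
have h : (index x s < size s)%N by rewrite index_mem.
rewrite (bigD1 (Ordinal h)) //= eqxx mul1r nth_index // big1 ?addr0 // => i.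
by rewrite -val_eqE /= => /negbTE ->; rewrite mul0r.
Qed.

Lemma ideal_gen_min s I : is_ideal I -> (forall x, x \in s -> I x) ->
  forall x, ideal_gen s x -> I x.
Proof.
move=> hI h x [c ->]; apply: (@ideal_sum I _ (fun i => c i * s`_i)) => // i hi.
by case: hI => _ _; apply; apply/h/mem_nth.
Qed.

Lemma is_ideal_prime (P : idealr A) : is_ideal (fun x => x \in P).
Proof.
split; [exact: idealr0|by move=> x y; exact: rpredD|by move=> *; exact: idealMr].
Qed.

(** Krull's lemma for the multiplicative set of the [u * x ^+ n] with [u]
    outside [P]: it misses [I] because [x] is regular modulo [I], and an ideal
    maximal among those missing it is prime. *)
Lemma regular_prime_below I (P : prime_idealr A) (x : A) :
  is_ideal I -> (forall y, I y -> y \in P) ->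
  (forall y, I (x * y) -> I y) ->
  exists Q : prime_idealr A,
    [/\ forall y, I y -> y \in Q, {subset Q <= P} & x \notin Q].
Proof.
move=> [I0 ID IM] IP regx.
pose M y := exists u n, u \notin P /\ y = u * x ^+ n.
have M1 : M 1 by exists 1, 0; rewrite expr0 mulr1 idealr1.
have MM y z : M y -> M z -> M (y * z).
  move=> [u [n [hu ->]]] [v [m [hv ->]]]; exists (u * v), (n + m)%N.
  by rewrite prime_idealrM negb_or hu hv exprD mulrACA.
pose good (J : A -> Prop) :=
  [/\ is_ideal J, forall y, I y -> J y & forall y, J y -> ~ M y].
have goodI : good I.
  split=> // y Iy [u [n [hu e]]]; case/negP: hu; apply: IP.
  elim: n y Iy e => [|n IH] y Iy e; first by rewrite expr0 mulr1 in e; rewrite -e.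
  by apply: (IH (u * x ^+ n)) => //; apply: regx; rewrite mulrCA -exprS -e.
have [J [gJ maxJ]] : exists J : set A, (J = set0 \/ good J) /\
    forall K, (J `<` K)%classic -> ~ (K = set0 \/ good K).
  (* The empty set is admitted because chains may be empty. *)
  apply: Zorn_bigcup => F hF totF.
  have [[X FX gX]|noF] := pselect (exists2 X, F X & good X); last first.
    left; apply/seteqP; split=> // y [X FX Xy].
    case: (hF _ FX) => [X0|gX]; first by rewrite X0 in Xy.
    by case: noF; exists X.
  have gF Y y : F Y -> Y y -> good Y.
    by move=> /hF [->|].
  right; split.
  - split.
    + by exists X => //; case: gX => [[]].
    + move=> y z [Y FY Yy] [Z FZ Zz].
      have [[_ YD _] _ _] := gF _ _ FY Yy; have [[_ ZD _] _ _] := gF _ _ FZ Zz.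
      case: (totF _ _ FY FZ) => [YZ|ZY]; [exists Z|exists Y] => //.
        by apply: ZD => //; apply: YZ.
      by apply: YD => //; apply: ZY.
    + move=> a y [Y FY Yy]; exists Y => //.
      by have [[_ _ YM] _ _] := gF _ _ FY Yy; apply: YM.
  - by move=> y Iy; exists X => //; case: gX => _ h _; apply: h.
  - by move=> y [Y FY Yy]; have [_ _ h] := gF _ _ FY Yy; apply: h.
have {}gJ : good J.
  case: gJ => // J0; case: (maxJ I); last by right.
  by rewrite J0; split=> // /(_ _ I0).
case: gJ => [[J0 JD JM] IJ JnM].
have key y : ~ J y -> exists2 j, J j & exists a, M (j + a * y).
  move=> nJy; apply: contrapT => h.
  pose K z := exists2 j, J j & exists a, z = j + a * y.
  apply: (maxJ K).
    split=> [z Jz|]; first by exists z => //; exists 0; rewrite mul0r addr0.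
    move=> sub; apply: nJy; apply: sub.
    by exists 0 => //; exists 1; rewrite mul1r add0r.
  right; split.
  - split.
    + by exists 0 => //; exists 0; rewrite mul0r addr0.
    + move=> z w [j Jj [a ->]] [k Jk [b ->]]; exists (j + k); first exact: JD.
      by exists (a + b); ring.
    + move=> b z [j Jj [a ->]]; exists (b * j); first exact: JM.
      by exists (b * a); ring.
  - by move=> z /IJ Jz; exists z => //; exists 0; rewrite mul0r addr0.
  - by move=> z [j Jj [a ->]] Mz; apply: h; exists j => //; exists a.
pose Q : {pred A} := fun y => `[< J y >].
have Qid : idealr_closed Q.
  split; first exact/asboolP.
    by apply/asboolP => /JnM.
  move=> a y z /asboolP Jy /asboolP Jz; apply/asboolP.
  by apply: JD => //; apply: JM.
have Qpr : prime_idealr_closed Q.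
  move=> y z /asboolP Jyz; apply/orP; apply: contrapT => /not_orP [ny nz].
  have [j Jj [a Ma]] : exists2 j, J j & exists a, M (j + a * y).
    by apply: key => Jy; apply: ny; apply/asboolP.
  have [k Jk [b Mb]] : exists2 j, J j & exists a, M (j + a * z).
    by apply: key => Jz; apply: nz; apply/asboolP.
  apply: (JnM _ _ (MM _ _ Ma Mb)).
  have -> : (j + a * y) * (k + b * z) =
    (k + b * z) * j + ((a * y) * k + (a * b) * (y * z)) by ring.
  by apply: (JD); [apply: JM|apply: JD; apply: JM].
pose mx := isIdealr.Build A Q Qid.
pose mp := isPrimeIdealrClosed.Build A Q Qpr.
pose QQ : prime_idealr A := HB.pack Q mx mp.
exists QQ; split.
- by move=> y Iy; apply/asboolP/IJ.
- move=> y /asboolP Jy; apply: contrapT => /negP ny.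
  by apply: (JnM _ Jy); exists y, 0; rewrite expr0 mulr1.
- apply/negP => /asboolP /JnM; apply.
  by exists 1, 1; rewrite idealr1 expr1 mul1r.
Qed.

Definition weakly_regular s := forall i, (i < size s)%N -> forall y,
  ideal_gen (take i s) (s`_i * y) -> ideal_gen (take i s) y.

(** The half of [depth <= dimension] that needs no dimension theory: each element
    of the sequence is regular modulo the previous ones, so there is a strictly
    smaller prime that contains those but not it. *)
Lemma weakly_regular_chain s (P : prime_idealr A) :
  weakly_regular s -> (forall x, x \in s -> x \in P) ->
  exists C, prime_chain (size s) C /\ C (size s) = P.
Proof.
elim/last_ind: s P => [|s x IH] P reg sP; first by exists (fun=> P).
have [||y|Q [sQ QP xQ]] := @regular_prime_below (ideal_gen s) P x.
- exact: ideal_genP.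
- apply: ideal_gen_min; first exact: is_ideal_prime.
  by move=> y ys; apply: sP; rewrite mem_rcons inE ys orbT.
- have := reg (size s); rewrite size_rcons ltnSn nth_rcons ltnn eqxx.
  by rewrite -cats1 take_size_cat // => /(_ isT y).
have [||C [chC eC]] := IH Q.
- move=> i hi y; have := reg i; rewrite size_rcons (ltn_trans hi) // nth_rcons hi.
  by rewrite -cats1 takel_cat 1?ltnW // => /(_ isT y).
- by move=> y ys; apply: sQ; apply: mem_ideal_gen.
exists (fun i => if (i <= size s)%N then C i else P).
rewrite size_rcons ltnn; split=> // i; rewrite ltnS => hi; rewrite hi.
case: ltngtP hi => // [hi _|-> _]; first exact: chC.
by rewrite eC; split=> //; exists x => //; apply: sP; rewrite mem_rcons mem_head.
Qed.

End Ideals.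

Section Hilbert.
Variable D : comNzRingType.
Hypothesis ND : ideals_fg D.

(** Hilbert's basis theorem.  If [I] were not finitely generated one could pick
    [f k] of least degree in [I] outside the ideal of the previous ones; the
    leading coefficients generate a finitely generated ideal, so one of them
    combines the previous ones, and cancelling it contradicts minimality. *)
Lemma hilbert_basis : ideals_fg {poly D}.
Proof.
move=> I hI; apply: contrapT => nfg; case: (hI) => [I0 ID IM].
pose ok (s : seq {poly D}) := forall f, f \in s -> I f.
have ex s : exists f, ok s -> [/\ I f, ~ ideal_gen s f &
    forall g, I g -> ~ ideal_gen s g -> (size f <= size g)%N].
  have [oks|] := pselect (ok s); last by exists 0.
  have [f0 If0 nf0] : exists2 f, I f & ~ ideal_gen s f.
    apply: contrapT => h; apply: nfg; exists s => f; split=> [If|].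
      by apply: contrapT => nf; apply: h; exists f.
    exact: ideal_gen_min.
  pose Pn n := `[< exists f, [/\ I f, ~ ideal_gen s f & size f = n] >].
  have exn : exists n, Pn n by exists (size f0); apply/asboolP; exists f0.
  case: (ex_minnP exn) => n /asboolP [f [If nf sf]] minn.
  exists f => _; split=> // g Ig ng; rewrite sf; apply: minn.
  by apply/asboolP; exists g.
have {ex} [next nextP] := choice ex.
pose L := fix L k := if k is j.+1 then rcons (L j) (next (L j)) else [::].
pose f k := next (L k).
have LE k : L k = mkseq f k.
  by elim: k => // k IH; rewrite /= mkseqS -IH.
have okL k : ok (L k).
  elim: k => [|k IH] // g; rewrite /= mem_rcons inE => /orP [/eqP ->|]; last exact: IH.
  by case: (nextP _ IH).
have fI k : I (f k) by case: (nextP _ (okL k)).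
have fn k : ~ ideal_gen (L k) (f k) by case: (nextP _ (okL k)).
have fmin k g : I g -> ~ ideal_gen (L k) g -> (size (f k) <= size g)%N.
  by case: (nextP _ (okL k)) => _ _; apply.
have fL i k : (i < k)%N -> ideal_gen (L k) (f i).
  by move=> ik; apply: mem_ideal_gen; rewrite LE; apply/mapP; exists i => //; rewrite mem_iota.
have Lmono i k : (i <= k)%N -> forall g, ideal_gen (L i) g -> ideal_gen (L k) g.
  move=> ik; apply: ideal_gen_min; first exact: ideal_genP.
  move=> g; rewrite LE => /mapP [j]; rewrite mem_iota => /= hj ->.
  by apply: fL; apply: leq_trans ik.
have fsz i k : (i <= k)%N -> (size (f i) <= size (f k))%N.
  move=> ik; apply: fmin => // /(Lmono _ _ ik); exact: fn.
pose lc k := mkseq (fun i => lead_coef (f i)) k.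
have lcmono i k : (i <= k)%N -> forall a, ideal_gen (lc i) a -> ideal_gen (lc k) a.
  move=> ik; apply: ideal_gen_min; first exact: ideal_genP.
  move=> g /mapP [j]; rewrite mem_iota => /= hj ->.
  apply: mem_ideal_gen; apply/mapP; exists j => //.
  by rewrite mem_iota /= (leq_trans hj).
pose J a := exists n, ideal_gen (lc n) a.
have hJ : is_ideal J.
  split.
  - by exists 0; case: (ideal_genP (lc 0)).
  - move=> a b [n ha] [m hb]; exists (maxn n m).
    case: (ideal_genP (lc (maxn n m))) => _ h _; apply: h.
      by apply: lcmono ha; rewrite leq_maxl.
    by apply: lcmono hb; rewrite leq_maxr.
  - by move=> a b [n hb]; exists n; case: (ideal_genP (lc n)) => _ _; apply.
have [s sP] := ND hJ.
have [N hN] : exists N, forall a, a \in s -> ideal_gen (lc N) a.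
  have : forall a, a \in s -> J a by move=> a /mem_ideal_gen /sP.
  elim: s {sP} => [|a s IH] h; first by exists 0.
  have [N hN] := IH (fun b hb => h b (@mem_behead _ (a :: s) b hb)).
  have [n hn] := h a (mem_head a s).
  exists (maxn n N) => b; rewrite inE => /orP [/eqP ->|/hN hb].
    by apply: lcmono hn; rewrite leq_maxl.
  by apply: lcmono hb; rewrite leq_maxr.
have : ideal_gen (lc N) (lead_coef (f N)).
  apply: (ideal_gen_min (ideal_genP _) hN); apply/sP.
  by exists N.+1; apply: mem_ideal_gen; apply/mapP; exists N => //; rewrite mem_iota /=.
case=> c; rewrite size_mkseq => Ec.
(* Cancel the leading term of [f N] by multiples of the earlier [f i]. *)
pose h i := (c i)%:P * 'X^(size (f N) - size (f i)) * f i.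
pose g := f N - \sum_(i < N) h i.
have hh : ideal_gen (L N) (\sum_(i < N) h i).
  apply: ideal_sum; first exact: ideal_genP.
  by move=> i hi; case: (ideal_genP (L N)) => _ _; apply; exact: fL.
have Ig : I g.
  apply: ID => //; rewrite -mulN1r; apply: IM.
  exact: (ideal_gen_min hI (@okL N)).
have ng : ~ ideal_gen (L N) g.
  move=> hg; apply: (fn N); have -> : f N = g + \sum_(i < N) h i by rewrite subrK.
  by case: (ideal_genP (L N)) => _ h' _; apply: h'.
have f0 i : f i != 0.
  by apply/eqP => e; apply: (fn i); rewrite e; case: (ideal_genP (L i)).
have := fmin N _ Ig ng; apply/negP; rewrite -ltnNge.
have sN : (0 < size (f N))%N by rewrite lt0n size_poly_eq0.
rewrite -(prednK sN) ltnS; apply/leq_sizeP => j.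
rewrite leq_eqVlt => /orP [/eqP <-|hj].
  rewrite coefB coef_sum -[X in X - _]/(lead_coef _) Ec.
  rewrite -sumrB big1 // => i _.
  rewrite /h -mulrA coefCM coefXnM (nth_mkseq _ _ (ltn_ord i)).
  have si := fsz i N (ltnW (ltn_ord i)).
  have fi : (0 < size (f i))%N by rewrite lt0n size_poly_eq0.
  have e1 : (size (f N) - size (f i) <= (size (f N)).-1)%N by lia.
  have e2 : ((size (f N)).-1 - (size (f N) - size (f i)) = (size (f i)).-1)%N by lia.
  by rewrite ltnNge e1 /= e2 subrr.
rewrite coefB coef_sum nth_default; last by rewrite -(prednK sN).
rewrite big1 ?subr0 // => i _; rewrite /h -mulrA coefCM coefXnM.
have si := fsz i N (ltnW (ltn_ord i)).
have fi : (0 < size (f i))%N by rewrite lt0n size_poly_eq0.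
rewrite ltnNge (leq_trans (leq_subr _ _)) /=; last by rewrite -(prednK sN).
rewrite nth_default ?mulr0 //.
move: hj si; rewrite (prednK sN) => hj si.
by rewrite -[X in (X <= _)%N](subKn si) leq_sub2r.
Qed.

End Hilbert.

Lemma ideals_fg_field (F : fieldType) : ideals_fg F.
Proof.
move=> I [I0 ID IM].
have [[x Ix x0]|h] := pselect (exists2 x, I x & x != 0).
  exists [:: 1] => y; split=> _; first by exists (fun=> y); rewrite big_ord1 mulr1.
  by rewrite -[y](mulfK x0); rewrite -mulrA [x * _]mulrC mulrA; apply: IM.
exists [::] => y; split=> [Iy|[c ->]]; last by rewrite big_ord0.
exists (fun=> 0); rewrite big_ord0; apply: contrapT => /eqP y0.
by apply: h; exists y.
Qed.

(** Noetherianity passes to any ring whose elements are fractions of images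
    with unit denominators: an ideal is generated by the images of generators
    of its preimage. *)
Lemma noetherian_fractions (B A : comNzRingType) (f : {rmorphism B -> A}) : ideals_fg B ->
  (forall a, exists b u, is_unit (f u) /\ a * f u = f b) -> noetherian A.
Proof.
move=> NB loc I.
have [|s sP] := NB (fun b => f b \in I).
  split; first by rewrite rmorph0 idealr0.
    by move=> x y hx hy; rewrite rmorphD rpredD.
  by move=> a x hx; rewrite rmorphM idealMr.
exists (map f s) => x; split=> [xI|]; last first.
  apply: (@ideal_gen_min _ _ (fun y => y \in I)); first exact: is_ideal_prime.
  by move=> y /mapP [b /mem_ideal_gen /sP hb ->].
have [b [u [[v uv] e]]] := loc x.
have /sP : f b \in I by rewrite -e mulrC idealMr.
case=> c Ec; exists (fun i => v * f (c i)).
rewrite -[x]mulr1 -uv mulrA e Ec rmorph_sum mulr_suml size_map.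
apply: eq_bigr => i _; rewrite rmorphM (nth_map 0) //; ring.
Qed.

(** * Algebraic independence modulo an ideal *)

Section NestedPolynomials.

(** Polynomials in [n] variables, the last one outermost.  Adjoining a variable
    is then definitional, which suits both the basis theorem and the extension of
    independent families one element at a time. *)
Fixpoint npoly (R : comNzRingType) n : comNzRingType :=
  if n is k.+1 then {poly (npoly R k)} : comNzRingType else R.

Variables (R A : comNzRingType) (f : {rmorphism R -> A}).

Fixpoint npeval (x : nat -> A) n : {rmorphism npoly R n -> A} :=
  if n is k.+1 return {rmorphism npoly R n -> A} then
    horner_morph (fun a => mulrC (x k) (npeval x k a))
  else f.

Lemma npevalS x n (p : {poly npoly R n}) :
  npeval x n.+1 p = (map_poly (npeval x n) p).[x n].
Proof. by []. Qed.

Lemma eq_npeval x y n : (forall i, (i < n)%N -> x i = y i) ->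
  npeval x n =1 npeval y n.
Proof.
elim: n => // n IH h p; rewrite !npevalS h //; congr _.[_].
by apply: eq_map_poly => a; apply: IH => i hi; apply/h/ltnW.
Qed.

(** Algebraic independence modulo [Q]; for [Q] the zero ideal this is the usual
    notion. *)
Definition indep_mod (Q : A -> Prop) x n := forall p, Q (npeval x n p) -> p = 0.

Lemma indep_mod_ext (Q : A -> Prop) x y n : (forall i, (i < n)%N -> x i = y i) ->
  indep_mod Q x n -> indep_mod Q y n.
Proof. by move=> /eq_npeval e h p; rewrite -e; apply: h. Qed.

Lemma indep_mod_transc (Q : A -> Prop) x n :
  (forall p : {poly npoly R n}, Q (npeval x n.+1 p) ->
     forall i, Q (npeval x n p`_i)) ->
  indep_mod Q x n -> indep_mod Q x n.+1.
Proof. by move=> h ind p /h hp; apply/polyP => i; rewrite coef0; apply: ind. Qed.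

(** An element of [Q] outside a smaller prime [P] is transcendental over any
    family independent modulo [Q]: the constant term of a relation modulo [P]
    lies in [Q], hence vanishes, and the new element can be divided out. *)
Lemma indep_mod_below (P : prime_idealr A) (Q : idealr A) x n :
  {subset P <= Q} -> x n \in Q -> x n \notin P ->
  indep_mod (fun a => a \in Q) x n -> indep_mod (fun a => a \in P) x n.+1.
Proof.
move=> PQ xQ xP ind; elim/poly_ind => // p c IH.
have -> : npeval x n.+1 (p * 'X + c%:P) = npeval x n.+1 p * x n + npeval x n c.
  by rewrite npevalS rmorphD rmorphM /= map_polyX map_polyC hornerMXaddC.
move=> hP; have c0 : c = 0.
  apply: ind; rewrite -[npeval x n c](addKr (npeval x n.+1 p * x n)).
  by apply: rpredD; [rewrite rpredN; apply: idealMr|apply: PQ].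
move: hP; rewrite c0 [npeval x n 0](rmorph0 (npeval x n)) addr0.
rewrite prime_idealrM (negbTE xP) orbF => hp.
by rewrite (IH hp) mul0r add0r.
Qed.

(** Each strict inclusion in a chain of primes adds one independent element. *)
Lemma chain_indep (C : nat -> prime_idealr A) m (Q : idealr A) x n :
  prime_chain m C -> {subset C m <= Q} -> indep_mod (fun a => a \in Q) x n ->
  exists y, indep_mod (fun a => a \in C 0) y (n + m).
Proof.
move=> chC CQ ind.
have {}ind : indep_mod (fun a => a \in C m) x n.
  by move=> p hp; apply: ind; apply: CQ.
elim: m x n chC {CQ} ind => [|m IH] x n chC ind.
  by exists x; rewrite addn0.
have [sub [a aC aC']] := chC m (ltnSn m).
pose y i := if i == n then a else x i.
have yn : y n = a by rewrite /y eqxx.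
rewrite -addSnnS; apply: (IH y).
  by move=> i hi; apply: chC; apply: ltnW.
apply: (@indep_mod_below _ (C m.+1)); rewrite ?yn //.
apply: indep_mod_ext ind => i hi; by rewrite /y ltn_eqF.
Qed.

End NestedPolynomials.

Lemma npeval_comp (R A B : comNzRingType) (f : {rmorphism R -> A})
    (g : {rmorphism A -> B}) (h : {rmorphism R -> B}) x n p :
  g \o f =1 h -> g (npeval f x n p) = npeval h (g \o x) n p.
Proof.
move=> e; elim: n p => [|n IH] p; first exact: e.
rewrite !npevalS -horner_map -map_poly_comp; congr _.[_].
exact: eq_map_poly.
Qed.

Lemma npeval_const (R A : comNzRingType) (f : {rmorphism R -> A}) x n a :
  exists p, npeval f x n p = f a.
Proof.
elim: n => [|n [p e]]; first by exists a.
by exists p%:P; rewrite npevalS map_polyC hornerC.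
Qed.

Lemma npeval_var (R A : comNzRingType) (f : {rmorphism R -> A}) x n i :
  (i < n)%N -> exists p, npeval f x n p = x i.
Proof.
elim: n => // n IH; rewrite ltnS leq_eqVlt => /orP [/eqP ->|/IH [p e]].
  by exists 'X; rewrite npevalS map_polyX hornerX.
by exists p%:P; rewrite npevalS map_polyC hornerC.
Qed.

Lemma ideals_fg_npoly (F : fieldType) n : ideals_fg (npoly F n).
Proof. by elim: n => [|n IH]; [exact: ideals_fg_field|exact: hilbert_basis]. Qed.

(** * Bounding algebraic independence by counting *)

Section Counting.
Variables (F : finFieldType).

(** A finite type, so that the polynomials of degree at most [M] in each variable
    can be counted. *)
Fixpoint coefT M n : finType :=
  if n is k.+1 then {ffun 'I_M.+1 -> coefT M k} : finType else F.

Fixpoint coef_npoly M n : coefT M n -> npoly F n :=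
  match n return coefT M n -> npoly F n with
  | 0 => fun c => c
  | k.+1 => fun c => \poly_(i < M.+1) @coef_npoly M k (c (inord i))
  end.

Lemma card_coefT M n : #|coefT M n| = (#|F| ^ (M.+1 ^ n))%N.
Proof.
elim: n => [|n IH] /=; first by rewrite expn0 expn1.
by rewrite card_ffun card_ord IH -expnM expnSr.
Qed.

Lemma coef_npoly_inj M n : injective (@coef_npoly M n).
Proof.
elim: n => // n IH c c' /= /polyP e; apply/ffunP => i; apply: IH.
by move: (e i); rewrite !coef_poly ltn_ord inord_val.
Qed.

Section MonomialOfDegree.
Variables (e k : nat).

(* A monomial of degree [e] is determined by all its exponents but one. *)
Definition monomial (a : {ffun 'I_k -> 'I_e.+1}) : 'X_{1..k.+1} :=
  [multinom (if unlift ord0 i is Some j then a j : nat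
             else (e - \sum_(j < k) a j)%N) | i < k.+1].

Lemma monomial_onto (m : 'X_{1..k.+1}) : mdeg m = e -> exists a, monomial a = m.
Proof.
move=> me; exists [ffun j => inord (m (lift ord0 j))].
have hE (j : 'I_k) : ([ffun j => inord (m (lift ord0 j))] : {ffun 'I_k -> 'I_e.+1}) j
    = m (lift ord0 j) :> nat.
  rewrite ffunE inordK // ltnS -me mdegE.
  by rewrite (bigD1 (lift ord0 j)) //= leq_addr.
apply/mnmP => i; rewrite mnmE; case: unliftP => [j ->|->]; first exact: hE.
under eq_bigr => j _ do rewrite hE.
by rewrite -me mdegE big_ord_recl addnK.
Qed.

Lemma homog_coef_inj (P Q : {mpoly F[k.+1]}) :
  P \is e.-homog -> Q \is e.-homog -> (forall a, P@_(monomial a) = Q@_(monomial a)) ->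
  P = Q.
Proof.
move=> hP hQ h; apply/mpolyP => m.
have [me|me] := eqVneq (mdeg m) e.
  by have [a <-] := monomial_onto me.
by rewrite (dhomog_nemf_coeff hP) // (dhomog_nemf_coeff hQ).
Qed.

End MonomialOfDegree.

Section Bound.
Variables (k D n : nat).
Local Notation S := {mpoly F[k.+1]}.
Local Notation K := {fraction S}.
Variables (f : {rmorphism F -> K}) (fE : forall a, f a = FracField.tofrac a%:MP).
Variables (Q : S) (y : nat -> K).
Hypotheses (Q0 : Q != 0) (hQ : Q \is D.-homog).
Hypothesis hy : forall i, (i < n)%N ->
  exists2 P : S, P \is D.-homog & y i * FracField.tofrac Q = FracField.tofrac P.

Lemma dhomog_expr (P : S) d i : P \is d.-homog -> P ^+ i \is (d * i).-homog.
Proof.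
move=> hP; elim: i => [|i IH]; first by rewrite muln0 dhomog1.
by rewrite exprS mulnS; apply: dhomogM.
Qed.

(** Clearing denominators turns the value of a polynomial of bounded degree into
    a homogeneous polynomial whose degree is linear in that bound. *)
Lemma npeval_homog M j (c : coefT M j) : (j <= n)%N ->
  exists2 P : S, P \is (D * (j * M)).-homog &
    npeval f y j (coef_npoly c) * FracField.tofrac Q ^+ (j * M) = FracField.tofrac P.
Proof.
elim: j c => [|j IH] c hj.
  exists (c%:MP); last by rewrite expr0 mulr1 /= fE.
  by rewrite mul0n muln0 -[c%:MP]mulr1 mul_mpolyC; apply/rpredZ/dhomog1.
have /choice [P hP] : forall i, exists P : S, P \is (D * (j * M)).-homog /\
    npeval f y j (coef_npoly (c i)) * FracField.tofrac Q ^+ (j * M) = FracField.tofrac P.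
  by move=> i; have [P] := IH (c i) (ltnW hj); exists P.
have [Y hY eY] := hy hj.
exists (\sum_(i < M.+1) P i * (Y ^+ i * Q ^+ (M - i))).
  apply: rpred_sum => i _.
  have -> : (D * (j.+1 * M) = D * (j * M) + (D * i + D * (M - i)))%N.
    by rewrite -!mulnDr mulSn subnKC 1?addnC // -ltnS.
  apply: dhomogM; first by case: (hP i).
  by apply: dhomogM; apply: dhomog_expr.
rewrite npevalS (@horner_coef_wide _ M.+1); last first.
  exact: leq_trans (size_poly _ _) (size_poly _ _).
rewrite mulr_suml rmorph_sum; apply: eq_bigr => i _.
rewrite coef_map coef_poly ltn_ord inord_val !rmorphM !rmorphXn /= -(proj2 (hP i)) -eY.
have -> : (j.+1 * M = j * M + (i + (M - i)))%N.
  by rewrite mulSn subnKC 1?addnC // -ltnS.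
by rewrite !exprD exprMn; ring.
Qed.

(** The transcendence degree bound by counting: [n] independent elements give
    [#|F| ^ (M.+1 ^ n)] distinct values of bounded degree, while homogeneous
    polynomials of degree [D * n * M] in [k.+1] variables number at most
    [#|F| ^ ((D * n * M).+1 ^ k)]. *)
Lemma indep_card M : indep_mod f (fun a => a = 0) y n ->
  (M.+1 ^ n <= (D * (n * M)).+1 ^ k)%N.
Proof.
move=> ind.
have /choice [P hP] : forall c : coefT M n, exists P : S,
    P \is (D * (n * M)).-homog /\
    npeval f y n (coef_npoly c) * FracField.tofrac Q ^+ (n * M) = FracField.tofrac P.
  by move=> c; have [P] := npeval_homog c (leqnn n); exists P.
pose g c : {ffun {ffun 'I_k -> 'I_(D * (n * M)).+1} -> F} := [ffun a => (P c)@_(monomial a)].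
have ginj : injective g.
  move=> c c' /ffunP e; apply: coef_npoly_inj; apply/eqP; rewrite -subr_eq0; apply/eqP.
  apply: ind; rewrite rmorphB; apply/eqP; rewrite subr_eq0.
  have Q0' : FracField.tofrac Q ^+ (n * M) != 0 by rewrite expf_neq0 // tofrac_eq0.
  rewrite -(inj_eq (mulIf Q0')) !(proj2 (hP _)); apply/eqP; congr FracField.tofrac.
  apply: (homog_coef_inj (proj1 (hP c)) (proj1 (hP c'))) => a.
  by have := e a; rewrite !ffunE.
have := leq_card g ginj; rewrite card_coefT !card_ffun !card_ord.
by rewrite leq_exp2l // card_finNzRing_gt1.
Qed.

Lemma indep_bound : indep_mod f (fun a => a = 0) y n -> (n <= k)%N.
Proof.
move=> ind; rewrite leqNgt; apply/negP => kn.
have n0 : (0 < n)%N by apply: leq_ltn_trans kn.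
(* With this [M] the left side of [indep_card], of order [M ^ n], wins. *)
pose M := ((D.+1 * n) ^ k)%N.
have := indep_card M ind; apply/negP; rewrite -ltnNge.
have h1 : ((D * (n * M)).+1 ^ k <= M * M.+1 ^ k)%N.
  have [->|k0] := posnP k; first by rewrite !expn0 muln1 /M expn_gt0 muln_gt0 n0.
  rewrite -expnMn leq_exp2r //; move: M => M; nia.
apply: leq_ltn_trans h1 _; apply: (@leq_trans (M.+1 ^ k.+1)).
  by rewrite expnS ltn_pmul2r // expn_gt0.
exact: leq_pexp2l.
Qed.

End Bound.

Lemma indep_homog_bound d D n (f : {rmorphism F -> {fraction {mpoly F[d]}}})
    (Q : {mpoly F[d]}) y :
  (0 < d)%N -> (forall a, f a = FracField.tofrac a%:MP) -> Q != 0 -> Q \is D.-homog ->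
  (forall i, (i < n)%N -> exists2 P : {mpoly F[d]}, P \is D.-homog &
    y i * FracField.tofrac Q = FracField.tofrac P) ->
  indep_mod f (fun a => a = 0) y n -> (n <= d.-1)%N.
Proof.
case: d f Q y => // k f Q y _ fE Q0 hQ hy.
exact: (@indep_bound k D n f fE Q y Q0 hQ hy).
Qed.

End Counting.

(** * Rings of partial fractions *)

Definition hornerDMX (R : comNzRingType) :=
  (@hornerXsubC R, @horner_exp R, @hornerM R, @hornerD R, @hornerN R).

Lemma polyOver_coef (R : nzRingType) (J : zmodClosed R) (p : {poly R}) i :
  p \is a polyOver J -> p`_i \in J.
Proof. by move/polyOverP. Qed.

Section Poles.
Variables (K : fieldType) (K' : divringClosed K) (X : K) (S : seq K).
Hypothesis trX : forall P, P \is a polyOver K' -> P.[X] = 0 -> P = 0.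
Hypothesis uS : uniq S.
Hypothesis SK : forall a, a \in S -> a \in K'.

(** A partial fraction expansion without polynomial part: [c] is the value at
    infinity and [p a] holds the coefficients of the powers of [(X - a)^-1],
    shifted by one so that the expansion is unique. *)
Definition pexp (c : K) (p : K -> {poly K}) : K :=
  c + \sum_(a <- S) (X - a)^-1 * (p a).[(X - a)^-1].

Lemma poleP a : a \in S -> 'X - a%:P \is a polyOver K'.
Proof. by move=> /SK aK; rewrite polyOverXsubC. Qed.

Lemma pole_neq0 a : a \in S -> X - a != 0.
Proof.
move=> aS; apply/eqP => e; have := trX (poleP aS).
by rewrite hornerXsubC => /(_ e) /eqP; rewrite polyXsubC_eq0.
Qed.

(** Clearing the denominator of one polar part reverses its coefficients, so the
    leading one becomes the value at the pole. *)
Lemma pexp_rev a (q : {poly K}) : a \in S -> q \is a polyOver K' ->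
  exists r, [/\ r \is a polyOver K',
    (X - a)^-1 * q.[(X - a)^-1] * (X - a) ^+ size q = r.[X] &
    r.[a] = lead_coef q].
Proof.
move=> aS /polyOverP hq; have Xa := pole_neq0 aS.
exists (\sum_(j < size q) q`_j *: ('X - a%:P) ^+ ((size q).-1 - j)); split.
- apply: rpred_sum => j _; apply: polyOverZ => //.
  by apply: rpredX; apply: poleP.
- rewrite horner_coef mulr_sumr mulr_suml horner_sum; apply: eq_bigr => j _.
  rewrite hornerZ horner_exp hornerXsubC.
  case: j => i /=; move: (q`_i) => e; move: (size q) => s hi.
  have -> : s = (s.-1 - i + i.+1)%N by lia.
  rewrite addnS /= addnK exprS exprD exprVn.
  by field; rewrite Xa expf_neq0.
- have [->|q0] := eqVneq q 0.
    by rewrite lead_coef0 size_poly0 big_ord0 horner0.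
  have sq : (0 < size q)%N by rewrite lt0n size_poly_eq0.
  have h : ((size q).-1 < size q)%N by rewrite prednK.
  rewrite horner_sum (bigD1 (Ordinal h)) //= subnn expr0 hornerZ hornerC mulr1.
  rewrite big1 ?addr0 // => j; rewrite -val_eqE /= => hj.
  rewrite hornerZ horner_exp hornerXsubC subrr expr0n.
  have -> : ((size q).-1 - j == 0)%N = false.
    by case: j hj => i /=; move: (size q) => s; lia.
  by rewrite mulr0.
Qed.

Lemma pexp_regular a c (p : K -> {poly K}) (T : seq K) :
  {subset T <= S} -> a \notin T -> c \in K' -> (forall b, p b \is a polyOver K') ->
  exists P W, [/\ P \is a polyOver K', W \is a polyOver K', W.[a] != 0 &
    (c + \sum_(b <- T) (X - b)^-1 * (p b).[(X - b)^-1]) * W.[X] = P.[X]].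
Proof.
move=> TS aT cK hp; elim: T TS aT => [|b T IH] TS.
  exists c%:P, 1; split; rewrite ?hornerC ?oner_neq0 ?polyOverC ?rpred1 //.
  by rewrite big_nil addr0 mulr1.
rewrite inE negb_or => /andP [ab aT].
have [|P [W [hP hW W0 e]]] := IH _ aT.
  by move=> x xT; apply: TS; rewrite inE xT orbT.
have bS : b \in S by apply: TS; rewrite mem_head.
have [r [hr er _]] := pexp_rev bS (hp b).
have hb : ('X - b%:P) ^+ size (p b) \is a polyOver K' by apply/rpredX/poleP.
exists (P * ('X - b%:P) ^+ size (p b) + r * W), (W * ('X - b%:P) ^+ size (p b)).
split; rewrite ?rpredD ?rpredM //.
  by rewrite hornerM horner_exp hornerXsubC mulf_neq0 // expf_neq0 // subr_eq0.
rewrite big_cons !hornerDMX -er -e; ring.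
Qed.

Lemma pexp_lead a c (p : K -> {poly K}) :
  a \in S -> c \in K' -> (forall b, p b \is a polyOver K') ->
  exists P W, [/\ P \is a polyOver K', W \is a polyOver K', W.[a] != 0,
    pexp c p * (X - a) ^+ size (p a) * W.[X] = P.[X] &
    (0 < size (p a))%N -> P.[a] = lead_coef (p a) * W.[a]].
Proof.
move=> aS cK hp.
have aT : a \notin [seq b <- S | b != a] by rewrite mem_filter eqxx.
have [|P [W [hP hW W0 e]]] := pexp_regular _ aT cK hp.
  by move=> b; rewrite mem_filter => /andP [].
have [r [hr er ra]] := pexp_rev aS (hp a).
have ha : ('X - a%:P) ^+ size (p a) \is a polyOver K' by apply/rpredX/poleP.
exists (P * ('X - a%:P) ^+ size (p a) + r * W), W; split=> //.
- by rewrite rpredD ?rpredM.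
- rewrite /pexp (bigD1_seq a) //= -big_filter !hornerDMX -er -e; ring.
- move=> sp; rewrite !hornerDMX ra subrr expr0n eqn0Ngt sp /=; ring.
Qed.

(** Polynomial identities in [X] are identities of polynomials, so the order
    of a pole and the leading coefficient there can be read off from any
    fraction of polynomials in [X]. *)
Lemma pexp_coef a c (p : K -> {poly K}) n (P Q : {poly K}) :
  a \in S -> c \in K' -> (forall b, p b \is a polyOver K') ->
  P \is a polyOver K' -> Q \is a polyOver K' -> Q.[a] != 0 ->
  pexp c p * (X - a) ^+ n * Q.[X] = P.[X] ->
  (size (p a) <= n)%N /\ ((0 < n)%N -> (p a)`_n.-1 * Q.[a] = P.[a]).
Proof.
move=> aS cK hp hP hQ Q0 e; set k := size (p a).
have [R [W [hR hW W0 eR leadR]]] := pexp_lead aS cK hp.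
have ha i : ('X - a%:P) ^+ i \is a polyOver K' by apply/rpredX/poleP.
have a0 i : ('X - a%:P) ^+ i != 0 by rewrite expf_neq0 // polyXsubC_eq0.
have E : P * W * ('X - a%:P) ^+ k = R * Q * ('X - a%:P) ^+ n.
  apply/eqP; rewrite -subr_eq0; apply/eqP; apply: trX.
    by rewrite rpredB ?rpredM.
  by rewrite !hornerDMX -e -eR -/k; ring.
have [nk|kn] := ltnP n k.
  have : P * W * ('X - a%:P) ^+ (k - n) = R * Q.
    by apply: (mulIf (a0 n)); rewrite -[LHS]mulrA -exprD subnK ?E // ltnW.
  move=> /(congr1 (horner^~ a)); rewrite !hornerDMX subrr expr0n.
  rewrite subn_eq0 leqNgt nk mulr0 leadR; last exact: leq_ltn_trans nk.
  move/esym/eqP; rewrite !mulf_eq0 (negbTE W0) (negbTE Q0) !orbF lead_coef_eq0.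
  by rewrite -size_poly_eq0 -/k => /eqP k0; rewrite k0 in nk.
split=> // n0.
have EE : P * W = R * Q * ('X - a%:P) ^+ (n - k).
  by apply: (mulIf (a0 k)); rewrite E -[RHS]mulrA -exprD subnK.
apply: (mulIf W0); move: EE => /(congr1 (horner^~ a)); rewrite !hornerDMX => ->.
rewrite subrr expr0n subn_eq0; have [nk|nk] := leqP n k.
  have nkE : n = k by apply/eqP; rewrite eqn_leq nk kn.
  rewrite mulr1 leadR -/k -?nkE // lead_coefE -/k -nkE; ring.
by rewrite nth_default -?/k ?mulr0 ?mul0r // -ltnS prednK.
Qed.

Lemma pexp_eq0 c (p : K -> {poly K}) : c \in K' -> (forall b, p b \is a polyOver K') ->
  pexp c p = 0 -> c = 0 /\ forall a, a \in S -> p a = 0.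
Proof.
move=> cK hp e.
have p0 a : a \in S -> p a = 0.
  move=> aS; apply/eqP; rewrite -size_poly_eq0 -leqn0.
  have [] // := @pexp_coef a c p 0 0 1 aS cK hp; rewrite ?rpred0 ?rpred1 //.
    by rewrite hornerC oner_neq0.
  by rewrite e !mul0r horner0.
split=> //; move: e; rewrite /pexp big_seq big1 ?addr0 // => a /p0 ->.
by rewrite horner0 mulr0.
Qed.

Lemma pexpB c d p q : pexp c p - pexp d q = pexp (c - d) (fun a => p a - q a).
Proof.
rewrite /pexp opprD addrACA -sumrB; congr (_ + _); apply: eq_bigr => a _.
by rewrite hornerD hornerN mulrBr.
Qed.

Lemma pexpZ f c p : f * pexp c p = pexp (f * c) (fun a => f *: p a).
Proof.
rewrite /pexp mulrDr mulr_sumr; congr (_ + _); apply: eq_bigr => a _.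
by rewrite hornerZ mulrCA.
Qed.

Lemma pexp_inj c d p q : c \in K' -> d \in K' ->
  (forall b, p b \is a polyOver K') -> (forall b, q b \is a polyOver K') ->
  pexp c p = pexp d q -> c = d /\ forall a, a \in S -> p a = q a.
Proof.
move=> cK dK hp hq /eqP; rewrite -subr_eq0 pexpB => /eqP e.
have [||/eqP h1 h2] := pexp_eq0 _ _ e; first exact: rpredB.
  by move=> b; apply: rpredB.
split; first by apply/eqP; rewrite -subr_eq0.
by move=> a /h2 /eqP; rewrite subr_eq0 => /eqP.
Qed.

(** The step of every induction on the total order of the poles. *)
Lemma pexp_drop a c (p : K -> {poly K}) : a \in S -> p a != 0 -> exists p',
  [/\ forall J : zmodClosed K, (forall b, p b \is a polyOver J) ->
         forall b, p' b \is a polyOver J,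
      (\sum_(b <- S) size (p' b) < \sum_(b <- S) size (p b))%N &
      pexp c p = pexp c p' + lead_coef (p a) * (X - a) ^- size (p a)].
Proof.
move=> aS pa0; set n := size (p a); set l := lead_coef _.
have n0 : (0 < n)%N by rewrite lt0n size_poly_eq0.
exists (fun b => if b == a then p a - l *: 'X^(n.-1) else p b); split.
- move=> J hp b; case: eqP => // _; apply/polyOverP => i.
  rewrite coefB coefZ coefXn; case: eqP => [->|_].
    by rewrite mulr1 /l lead_coefE subrr rpred0.
  by rewrite mulr0 subr0; apply: polyOver_coef.
- rewrite !(bigD1_seq a) //= eqxx -addSn leq_add //; last first.
    by apply: leq_sum => b /negbTE ->.
  rewrite -/n -[X in (_ < X)%N](prednK n0) ltnS; apply/leq_sizeP => j.
  rewrite coefB coefZ coefXn leq_eqVlt => /orP [/eqP <-|hj].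
    by rewrite eqxx mulr1 /l lead_coefE subrr.
  rewrite gtn_eqF // mulr0 subr0 nth_default // -/n.
  by rewrite -(prednK n0).
- rewrite /pexp -addrA; congr (_ + _).
  rewrite !(bigD1_seq a) //= eqxx addrAC; congr (_ + _); last first.
    by apply: eq_bigr => b /negbTE ->.
  have Xa := pole_neq0 aS.
  have -> : (X - a) ^+ n = (X - a) * (X - a) ^+ n.-1 by rewrite -exprS prednK.
  rewrite hornerD hornerN hornerZ hornerXn exprVn.
  by field; rewrite expf_neq0.
Qed.

(** For a ring [J] containing the inverses of the differences of the poles this is
    the ring generated over [J] by the [(X - a)^-1]; for an ideal of such a ring it
    is the extended ideal. *)
Definition poles (J : {pred K}) : {pred K} := fun e =>
  `[< exists c p, [/\ c \in J, forall a, p a \is a polyOver J & e = pexp c p] >].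

Lemma polesP (J : {pred K}) e : e \in poles J -> 
  exists c p, [/\ c \in J, forall a, p a \is a polyOver J & e = pexp c p].
Proof. by move/asboolP. Qed.

Lemma poles_closed (J : zmodClosed K) : zmod_closed (poles J).
Proof.
split.
  apply/asboolP; exists 0, (fun=> 0); split; [exact: rpred0|move=> a; exact: rpred0|].
  by rewrite /pexp add0r big1 // => a _; rewrite horner0 mulr0.
move=> _ _ /asboolP [c [p [hc hp ->]]] /asboolP [d [q [hd hq ->]]].
apply/asboolP; exists (c - d), (fun a => p a - q a).
by split; [exact: rpredB|move=> a; exact: rpredB|rewrite pexpB].
Qed.
HB.instance Definition _ (J : zmodClosed K) :=
  GRing.isZmodClosed.Build K (poles J) (poles_closed J).

Lemma poles_const (J : zmodClosed K) c : c \in J -> c \in poles J.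
Proof.
move=> cJ; apply/asboolP; exists c, (fun=> 0); split=> // [a|]; first exact: rpred0.
by rewrite /pexp big1 ?addr0 // => a _; rewrite horner0 mulr0.
Qed.

Lemma poles_monom (J : zmodClosed K) c a n :
  c \in J -> a \in S -> c * (X - a) ^- n \in poles J.
Proof.
move=> cJ aS; case: n => [|n]; first by rewrite expr0 invr1 mulr1 poles_const.
apply/asboolP; exists 0, (fun b => if b == a then c *: 'X^n else 0); split.
- exact: rpred0.
- move=> b; case: eqP => _; last exact: rpred0.
  apply/polyOverP => i; rewrite coefZ coefXn; case: eqP => _.
    by rewrite mulr1.
  by rewrite mulr0 rpred0.
rewrite /pexp add0r (bigD1_seq a) //= eqxx big1 => [|b /negbTE ->]; last first.
  by rewrite horner0 mulr0.
by rewrite addr0 hornerZ hornerXn mulrCA -exprS exprVn.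
Qed.

Lemma pexp_monomials c p : pexp c p =
  c + \sum_(a <- S) \sum_(j < size (p a)) (p a)`_j * (X - a) ^- j.+1.
Proof.
congr (_ + _); apply: eq_bigr => a _; rewrite horner_coef mulr_sumr.
by apply: eq_bigr => j _; rewrite mulrCA -exprS exprVn.
Qed.

Lemma poles_ind (J : zmodClosed K) (Q : zmodClosed K) :
  (forall c, c \in J -> c \in Q) ->
  (forall c a n, c \in J -> a \in S -> c * (X - a) ^- n \in Q) ->
  {subset poles J <= Q}.
Proof.
move=> h0 h1 _ /asboolP [c [p [hc hp ->]]]; rewrite pexp_monomials.
apply: rpredD; first exact: h0.
rewrite big_seq; apply: rpred_sum => a aS; apply: rpred_sum => j _.
by apply: h1 => //; apply: polyOver_coef.
Qed.

Section Product.
Variable D : subringClosed K.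
Hypothesis DS : forall a b, a \in S -> b \in S -> a != b -> (a - b)^-1 \in D.

Section Module.
Variable J : zmodClosed K.
Hypothesis DJ : forall d x, d \in D -> x \in J -> d * x \in J.

Lemma poles_scale d y : d \in D -> y \in poles J -> d * y \in poles J.
Proof.
move=> hd /asboolP [c [p [hc hp ->]]]; rewrite pexpZ; apply/asboolP.
exists (d * c), (fun a => d *: p a); split=> //; first exact: DJ.
move=> a; apply/polyOverP => i; rewrite coefZ; apply: DJ => //.
exact/polyOverP.
Qed.

(** Products of poles are separated by
    [(X - a)^-1 * (X - b)^-1 = (a - b)^-1 * ((X - a)^-1 - (X - b)^-1)]. *)
Lemma poles_mulpole b y : b \in S -> y \in poles J -> y * (X - b)^-1 \in poles J.
Proof.
move=> bS /asboolP [c [p [hc hp ->]]]; rewrite pexp_monomials mulrDl mulr_suml.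
apply: rpredD; first by rewrite -[X - b]expr1; apply: poles_monom.
rewrite big_seq; apply: rpred_sum => a aS; rewrite mulr_suml.
apply: rpred_sum => j _; have cJ : (p a)`_j \in J by apply: polyOver_coef.
move: ((p a)`_j) cJ j.+1 => {p hp j}e eJ n.
have [->|ab] := eqVneq a b.
  by rewrite -mulrA -invfM -exprSr; apply: poles_monom.
elim: n => [|n IH].
  by rewrite expr0 invr1 mulr1 -[X - b]expr1; apply: poles_monom.
have Xa := pole_neq0 aS; have Xb := pole_neq0 bS.
have ab' : a - b != 0 by rewrite subr_eq0.
have -> : e * (X - a) ^- n.+1 / (X - b) =
  (a - b)^-1 * (e * (X - a) ^- n.+1 - e * (X - a) ^- n / (X - b)).
  rewrite exprS; field; rewrite Xa Xb ab' expf_neq0 //.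
apply: poles_scale; first exact: DS.
by apply: rpredB => //; apply: poles_monom.
Qed.

Lemma poles_mul y z : y \in poles D -> z \in poles J -> y * z \in poles J.
Proof.
move=> /asboolP [c [p [hc hp ->]]] hz; rewrite pexp_monomials mulrDl mulr_suml.
apply: rpredD; first exact: poles_scale.
rewrite big_seq; apply: rpred_sum => a aS; rewrite mulr_suml.
apply: rpred_sum => j _; rewrite -mulrA; apply: poles_scale.
  exact: polyOver_coef.
rewrite mulrC; elim: {j}j.+1 => [|n IH]; first by rewrite expr0 invr1 mulr1.
by rewrite exprSr invfM mulrA; apply: poles_mulpole.
Qed.

End Module.

Lemma poles_subring : subring_closed (poles D).
Proof.
split; first by apply: poles_const; apply: rpred1.
  by move=> y z hy hz; apply: rpredB.
by move=> y z hy hz; apply: poles_mul => // d x; apply: rpredM.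
Qed.

Hypothesis DK : {subset D <= K'}.

Lemma over_sub (J : zmodClosed K) (p : {poly K}) : {subset J <= K'} ->
  p \is a polyOver J -> p \is a polyOver K'.
Proof. by move=> h /polyOverP hp; apply/polyOverP => i; apply: h. Qed.

Section Regular.
Variable I : zmodClosed K.
Hypothesis ID : {subset I <= D}.
Hypothesis DI : forall d x, d \in D -> x \in I -> d * x \in I.
Let IK : {subset I <= K'}. Proof. by move=> x /ID /DK. Qed.

(** Coefficientwise: the pole ring is free over [D]. *)
Lemma poles_regular_base f y : f \in D ->
  (forall x, x \in D -> f * x \in I -> x \in I) ->
  y \in poles D -> f * y \in poles I -> y \in poles I.
Proof.
move=> fD reg /asboolP [c [p [hc hp ->]]] /asboolP [d [q [hd hq]]].
rewrite pexpZ => /pexp_inj [||||e1 e2].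
- by apply: DK; apply: rpredM.
- exact: IK.
- by move=> a; apply: (over_sub DK); apply: polyOverZ.
- by move=> a; apply: (over_sub IK).
apply/asboolP; exists c, (fun a => if a \in S then p a else 0); split.
- by apply: reg => //; rewrite e1.
- move=> a; case: ifP => aS; last exact: rpred0.
  apply/polyOverP => i; apply: reg; first exact: polyOver_coef.
  by rewrite -coefZ e2 //; apply: polyOver_coef.
- by congr (_ + _); apply: eq_big_seq => a aS; rewrite aS.
Qed.

(** An element [g] that is monic at every pole is regular modulo [poles I]:
    multiplication by [g] shifts leading coefficients, so the leading
    coefficients of [y] lie in [I] and can be removed one by one. *)
Lemma poles_regular_monic cg pg y : S != [::] -> cg \in D ->
  (forall a, pg a \is a polyOver D) -> (forall a, a \in S -> pg a \is monic) ->
  y \in poles D -> pexp cg pg * y \in poles I -> y \in poles I.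
Proof.
move=> S0 hcg hpg mon /asboolP [c [p [hc hp ->]]].
have [N] := ubnP (\sum_(a <- S) size (p a)).
elim: N c p hc hp => // N IH c p hc hp; rewrite ltnS => hN hI.
have hg : pexp cg pg \in poles D by apply/asboolP; exists cg, pg.
have hgK a : pg a \is a polyOver K' by apply: (over_sub DK).
have hpK a : p a \is a polyOver K' by apply: (over_sub DK).
have [allz|] := boolP (all (fun a => p a == 0) S).
  have e : pexp c p = c.
    rewrite /pexp big_seq big1 ?addr0 // => a /(allP allz) /eqP ->.
    by rewrite horner0 mulr0.
  move: hI; rewrite e mulrC pexpZ => /polesP [d [q [hd hq]]] /pexp_inj [||||_ e2].
  - by apply: DK; apply: rpredM.
  - exact: IK.
  - by move=> a; apply: polyOverZ => //; apply: DK.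
  - by move=> a; apply: (over_sub IK).
  apply: poles_const; case: S S0 mon e2 => // a S' _ mon e2.
  have := congr1 lead_coef (e2 a (mem_head _ _)).
  rewrite lead_coefZ (eqP (mon a (mem_head _ _))) mulr1 => ->.
  by rewrite lead_coefE; apply: polyOver_coef.
rewrite -has_predC => /hasP [a aS /= pa0].
set n := size (p a); set m := size (pg a).
have n0 : (0 < n)%N by rewrite lt0n size_poly_eq0.
have m0 : (0 < m)%N by rewrite lt0n size_poly_eq0 monic_neq0 // mon.
pose l := lead_coef (p a).
have lI : l \in I.
  have [P [W [hP hW W0 eP lP]]] := pexp_lead aS (DK hc) hpK.
  have [P' [W' [hP' hW' W0' eP' lP']]] := pexp_lead aS (DK hcg) hgK.
  case/polesP: (hI) => d [q [hd hq e]].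
  have [|||||_] := @pexp_coef a d q (m + n) (P' * P) (W' * W) aS (IK hd).
  - by move=> b; apply: (over_sub IK).
  - by rewrite rpredM.
  - by rewrite rpredM.
  - by rewrite hornerM mulf_neq0.
  - by rewrite -e !hornerM -eP -eP' exprD -/m -/n; ring.
  rewrite addn_gt0 m0 => /(_ isT); rewrite !hornerM lP // lP' //.
  rewrite (eqP (mon a aS)) mul1r => e2.
  have -> : l = (q a)`_(m + n).-1.
    have WW : W'.[a] * W.[a] != 0 by rewrite mulf_neq0.
    by apply: (mulIf WW); rewrite e2 /l; ring.
  exact: polyOver_coef.
have lm : l * (X - a) ^- n \in poles I by apply: poles_monom.
have [p' [hp' sz e]] := pexp_drop c aS pa0.
rewrite e; apply: rpredD => //; apply: IH => //; first exact: hp'.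
  exact: leq_trans sz hN.
move: hI; rewrite e mulrDr => h.
rewrite -[X in X \in _](addrK (pexp cg pg * (l * (X - a) ^- n))).
by apply: rpredB => //; apply: poles_mul.
Qed.

End Regular.
End Product.
End Poles.

(** * Regular sequences and partial fractions *)

Section SubringIdeals.
Variable K : fieldType.
Implicit Types (D : subringClosed K) (s : seq K).

Definition sub_ideal (D : {pred K}) s : {pred K} := fun x =>
  `[< exists c : nat -> K, (forall i, c i \in D) /\ x = \sum_(i < size s) c i * s`_i >].

Lemma sub_ideal_closed D s : zmod_closed (sub_ideal D s).
Proof.
split.
  apply/asboolP; exists (fun=> 0); split=> [i|]; first exact: rpred0.
  by rewrite big1 // => i _; rewrite mul0r.
move=> _ _ /asboolP [c [hc ->]] /asboolP [d [hd ->]]; apply/asboolP.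
exists (fun i => c i - d i); split=> [i|]; first exact: rpredB.
by rewrite -sumrB; apply: eq_bigr => i _; rewrite mulrBl.
Qed.
HB.instance Definition _ D s :=
  GRing.isZmodClosed.Build K (sub_ideal D s) (sub_ideal_closed D s).

Lemma sub_idealM D s d x : d \in D -> x \in sub_ideal D s -> d * x \in sub_ideal D s.
Proof.
move=> hd /asboolP [c [hc ->]]; apply/asboolP.
exists (fun i => d * c i); split=> [i|]; first exact: rpredM.
by rewrite mulr_sumr; apply: eq_bigr => i _; rewrite mulrA.
Qed.

Lemma sub_ideal_sub D s : {subset s <= D} -> {subset sub_ideal D s <= D}.
Proof.
move=> sD _ /asboolP [c [hc ->]]; apply: rpred_sum => i _.
by apply: rpredM => //; apply: sD; apply: mem_nth.
Qed.

Lemma mem_sub_ideal D s i : (i < size s)%N -> s`_i \in sub_ideal D s.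
Proof.
move=> hi; apply/asboolP; exists (fun j => (j == i)%:R); split.
  by move=> j; case: (j == i); rewrite ?rpred1 ?rpred0.
rewrite (bigD1 (Ordinal hi)) //= eqxx mul1r big1 ?addr0 // => j.
by rewrite -val_eqE /= => /negbTE ->; rewrite mul0r.
Qed.

Definition sub_regular (D : {pred K}) s := {subset s <= D} /\
  forall i, (i < size s)%N -> forall y, y \in D ->
    s`_i * y \in sub_ideal D (take i s) -> y \in sub_ideal D (take i s).

End SubringIdeals.

Section PoleStep.
Variables (K : fieldType) (K' : divringClosed K) (X : K) (S : seq K).
Hypothesis trX : forall P, P \is a polyOver K' -> P.[X] = 0 -> P = 0.
Hypothesis uS : uniq S.
Hypothesis SK : forall a, a \in S -> a \in K'.
Variables D A : subringClosed K.
Hypothesis DS : forall a b, a \in S -> b \in S -> a != b -> (a - b)^-1 \in D.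
Hypothesis DK : {subset D <= K'}.
Hypothesis DA : {subset poles X S D <= A}.
Hypothesis locA : forall y, y \in A -> exists u,
  [/\ u \in poles X S D, u != 0, u^-1 \in A & u * y \in poles X S D].

Let polesM (J : zmodClosed K) y z :
  (forall d x, d \in D -> x \in J -> d * x \in J) ->
  y \in poles X S D -> z \in poles X S J -> y * z \in poles X S J.
Proof. by move=> DJ; apply: (poles_mul trX uS SK DS DJ). Qed.

Lemma poles_sub_ideal s : {subset poles X S (sub_ideal D s) <= sub_ideal A s}.
Proof.
have sub : {subset sub_ideal D s <= sub_ideal A s}.
  move=> x /asboolP [c [hc ->]]; apply/asboolP; exists c; split=> // i.
  by apply: DA; apply: poles_const.
apply: poles_ind => [c /sub //|c a n /sub hc aS].
rewrite mulrC; apply: sub_idealM => //; apply: DA.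
by rewrite -[_^-1]mul1r; apply: poles_monom => //; apply: rpred1.
Qed.

(** Up to a unit of [A], membership in an extended ideal can be tested on the
    coefficients of partial fractions. *)
Lemma sub_ideal_poles s y : y \in sub_ideal A s -> exists u,
  [/\ u \in poles X S D, u != 0, u^-1 \in A & u * y \in poles X S (sub_ideal D s)].
Proof.
have IM d x : d \in D -> x \in sub_ideal D s -> d * x \in sub_ideal D s.
  exact: sub_idealM.
move=> /asboolP [c [hc ->]].
suff H n : (n <= size s)%N -> exists u, [/\ u \in poles X S D, u != 0, u^-1 \in A &
    u * \sum_(i < n) c i * s`_i \in poles X S (sub_ideal D s)] by apply: H.
elim: n => [|n IH] hn.
  exists 1; rewrite big_ord0 mulr0 invr1 oner_neq0 !rpred1; split=> //.
    by apply: poles_const; apply: rpred1.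
  exact: rpred0.
have [u [uD u0 uA hu]] := IH (ltnW hn).
have [v [vD v0 vA hv]] := locA (hc n).
exists (u * v); split.
- by apply: polesM => // d x; apply: rpredM.
- by rewrite mulf_neq0.
- by rewrite invfM rpredM.
rewrite big_ord_recr /= mulrDr; apply: rpredD.
  by rewrite [u * v]mulrC -mulrA; apply: polesM.
rewrite -mulrA; apply: polesM => //; rewrite mulrA; apply: polesM => //.
by apply: poles_const; apply: mem_sub_ideal.
Qed.

Lemma poles_regular_local s f :
  (forall z, z \in poles X S D -> f * z \in poles X S (sub_ideal D s) ->
    z \in poles X S (sub_ideal D s)) ->
  f \in A -> forall y, y \in A -> f * y \in sub_ideal A s -> y \in sub_ideal A s.
Proof.
move=> reg fA y yA /sub_ideal_poles [u [uD u0 uA hu]].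
have [v [vD v0 vA hv]] := locA yA.
have h : u * (v * y) \in poles X S (sub_ideal D s).
  apply: reg; first by apply: polesM => // d x; apply: rpredM.
  have -> : f * (u * (v * y)) = v * (u * (f * y)) by ring.
  by apply: polesM => // d x; apply: sub_idealM.
have -> : y = (u^-1 * v^-1) * (u * (v * y)) by field; rewrite u0 v0.
by apply: sub_idealM; [apply: rpredM|apply: poles_sub_ideal].
Qed.

Lemma take_subset (T : eqType) i (s : seq T) : {subset take i s <= s}.
Proof. by move=> x; apply: mem_take. Qed.

(** [A] is a localization of a free [D]-module, hence flat over [D]. *)
Lemma sub_regular_flat s : sub_regular D s -> sub_regular A s.
Proof.
move=> [sD reg]; have sA : {subset s <= A}.
  by move=> x /sD xD; apply: DA; apply: poles_const.
split=> // i hi; apply: poles_regular_local; last exact/sA/mem_nth.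
move=> z hz; apply: (poles_regular_base trX uS SK DK) hz => //.
- by apply: sub_ideal_sub => x /take_subset /sD.
- exact/sD/mem_nth.
- by move=> x xD; apply: reg.
Qed.

Lemma sub_regular_rcons s cg pg : sub_regular D s -> S != [::] -> cg \in D ->
  (forall a, pg a \is a polyOver D) -> (forall a, a \in S -> pg a \is monic) ->
  sub_regular A (rcons s (pexp X S cg pg)).
Proof.
move=> sreg S0 hcg hpg mon; have [sA reg] := sub_regular_flat sreg.
have [sD _] := sreg.
have gA : pexp X S cg pg \in A.
  by apply: DA; apply/asboolP; exists cg, pg.
split=> [x|i]; first by rewrite mem_rcons inE => /orP [/eqP -> //|/sA].
rewrite size_rcons ltnS leq_eqVlt nth_rcons => /orP [/eqP ->|hi].
  rewrite ltnn eqxx -cats1 take_size_cat //; apply: poles_regular_local => //.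
  move=> z; apply: (poles_regular_monic trX uS SK DS DK) => //.
    exact: sub_ideal_sub.
  by move=> d x; apply: sub_idealM.
by rewrite hi -cats1 takel_cat 1?ltnW //; apply: reg.
Qed.

End PoleStep.

(** * Complete integral closure of rings of partial fractions *)

Section CompleteIntegralClosure.
Variables (K : fieldType) (K' : divringClosed K) (X : K) (S : seq K).
Hypothesis trX : forall P, P \is a polyOver K' -> P.[X] = 0 -> P = 0.
Hypothesis uS : uniq S.
Hypothesis SK : forall a, a \in S -> a \in K'.

(** The coefficients stay in the subfield because the algorithm only divides by
    the leading coefficient of [Q]. *)
Lemma polyOver_div (A Q : {poly K}) : A \is a polyOver K' -> Q \is a polyOver K' ->
  Q != 0 -> exists B R, [/\ B \is a polyOver K', R \is a polyOver K',
    A = B * Q + R & (size R < size Q)%N].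
Proof.
move=> hA hQ Q0; have [N] := ubnP (size A).
elim: N A hA => // N IH A hA; rewrite ltnS => sA.
have [lt|le] := ltnP (size A) (size Q).
  by exists 0, A; rewrite mul0r add0r rpred0.
have Q1 : (0 < size Q)%N by rewrite lt0n size_poly_eq0.
have A1 : (0 < size A)%N by apply: leq_trans le.
pose u := lead_coef A / lead_coef Q.
have uK : u \in K' by rewrite rpred_div // lead_coefE polyOver_coef.
pose T := u *: 'X^(size A - size Q).
have hT : T \is a polyOver K' by apply: polyOverZ => //; apply: polyOverXn.
have [||B [R [hB hR e sR]]] := IH (A - T * Q).
- by rewrite rpredB ?rpredM.
- apply: leq_trans sA; rewrite -[X in (_ < X)%N](prednK A1) ltnS.
  apply/leq_sizeP => j; rewrite coefB -scalerAl coefZ coefXnM leq_eqVlt.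
  move=> /orP [/eqP <-|hj].
    have -> : ((size A).-1 < size A - size Q)%N = false.
      by apply/negbTE; rewrite -leqNgt; move: (size A) (size Q) Q1 A1; lia.
    have -> : ((size A).-1 - (size A - size Q) = (size Q).-1)%N.
      by move: (size A) (size Q) Q1 A1 le; lia.
    by rewrite -!lead_coefE /u divfK ?subrr // lead_coef_eq0.
  rewrite nth_default; last by rewrite -(prednK A1).
  case: ifP => [_|_]; first by rewrite mulr0 subrr.
  rewrite nth_default ?mulr0 ?subrr //.
  by move: (size A) (size Q) Q1 A1 le hj; lia.
exists (B + T), R; split=> //; first exact: rpredD.
by rewrite mulrDl addrAC -e subrK.
Qed.

Lemma polyOver_divXsubC (A : {poly K}) a : A \is a polyOver K' -> a \in K' ->
  exists2 B, B \is a polyOver K' & A = B * ('X - a%:P) + A.[a]%:P.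
Proof.
move=> hA aK; have [||B [R [hB hR e sR]]] := polyOver_div hA (_ : 'X - a%:P \is a polyOver K').
- by rewrite polyOverXsubC.
- by rewrite polyXsubC_eq0.
exists B => //; move: sR; rewrite size_XsubC ltnS => /size1_polyC eR.
by rewrite {2}e eR hornerD hornerM hornerXsubC subrr mulr0 add0r hornerC {1}e {1}eR.
Qed.

Lemma polyOver_mult (A : {poly K}) a : A \is a polyOver K' -> a \in K' -> A != 0 ->
  exists m q, [/\ q \is a polyOver K', q.[a] != 0 & A = q * ('X - a%:P) ^+ m].
Proof.
move=> hA aK; have [N] := ubnP (size A); elim: N A hA => // N IH A hA.
rewrite ltnS => sA A0; have [Aa|Aa] := eqVneq A.[a] 0; last first.
  by exists 0, A; rewrite expr0 mulr1.
have [B hB] := polyOver_divXsubC hA aK; rewrite Aa polyC0 addr0 => e.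
have B0 : B != 0 by apply: contraNneq A0 => B0; rewrite e B0 mul0r.
have [||m [q [hq qa eq]]] := IH B hB => //.
  by apply: leq_trans sA; rewrite e size_Mmonic ?monicXsubC // size_XsubC addn2.
by exists m.+1, q; split=> //; rewrite e eq exprSr mulrA.
Qed.

Section Descent.
Variable D : subringClosed K.
Hypothesis DS : forall a b, a \in S -> b \in S -> a != b -> (a - b)^-1 \in D.
Hypothesis DK : {subset D <= K'}.
Hypothesis cicD : forall y c, y \in K' -> c != 0 -> (forall n, c * y ^+ n \in D) -> y \in D.

(** If [y] is almost integral over the pole ring, so is its leading coefficient
    at each pole over [D]: compare leading coefficients in [c * y ^+ n] once
    [n] exceeds the order of vanishing of [c] there. *)
Lemma poles_lead_completely_closed c d p a : (forall b, p b \is a polyOver K') -> d \in K' ->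
  c != 0 -> (forall n, c * pexp X S d p ^+ n \in poles X S D) ->
  a \in S -> p a != 0 -> lead_coef (p a) \in D.
Proof.
move=> hp dK c0 hc aS pa0; set l := lead_coef (p a); set k := size (p a).
have k0 : (0 < k)%N by rewrite lt0n size_poly_eq0.
have lK : l \in K' by rewrite /l lead_coefE polyOver_coef.
have [P [W [hP hW W0 eP /(_ k0) lP]]] := pexp_lead trX uS SK aS dK hp.
have [cc [pc [hcc hpc ec]]] : exists cc pc, [/\ cc \in K', forall b, pc b \is a polyOver K' &
    c = pexp X S cc pc].
  have := hc 0; rewrite expr0 mulr1 => /polesP [cc [pc [hcc hpc ec]]].
  exists cc, pc; split=> //; first exact: DK.
  by move=> b; apply: (over_sub DK).
have [Pc [Wc [hPc hWc Wc0 ePc _]]] := pexp_lead trX uS SK aS hcc hpc.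
have aK := SK aS; have Xa := pole_neq0 trX SK aS.
have Pc0 : Pc != 0.
  apply/eqP => e; move: ePc; rewrite e horner0 -ec => /eqP.
  rewrite !mulf_eq0 (negbTE c0) expf_eq0 (negbTE Xa) andbF /= => /eqP.
  by move/(trX hWc) => e'; rewrite e' horner0 eqxx in Wc0.
have [mu [q [hq qa eq]]] := polyOver_mult hPc aK Pc0.
set kc := size (pc a) in ePc.
have key n : (mu < n)%N -> q.[a] / Wc.[a] * l ^+ n \in D.
  move=> hn; pose N := (kc + k * n - mu)%N.
  have hmu : (mu < kc + k * n)%N by rewrite (leq_trans hn) // (leq_trans (leq_pmull n k0)) // leq_addl.
  have N0 : (0 < N)%N by rewrite subn_gt0.
  have [e [r [he hr er]]] := polesP (hc n).
  have [|||||_ /(_ N0)] := @pexp_coef K K' X S trX uS SK a e r N (q * P ^+ n) (Wc * W ^+ n) aS (DK he).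
  - by move=> b; apply: (over_sub DK).
  - by rewrite rpredM ?rpredX.
  - by rewrite rpredM ?rpredX.
  - by rewrite hornerM horner_exp mulf_neq0 // expf_neq0.
  - apply: (mulIf (expf_neq0 mu Xa)).
    rewrite -er !hornerM !horner_exp -eP -/k.
    set Y := pexp X S d p; set w := W.[X]; set u := X - a.
    transitivity (c * Y ^+ n * u ^+ (kc + k * n) * (Wc.[X] * w ^+ n)).
      by rewrite -[in RHS](subnK (ltnW hmu)) -/N exprD; ring.
    transitivity (c * u ^+ kc * Wc.[X] * (Y * u ^+ k * w) ^+ n).
      by rewrite exprD exprM !exprMn; ring.
    by rewrite ec ePc eq hornerM horner_exp hornerXsubC -/u; ring.
  rewrite !hornerM !horner_exp lP exprMn => e2.
  have -> : q.[a] / Wc.[a] * l ^+ n = (r a)`_N.-1.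
    have h : Wc.[a] * W.[a] ^+ n != 0 by rewrite mulf_neq0 ?expf_neq0.
    apply: (mulIf h); rewrite e2; field; exact: Wc0.
  exact: polyOver_coef.
apply: (@cicD l (q.[a] / Wc.[a] * l ^+ mu.+1)) => //.
  by rewrite !mulf_neq0 ?invr_eq0 // expf_neq0 // lead_coef_eq0.
by move=> n; rewrite -[X in X \in _]mulrA -exprD; apply: key; rewrite addSn ltnS leq_addr.
Qed.

(** Descent from [K'] to [D]: the leading polar coefficients lie in [D] and can be
    subtracted one after the other, and a constant that is almost integral over the
    pole ring is almost integral over [D], as one sees on any non-zero coefficient
    of [c]. *)
Lemma poles_completely_closed y c : y \in poles X S K' -> c != 0 ->
  (forall n, c * y ^+ n \in poles X S D) -> y \in poles X S D.
Proof.
move=> /polesP [d [p [hd hp ->]]] c0.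
have [N] := ubnP (\sum_(a <- S) size (p a)).
elim: N p hp => // N IH p hp; rewrite ltnS => hN hc.
have [_ polB polM] := poles_subring trX uS SK DS.
have [allz|] := boolP (all (fun a => p a == 0) S).
  have e : pexp X S d p = d.
    rewrite /pexp big_seq big1 ?addr0 // => a /(allP allz) /eqP ->.
    by rewrite horner0 mulr0.
  rewrite e in hc *; apply: poles_const.
  have := hc 0; rewrite expr0 mulr1 => /polesP [cc [pc [hcc hpc ec]]].
  have coefs n : d ^+ n * cc \in D /\ forall a, a \in S -> forall i, d ^+ n * (pc a)`_i \in D.
    have := hc n; rewrite ec mulrC pexpZ => /polesP [b [q [hb hq]]].
    case/(pexp_inj trX uS SK) => [||||-> e2].
    - by rewrite rpredM ?rpredX // DK.
    - exact: DK.
    - by move=> a; apply: polyOverZ; [apply: rpredX|apply: (over_sub DK)].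
    - by move=> a; apply: (over_sub DK).
    by split=> // a aS i; rewrite -coefZ e2 //; apply: polyOver_coef.
  have [cc0|cc0] := eqVneq cc 0; last first.
    by apply: (cicD hd cc0) => n; rewrite mulrC; case: (coefs n).
  have [/allP pz|] := boolP (all (fun a => pc a == 0) S).
    case/eqP: c0; rewrite ec /pexp big_seq big1 ?addr0 // => a /pz /eqP ->.
    by rewrite horner0 mulr0.
  rewrite -has_predC => /hasP [a aS /= pa0].
  have lc0 : lead_coef (pc a) != 0 by rewrite lead_coef_eq0.
  apply: (cicD hd lc0) => n; rewrite mulrC lead_coefE.
  by case: (coefs n) => _; apply.
rewrite -has_predC => /hasP [a aS /= pa0].
have lD := poles_lead_completely_closed hp hd c0 hc aS pa0.
have [p' [hp' sz e]] := pexp_drop trX uS SK d aS pa0.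
set z := _ * _ in e.
have hz : z \in poles X S D by apply: poles_monom.
rewrite e; apply: rpredD => //; apply: IH; first exact: hp'.
  exact: leq_trans sz hN.
move=> n; have -> : pexp X S d p' = pexp X S d p - z by rewrite e addrK.
rewrite exprBn mulr_sumr; apply: rpred_sum => i _.
rewrite mulrnAr rpredMn //.
have -> : c * ((-1) ^+ i * pexp X S d p ^+ (n - i) * z ^+ i) =
  c * pexp X S d p ^+ (n - i) * (- z) ^+ i by rewrite [in RHS]exprNn; ring.
apply: (polM); first exact: hc.
elim: (i : nat) => [|j IHj]; first by rewrite expr0; apply: poles_const; apply: rpred1.
by rewrite exprS; apply: polM => //; rewrite rpredN.
Qed.

End Descent.

Let DS' a b : a \in S -> b \in S -> a != b -> (a - b)^-1 \in K'.
Proof. by move=> /SK aK /SK bK _; rewrite rpredV rpredB. Qed.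

Let om : {poly K} := \prod_(a <- S) ('X - a%:P).

Let om_monic i : om ^+ i \is monic.
Proof. by apply/monic_exp/monic_prod => a _; apply: monicXsubC. Qed.

Let om_over i : om ^+ i \is a polyOver K'.
Proof.
apply: rpredX; rewrite /om big_seq; apply: rpred_prod => a aS.
by rewrite polyOverXsubC SK.
Qed.

Let omX i : om.[X] ^+ i != 0.
Proof.
rewrite -horner_exp; apply/eqP => /(trX (om_over i)) e.
by have := monic_neq0 (om_monic i); rewrite e eqxx.
Qed.

(* No condition is imposed at infinity. *)
Definition regular_outside e :=
  exists M (P : {poly K}), P \is a polyOver K' /\ e * om.[X] ^+ M = P.[X].

Lemma regular_outsideM P e : P \is a polyOver K' -> regular_outside e ->
  regular_outside (P.[X] * e).
Proof.
move=> hP [M [Q [hQ eQ]]]; exists M, (P * Q); split; first exact: rpredM.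
by rewrite hornerM -eQ mulrA.
Qed.

Lemma regular_outsideB e f : regular_outside e -> regular_outside f ->
  regular_outside (e - f).
Proof.
move=> [M [P [hP eP]]] [N [Q [hQ eQ]]].
exists (M + N)%N, (P * om ^+ N - Q * om ^+ M); split.
  by rewrite rpredB ?rpredM.
by rewrite !hornerDMX -eP -eQ exprD; ring.
Qed.

Let deg_om i : (size (om ^+ i)).-1 = (size S * i)%N.
Proof. by rewrite size_exp /om size_prod_XsubC. Qed.

(** The bound on the degree of the numerator expresses regularity at infinity. *)
Lemma poles_bounded e : e \in poles X S K' -> exists M P,
  [/\ P \is a polyOver K', (size P <= (size S * M).+1)%N & e * om.[X] ^+ M = P.[X]].
Proof.
pose Q : {pred K} := fun e => `[< exists M P, [/\ P \is a polyOver K',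
  (size P <= (size S * M).+1)%N & e * om.[X] ^+ M = P.[X]] >].
have bound (P : {poly K}) M N : (size P <= (size S * M).+1)%N ->
    (size (P * om ^+ N)%R <= (size S * (M + N)).+1)%N.
  move=> sP; apply: leq_trans (size_polyMleq _ _) _.
  have := deg_om N; have : (0 < size (om ^+ N)%R)%N by rewrite size_poly_gt0 monic_neq0.
  move: sP; rewrite mulnDr; move: (size _) (size _) (_ * _)%N (_ * _)%N; lia.
have Qz : zmod_closed Q.
  split; first by apply/asboolP; exists 0, 0; rewrite rpred0 size_poly0 mul0r horner0.
  move=> e1 e2 /asboolP [M [P [hP sP eP]]] /asboolP [N [R [hR sR eR]]]; apply/asboolP.
  exists (M + N)%N, (P * om ^+ N - R * om ^+ M); split.
  - by rewrite rpredB ?rpredM.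
  - apply: leq_trans (size_polyD _ _) _; rewrite size_polyN geq_max bound //.
    by rewrite addnC bound.
  - by rewrite !hornerDMX -eP -eR exprD; ring.
pose QQ : zmodClosed K := HB.pack Q (GRing.isZmodClosed.Build K Q Qz).
move=> he; apply/asboolP; move: e he; apply: (@poles_ind _ X S K' QQ) => [c cK|c a n cK aS].
  apply/asboolP; exists 0, c%:P.
  by rewrite polyOverC cK muln0 size_polyC leq_b1 expr0 mulr1 hornerC.
pose om' := \prod_(b <- S | b != a) ('X - b%:P).
have omE : om = ('X - a%:P) * om' by rewrite /om (bigD1_seq a).
have om'm : om' \is monic by apply: monic_prod => b _; apply: monicXsubC.
apply/asboolP; exists n, (c *: om' ^+ n); split.
- apply: polyOverZ => //; apply: rpredX; rewrite /om' big_seq_cond.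
  by apply: rpred_prod => b /andP [bS _]; rewrite polyOverXsubC SK.
- apply: leq_trans (size_scale_leq _ _) _.
  rewrite -deg_om prednK ?size_poly_gt0 ?monic_neq0 //.
  rewrite omE exprMn size_mul ?expf_neq0 ?polyXsubC_eq0 ?monic_neq0 //.
  have : (0 < size (('X - a%:P) ^+ n)%R)%N by rewrite size_poly_gt0 expf_neq0 ?polyXsubC_eq0.
  move: (size _) (size _); lia.
- rewrite omE hornerZ horner_exp hornerM hornerXsubC exprMn.
  by field; rewrite expf_neq0 // (pole_neq0 trX SK aS).
Qed.

(** Existence of partial fractions when the denominator is split. *)
Lemma partial_fractions (b : {poly K}) (T : seq K) : {subset T <= S} ->
  b \is a polyOver K' -> (size b <= (size T).+1)%N ->
  b.[X] * \prod_(a <- T) (X - a)^-1 \in poles X S K'.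
Proof.
elim: T b => [|a T IH] b TS hb sb.
  rewrite big_nil mulr1 (size1_polyC sb) hornerC.
  by apply: poles_const; apply: polyOver_coef.
have aS : a \in S by apply: TS; rewrite mem_head.
have TS' : {subset T <= S} by move=> x xT; apply: TS; rewrite inE xT orbT.
have [B hB e] := polyOver_divXsubC hb (SK aS).
have Xa := pole_neq0 trX SK aS.
have -> : b.[X] * \prod_(a <- a :: T) (X - a)^-1 =
    B.[X] * \prod_(a <- T) (X - a)^-1 +
    b.[a] * \prod_(a <- T) (X - a)^-1 * (X - a)^-1.
  rewrite big_cons {1}e !hornerDMX hornerC; field; exact: Xa.
apply: rpredD.
  apply: IH => //; have [->|B0] := eqVneq B 0; first by rewrite size_poly0.
  have : (size (B * ('X - a%:P))%R <= (size T).+2)%N.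
    have -> : B * ('X - a%:P) = b - b.[a]%:P by rewrite {1}e addrK.
    apply: leq_trans (size_polyD _ _) _; rewrite size_polyN geq_max sb.
    by rewrite size_polyC; case: (b.[a] != 0).
  by rewrite size_Mmonic ?monicXsubC // size_XsubC addn2 /= ltnS.
apply: (poles_mulpole trX uS SK DS') => //; first by move=> d x; apply: rpredM.
have bK : b.[a] \in K' by apply: rpred_horner => //; apply: SK.
elim: T TS' {IH e TS sb} => [|x T IH] TS.
  by rewrite big_nil mulr1; apply: poles_const.
rewrite big_cons mulrCA mulrC.
apply: (poles_mulpole trX uS SK DS').
- by move=> d y; apply: rpredM.
- by apply: TS; rewrite mem_head.
- by apply: IH => y yT; apply: TS; rewrite inE yT orbT.
Qed.

(** The pole ring over a field is completely integrally closed: the denominators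
    clearing all powers of [y] form an ideal of polynomials, hence a principal
    one, and it is stable under [y]; comparing degrees excludes a pole at
    infinity. *)
Lemma poles_field_completely_closed c y : c != 0 -> (forall n, c * y ^+ n \in poles X S K') ->
  y \in poles X S K'.
Proof.
move=> c0 hc.
pose J (A : {poly K}) := A \is a polyOver K' /\ forall n, regular_outside (A.[X] * y ^+ n).
have [M0 [P0 [hP0 sP0 eP0]]] := poles_bounded (hc 0).
rewrite expr0 mulr1 in eP0.
have P00 : P0 != 0.
  apply/eqP => e; move: eP0; rewrite e horner0 => /eqP.
  by rewrite mulf_eq0 (negbTE c0) (negbTE (omX _)).
have JP0 : J P0.
  split=> // n; rewrite -eP0.
  have -> : c * om.[X] ^+ M0 * y ^+ n = (om ^+ M0).[X] * (c * y ^+ n).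
    by rewrite horner_exp; ring.
  apply: regular_outsideM => //.
  by have [M [P [hP _ eP]]] := poles_bounded (hc n); exists M, P.
pose deg n := `[< exists A, [/\ J A, A != 0 & size A = n] >].
have [n0 /asboolP [h [Jh h0 <-]] minh] : exists2 n, deg n & forall m, deg m -> (n <= m)%N.
  have exd : exists n, deg n by exists (size P0); apply/asboolP; exists P0.
  by case: (ex_minnP exd) => n hn mn; exists n.
have [hh hn] := Jh.
have hX : h.[X] != 0 by apply/eqP => /(trX hh) /eqP; rewrite (negbTE h0).
have [M [P [hP eP]]] := hn 1; rewrite expr1 in eP.
have JP : J P.
  split=> // n; rewrite -eP.
  have -> : h.[X] * y * om.[X] ^+ M * y ^+ n = (om ^+ M).[X] * (h.[X] * y ^+ n.+1).
    by rewrite horner_exp exprS; ring.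
  exact: regular_outsideM.
have [b [R [hb hR e sR]]] := polyOver_div hP hh h0.
have JR : J R.
  split=> // n; have -> : R.[X] * y ^+ n = P.[X] * y ^+ n - b.[X] * (h.[X] * y ^+ n).
    by rewrite e !hornerDMX; ring.
  by apply: regular_outsideB; [apply: (proj2 JP)|apply: regular_outsideM].
have {e} e : P = b * h.
  have [R0|R0] := eqVneq R 0; first by rewrite e R0 addr0.
  by move: sR; rewrite ltnNge minh //; apply/asboolP; exists R.
have yb : y * om.[X] ^+ M = b.[X].
  by apply: (mulIf hX); rewrite -hornerM -e -eP; ring.
have sb : (size b <= (size S * M).+1)%N.
  have [->|b0] := eqVneq b 0; first by rewrite size_poly0.
  rewrite leqNgt; apply/negP => big.
  (* The degree excess of [b ^+ n] must exceed what [c] can compensate. *)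
  pose n := (size S * M0).+1.
  have [N [Pn [hPn sPn ePn]]] := poles_bounded (hc n).
  have E : P0 * b ^+ n * om ^+ N = Pn * om ^+ M0 * om ^+ (M * n).
    apply/eqP; rewrite -subr_eq0; apply/eqP; apply: trX.
      by apply: rpredB; rewrite !rpredM // rpredX.
    rewrite !hornerDMX -yb -eP0 -ePn exprM exprMn; ring.
  have Pn0 : Pn != 0.
    apply: contraNneq P00 => e'; move/eqP: E; rewrite e' !mul0r.
    by rewrite !mulf_eq0 !expf_eq0 (negbTE b0) (negbTE (monic_neq0 (om_monic 1))) !andbF !orbF.
  have om0 i : om ^+ i != 0 by rewrite monic_neq0.
  have bn : b ^+ n != 0 by rewrite expf_neq0.
  have degM (p q : {poly K}) : p != 0 -> q != 0 ->
      (size (p * q)).-1 = ((size p).-1 + (size q).-1)%N.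
    move=> p0 q0; rewrite size_mul //.
    move: p0 q0; rewrite -!size_poly_gt0.
    by case: (size p) => // i; case: (size q) => // j _ _; rewrite addnS.
  have := congr1 (fun q : {poly K} => (size q).-1) E.
  rewrite !degM ?mulf_neq0 // !deg_om size_exp.
  have db : ((size S * M).+1 * n <= (size b).-1 * n)%N.
    by rewrite leq_mul2r -ltnS (ltn_predK big) big orbT.
  have dP : ((size Pn).-1 <= size S * N)%N by rewrite -ltnS prednK ?size_poly_gt0.
  have arith i j k l m d e' : (m + l.+1 <= d -> i <= k -> j + d + k = i + l + m -> e')%N.
    by lia.
  move: db; rewrite mulSn mulnA addnC; move/arith; apply; exact: dP.
have sT : size (flatten (nseq M S)) = (size S * M)%N.
  by rewrite size_flatten /shape map_nseq sumn_nseq.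
have -> : y = b.[X] * \prod_(a <- flatten (nseq M S)) (X - a)^-1.
  rewrite -yb -(mulfK (omX M) y); congr (_ * _ * _).
    by rewrite mulfK.
  rewrite -exprVn; elim: M {eP yb sb sT} => [|M IH]; first by rewrite big_nil.
  rewrite /= big_cat exprS -IH; congr (_ * _).
  rewrite /om horner_prod -prodfV; apply: eq_bigr => a _.
  by rewrite hornerXsubC.
apply: partial_fractions => //; last by rewrite sT.
by move=> x /flattenP [t]; rewrite mem_nseq => /andP [_ /eqP ->].
Qed.

End CompleteIntegralClosure.

(** * Linear forms in the function field *)

Section GeneratedSubring.
Variable K : fieldType.

Definition subring_gen (P : K -> Prop) : {pred K} := fun x => `[< forall B : {pred K},
  subring_closed B -> (forall y, P y -> y \in B) -> x \in B >].

Lemma subring_gen_closed P : subring_closed (subring_gen P).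
Proof.
split.
- by apply/asboolP => B [].
- move=> x y /asboolP hx /asboolP hy; apply/asboolP => B hB hP.
  by case: (hB) => _ h _; apply: h; [apply: hx|apply: hy].
- move=> x y /asboolP hx /asboolP hy; apply/asboolP => B hB hP.
  by case: (hB) => _ _ h; apply: h; [apply: hx|apply: hy].
Qed.
HB.instance Definition _ P := GRing.isSubringClosed.Build K (subring_gen P) (subring_gen_closed P).

Lemma mem_subring_gen (P : K -> Prop) x : P x -> x \in subring_gen P.
Proof. by move=> Px; apply/asboolP => B _; apply. Qed.

Lemma subring_gen_min P (B : {pred K}) : subring_closed B -> (forall y, P y -> y \in B) ->
  {subset subring_gen P <= B}.
Proof. by move=> hB hP x /asboolP; apply. Qed.

Lemma subringP (B : subringClosed K) : subring_closed B.
Proof. by split; [apply: rpred1|move=> x y; apply: rpredB|move=> x y; apply: rpredM]. Qed.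

Definition fracs (D : {pred K}) : {pred K} := fun x =>
  `[< exists a b, [/\ a \in D, b \in D, b != 0 & x = a / b] >].

Lemma fracs_divring (D : subringClosed K) : divring_closed (fracs D).
Proof.
split.
- by apply/asboolP; exists 1, 1; rewrite rpred1 oner_neq0 divr1.
- move=> _ _ /asboolP [a [b [ha hb b0 ->]]] /asboolP [c [d [hc hd d0 ->]]].
  apply/asboolP; exists (a * d - c * b), (b * d).
  rewrite rpredB ?rpredM // mulf_neq0 //; split=> //.
  by field; rewrite b0 d0.
- move=> _ _ /asboolP [a [b [ha hb b0 ->]]] /asboolP [c [d [hc hd d0 ->]]].
  apply/asboolP; have [->|c0] := eqVneq c 0.
    by exists 0, 1; rewrite rpred0 rpred1 oner_neq0 mul0r invr0 mulr0 mul0r.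
  exists (a * d), (b * c); rewrite !rpredM // mulf_neq0 //; split=> //.
  by field; rewrite b0 c0 d0.
Qed.
HB.instance Definition _ (D : subringClosed K) :=
  GRing.isDivringClosed.Build K (fracs D) (fracs_divring D).

Lemma sub_fracs (D : subringClosed K) : {subset D <= fracs D}.
Proof.
by move=> x hx; apply/asboolP; exists x, 1; rewrite rpred1 oner_neq0 divr1.
Qed.

Definition transc (K' : {pred K}) x :=
  forall P : {poly K}, P \is a polyOver K' -> P.[x] = 0 -> P = 0.

Lemma transcZ (K' : divringClosed K) c x : c \in K' -> c != 0 ->
  transc K' x -> transc K' (c * x).
Proof.
move=> cK c0 tx P hP e.
have /polyP e0 : \poly_(i < size P) (P`_i * c ^+ i) = 0.
  apply: tx.
    apply/polyOverP => i; rewrite coef_poly; case: ifP => _; last exact: rpred0.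
    by rewrite rpredM ?rpredX ?polyOver_coef.
  rewrite horner_poly -[RHS]e horner_coef; apply: eq_bigr => i _.
  by rewrite exprMn mulrA.
apply/polyP => i; have := e0 i; rewrite coef_poly !coef0.
case: ltnP => [_|le _]; last by rewrite nth_default.
by move/eqP; rewrite mulf_eq0 expf_eq0 (negbTE c0) andbF orbF => /eqP.
Qed.

End GeneratedSubring.

Lemma clear_denom (K : fieldType) (d s t : K) : t != 0 -> d * t * (s / t) = d * s.
Proof. by move=> t0; field. Qed.

Section LinearForms.
Variables (F : finFieldType) (V : vectType F).
Local Notation SV := {mpoly F[\dim {:V}]}.
Local Notation KV := {fraction SV}.
Local Notation lin := (@KV_in F V).
Local Notation cst := (@KV_const F V).
Implicit Types (U : {vspace V}) (u v x : V) (a : F).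

Lemma KV_inD u v : lin (u + v) = lin u + lin v.
Proof. by rewrite /KV_in linearD rmorphD. Qed.

Lemma KV_inN u : lin (- u) = - lin u.
Proof. by rewrite /KV_in linearN rmorphN. Qed.

Lemma KV_inB u v : lin (u - v) = lin u - lin v.
Proof. by rewrite KV_inD KV_inN. Qed.

Lemma KV_in0 : lin 0 = 0.
Proof. by rewrite /KV_in linear0 rmorph0. Qed.

Lemma KV_inZ a v : lin (a *: v) = cst a * lin v.
Proof. by rewrite /KV_in linearZ /= -mul_mpolyC rmorphM. Qed.

Lemma KV_in_eq0 v : (lin v == 0) = (v == 0).
Proof. by rewrite /KV_in tofrac_eq0 -(inj_eq (@SV_in_inj F V)) linear0. Qed.

Definition KV_constf : {rmorphism F -> KV} :=
  (@FracField.tofrac SV) \o (@mpolyC (\dim {:V}) F).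

Lemma KV_constE a : cst a = KV_constf a.
Proof. by []. Qed.

Definition vectors : seq V :=
  [seq \sum_i c i *: (vbasis {:V})`_i | c : {ffun 'I_(\dim {:V}) -> F}].

Lemma mem_vectors v : v \in vectors.
Proof.
apply/mapP; exists [ffun i => coord (vbasis {:V}) i v]; first exact: mem_enum.
rewrite {1}(coord_vbasis (memvf v)); apply: eq_bigr => i _.
by rewrite ffunE.
Qed.

Definition images (T : eqType) (g : V -> T) U : seq T :=
  undup [seq g u | u <- vectors & u \in U].

Lemma imagesP (T : eqType) (g : V -> T) U z :
  reflect (exists2 u, u \in U & z = g u) (z \in images g U).
Proof.
rewrite mem_undup; apply: (iffP mapP) => [[u]|[u uU ->]].
  by rewrite mem_filter => /andP [uU _] ->; exists u.
by exists u => //; rewrite mem_filter uU mem_vectors.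
Qed.

(* The zero vector is harmless in [invU], as its inverse is [0]. *)
Definition symU U := subring_gen (fun z => (exists a, z = cst a) \/ exists2 u, u \in U & z = lin u).
Definition invU U := subring_gen (fun z => (exists a, z = cst a) \/ exists2 u, u \in U & z = (lin u)^-1).
Definition fieldU U := fracs (symU U).
HB.instance Definition _ U := GRing.SubringClosed.on (symU U).
HB.instance Definition _ U := GRing.SubringClosed.on (invU U).
HB.instance Definition _ U := GRing.DivringClosed.on (fieldU U).

Lemma fieldU_lin U u : u \in U -> lin u \in fieldU U.
Proof. by move=> uU; apply/sub_fracs/mem_subring_gen; right; exists u. Qed.

Lemma fieldU_const U a : cst a \in fieldU U.
Proof. by apply/sub_fracs/mem_subring_gen; left; exists a. Qed.

Lemma fieldU_inv U : {subset invU U <= fieldU U}.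
Proof.
apply: subring_gen_min; first exact: subringP.
move=> y [[a ->]|[u uU ->]]; first exact: fieldU_const.
by rewrite rpredV fieldU_lin.
Qed.

Section Transcendence.
Variables (U : {vspace V}) (x : V).
Hypothesis xU : x \notin U.

Lemma line_cap0 : (<[x]> :&: U)%VS = 0%VS.
Proof.
apply/eqP; rewrite -subv0; apply/subvP => v; rewrite memv_cap memv0.
move=> /andP [/vlineP [k ->] kxU]; have [->|k0] := eqVneq k 0; first by rewrite scale0r.
by case/negP: xU; rewrite -(scalerK k0 x) memvZ.
Qed.

Lemma dual_form : exists l : V -> F,
  [/\ forall u v, l (u + v) = l u + l v, forall a u, l (a *: u) = a * l u,
      forall u, u \in U -> l u = 0 & l x = 1].
Proof.
have cap := line_cap0.
have cap' : (U :&: <[x]>)%VS = 0%VS by rewrite capvC.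
pose f v := coord [tuple x] ord0 (daddv_pi <[x]> U v).
exists f; split.
- by move=> u v; rewrite /f !linearD.
- by move=> k u; rewrite /f !linearZ.
- move=> u uU; rewrite /f.
  have : u \in (<[x]> + U)%VS by rewrite (subvP (addvSr _ _)).
  move/(daddv_pi_add cap); rewrite (daddv_pi_id cap') // => /eqP.
  by rewrite addrC -subr_eq0 addrAC subrr add0r => /eqP ->; rewrite linear0.
rewrite /f (daddv_pi_id cap) ?memv_line //.
have fr : free [tuple x].
  by rewrite seq1_free; apply: contraNneq xU => ->; apply: mem0v.
exact: (@coord_free _ _ _ [tuple x] ord0 ord0 fr).
Qed.

(** A change of basis would turn [x] into a variable; instead one moves every
    vector [v] by [l v] times ['X - x], for a linear form [l] that vanishes on [U]
    and takes the value [1] at [x]. *)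
Lemma substitution : exists f : {rmorphism SV -> {poly SV}},
  [/\ forall a, f a%:MP = (a%:MP)%:P, forall u, u \in U -> f (SV_in u) = (SV_in u)%:P &
      f (SV_in x) = 'X].
Proof.
have [l [lD lZ lU lx]] := dual_form.
pose c : {rmorphism F -> {poly SV}} := polyC \o @mpolyC (\dim {:V}) F.
pose g v : {poly SV} := (SV_in v)%:P + c (l v) * ('X - (SV_in x)%:P).
pose h i := g (vbasis {:V})`_i.
have gD u v : g (u + v) = g u + g v.
  by rewrite /g lD linearD !rmorphD /=; ring.
have gZ a v : g (a *: v) = c a * g v.
  by rewrite /g lZ linearZ /= -mul_mpolyC !rmorphM /=; ring.
have g0 : g 0 = 0 by rewrite -(scale0r (0 : V)) gZ rmorph0 mul0r.
pose f : {rmorphism SV -> {poly SV}} := mmap c h.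
have fg v : f (SV_in v) = g v.
  rewrite [in RHS](coord_vbasis (memvf v)).
  rewrite (big_morph g gD g0) /SV_in rmorph_sum.
  apply: eq_bigr => i _; rewrite gZ -mul_mpolyC rmorphM /=.
  by rewrite mmapC mmapX mmap1U.
exists f; split.
- by move=> a; rewrite /f /= mmapC.
- by move=> u uU; rewrite fg /g lU // rmorph0 mul0r addr0.
- by rewrite fg /g lx rmorph1 mul1r addrC subrK.
Qed.

(** An algebraic equation for [x] with cleared denominators has coefficients
    fixed by the substitution, which maps it to the same equation for ['X]. *)
Lemma KV_in_transc : transc (fieldU U) (lin x).
Proof.
have [f [fa fU fx]] := substitution.
pose fixed (s : SV) := f s = s%:P.
have fixM s t : fixed s -> fixed t -> fixed (s * t).
  by rewrite /fixed rmorphM polyCM => -> ->.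
pose T : {pred KV} := fun z => `[< exists2 s, fixed s & z = FracField.tofrac s >].
have TP : {subset symU U <= T}.
  apply: subring_gen_min.
    split.
    - by apply/asboolP; exists 1; rewrite /fixed ?rmorph1.
    - move=> _ _ /asboolP [s hs ->] /asboolP [t ht ->]; apply/asboolP.
      by exists (s - t); rewrite ?rmorphB // /fixed rmorphB polyCB hs ht.
    - move=> _ _ /asboolP [s hs ->] /asboolP [t ht ->]; apply/asboolP.
      by exists (s * t); rewrite ?rmorphM //; apply: fixM.
  move=> z [[a ->]|[u uU ->]]; apply/asboolP; first by exists a%:MP; first exact: fa.
  by exists (SV_in u) => //; apply: fU.
have clear (P : {poly KV}) : P \is a polyOver (fieldU U) ->
    exists d (Q : {poly SV}), [/\ fixed d, d != 0, forall i, fixed Q`_i &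
      FracField.tofrac d *: P = map_poly (@FracField.tofrac SV) Q].
  elim/poly_ind: P => [|P c IH] hP.
    exists 1, 0; rewrite /fixed !rmorph1 oner_neq0 scaler0 map_poly0; split=> // i.
    by rewrite coef0 rmorph0.
  have hP' : P \is a polyOver (fieldU U).
    apply/polyOverP => i; have := polyOver_coef i.+1 hP.
    by rewrite coefD coefMX coefC addr0.
  have : c \in fieldU U by have := polyOver_coef 0 hP; rewrite coefD coefMX coefC add0r.
  move=> /asboolP [a [b [/TP /asboolP [s fs ->] /TP /asboolP [t ft ->] t0 ->]]].
  rewrite tofrac_eq0 in t0.
  have [d [Q [fd d0 fQ e]]] := IH hP'.
  exists (d * t), (t *: Q * 'X + (d * s)%:P); split.
  - exact: fixM.
  - by rewrite mulf_neq0.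
  - move=> i; rewrite coefD coefMX coefC coefZ; case: i => [|i] /=.
      by rewrite add0r; apply: fixM.
    by rewrite addr0; apply: fixM.
  - rewrite [RHS]rmorphD [X in _ = X + _]rmorphM /= map_polyX map_polyC map_polyZ /= -e.
    rewrite scalerDr !tofracM; congr (_ + _).
      by rewrite -!scalerAl scalerA mulrC.
    by rewrite -mul_polyC -polyCM (@clear_denom KV) ?tofrac_eq0.
move=> P hP Px; have [d [Q [fd d0 fQ e]]] := clear P hP.
have Qx : Q.[SV_in x] = 0.
  apply/eqP; rewrite -tofrac_eq0 -horner_map /= -e hornerZ -/(KV_in x) Px.
  by rewrite mulr0.
have Q0 : Q = 0.
  rewrite -[Q]comp_polyXr /comp_poly -[RHS](rmorph0 f) -Qx -horner_map /= fx.
  congr _.[_]; apply/polyP => i; rewrite !coef_map /=; exact/esym/fQ.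
move/eqP: e; rewrite Q0 map_poly0 scaler_eq0 tofrac_eq0 (negbTE d0) /=.
by move/eqP.
Qed.

End Transcendence.
End LinearForms.

(** * Normality of the coordinate ring *)

Section Normality.
Variables (F : finFieldType) (V : vectType F).
Local Notation SV := {mpoly F[\dim {:V}]}.
Local Notation KV := {fraction SV}.
Local Notation lin := (@KV_in F V).
Local Notation cst := (@KV_const F V).
Implicit Types (U : {vspace V}) (u v x : V) (a : F).

(** Complete integral closedness; it is stronger than integral closedness, but
    passes from a ring to its pole rings by a comparison of leading coefficients. *)
Definition completely_closed (K : fieldType) (D : {pred K}) :=
  forall c y : K, c != 0 -> (forall n, c * y ^+ n \in D) -> y \in D.

Lemma invU_cst U a : cst a \in invU U.
Proof. by apply: mem_subring_gen; left; exists a. Qed.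

Lemma invU_inv U u : u \in U -> (lin u)^-1 \in invU U.
Proof. by move=> uU; apply: mem_subring_gen; right; exists u. Qed.

Lemma invU_sub U W : (U <= W)%VS -> {subset invU U <= invU W}.
Proof.
move=> UW; apply: subring_gen_min; first exact: subringP.
move=> z [[a ->]|[u uU ->]]; first exact: invU_cst.
by apply: invU_inv; apply: (subvP UW).
Qed.

Lemma cst_inv a : (cst a)^-1 = cst a^-1.
Proof. by rewrite !KV_constE fmorphV. Qed.

Section Step.
Variables (U : {vspace V}) (x : V).
Hypothesis xU : x \notin U.
Let W := (<[x]> + U)%VS.
Let S := images (fun u => - lin u) U.

Let uS : uniq S. Proof. exact: undup_uniq. Qed.

Lemma shifts_inv z : z \in S -> exists2 u, u \in U & lin x - z = lin (x + u).
Proof. by case/imagesP => u uU ->; exists u => //; rewrite opprK KV_inD. Qed.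

Lemma shifts_field z : z \in S -> z \in fieldU U.
Proof. by case/imagesP => u uU ->; rewrite rpredN fieldU_lin. Qed.

Lemma shifts_diff z w : z \in S -> w \in S -> z != w -> (z - w)^-1 \in invU U.
Proof.
move=> /imagesP [u uU ->] /imagesP [v vU ->] _.
by rewrite opprK addrC -KV_inB invU_inv // rpredB.
Qed.

Lemma invU_poles : {subset invU W <= poles (lin x) S (invU U)}.
Proof.
have trx := KV_in_transc xU.
have sub := poles_subring trx uS shifts_field shifts_diff.
have [_ _ polM] := sub.
have inD z : z \in invU U -> z \in poles (lin x) S (invU U) by exact: poles_const.
apply: subring_gen_min => // z [[a ->]|[v /memv_addP [_ /vlineP [k ->] [u uU ->]] ->]].
  by apply: inD; apply: invU_cst.
have [->|k0] := eqVneq k 0; first by rewrite scale0r add0r; apply/inD/invU_inv.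
have -> : k *: x + u = k *: (x + k^-1 *: u).
  by rewrite scalerDr scalerA divff // scale1r.
rewrite KV_inZ invfM cst_inv; apply: polM; first exact/inD/invU_cst.
pose w := - lin (k^-1 *: u).
have wS : w \in S by apply/imagesP; exists (k^-1 *: u); rewrite ?memvZ.
have -> : lin (x + k^-1 *: u) = lin x - w by rewrite /w opprK KV_inD.
rewrite -[_^-1]mul1r -[lin x - w]expr1; apply: poles_monom => //.
exact: rpred1.
Qed.

Lemma poles_invU : {subset poles (lin x) S (invU U) <= invU W}.
Proof.
have UW : {subset invU U <= invU W} by apply/invU_sub/addvSr.
apply: poles_ind => [c /UW //|c z n /UW cW /shifts_inv [u uU ->]].
rewrite rpredM // -exprVn rpredX // invU_inv //.
by rewrite memv_add // memv_line.
Qed.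

(** The step of the induction: almost integral elements have no unexpected pole
    and their polar coefficients are almost integral over the smaller ring. *)
Lemma completely_closed_step : completely_closed (invU U) -> completely_closed (invU W).
Proof.
move=> cicU c y c0 hc.
have trx := KV_in_transc xU.
have hcD n : c * y ^+ n \in poles (lin x) S (invU U) by apply/invU_poles/hc.
apply: poles_invU.
apply: (@poles_completely_closed _ (fieldU U) (lin x) S trx uS shifts_field (invU U)
  shifts_diff (@fieldU_inv _ _ U) _ y c) => //.
- by move=> z d _; apply: cicU.
apply: (@poles_field_completely_closed _ (fieldU U) (lin x) S trx uS shifts_field c) => //.
move=> n; have /polesP [d [p [hd hp ->]]] := hcD n.
apply/asboolP; exists d, p; split=> //; first exact: fieldU_inv.
by move=> a; apply: (over_sub (@fieldU_inv _ _ U)).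
Qed.

End Step.

(** Induction on the dimension; for the zero space the ring is the base field. *)
Lemma completely_closed_invU U : completely_closed (invU U).
Proof.
rewrite -(span_basis (vbasisP U)); elim: (vbasis U : seq V) => [|x s IH].
  rewrite span_nil => c y c0 hc.
  pose C : {pred KV} := fun z => `[< exists a, z = cst a >].
  have sub : {subset invU 0%VS <= C}.
    apply: subring_gen_min.
      split; first by apply/asboolP; exists 1; rewrite KV_constE rmorph1.
        move=> _ _ /asboolP [a ->] /asboolP [b ->]; apply/asboolP.
        by exists (a - b); rewrite !KV_constE rmorphB.
      move=> _ _ /asboolP [a ->] /asboolP [b ->]; apply/asboolP.
      by exists (a * b); rewrite !KV_constE rmorphM.
    move=> z [[a ->]|[u]]; first by apply/asboolP; exists a.
    rewrite memv0 => /eqP -> ->; apply/asboolP; exists 0.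
    by rewrite KV_in0 invr0 KV_constE rmorph0.
  have /sub /asboolP [a ea] := hc 0; have /sub /asboolP [b eb] := hc 1.
  rewrite expr0 mulr1 in ea; rewrite expr1 in eb.
  have -> : y = cst (a^-1 * b).
    by rewrite KV_constE rmorphM fmorphV -!KV_constE -ea -eb mulKf.
  exact: invU_cst.
rewrite span_cons; have [xs|xs] := boolP (x \in <<s>>%VS).
  have -> // : (<[x]> + <<s>>)%VS = <<s>>%VS.
  by apply/eqP; rewrite eqEsubv addvSr andbT subv_add subvv andbT -memvE.
exact: completely_closed_step.
Qed.

Lemma RV_predE : @RV_pred F V =i invU fullv.
Proof.
move=> z; apply/idP/idP.
  move=> /asboolP; apply; first exact: subringP.
    by move=> a; apply: invU_cst.
  by move=> v _; apply: invU_inv; apply: memvf.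
apply: subring_gen_min; first exact: RV_pred_subring.
move=> y [[a ->]|[u _ ->]].
  by apply/asboolP => B hB hc hv; apply: hc.
have [->|u0] := eqVneq u 0; last by apply/asboolP => B hB hc hv; apply: hv.
by rewrite KV_in0 invr0; exact: rpred0.
Qed.

End Normality.

Lemma fraction_repr (A : idomainType) (x : {fraction A}) :
  exists a b : A, b != 0 /\ x = FracField.tofrac a / FracField.tofrac b.
Proof.
elim/quotW: x => r; exists (frac r).1, (frac r).2; split; first exact: denom_ratioP.
apply: (canRL (mulfK _)); first by rewrite tofrac_eq0 denom_ratioP.
rewrite -[LHS]/(FracField.mul _ _) !piE; apply/eqmodP => /=.
rewrite FracField.equivfE /FracField.mulf !numden_Ratio ?mulf_neq0 ?oner_neq0 ?denom_ratioP //.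
by rewrite !mulr1 mulrC.
Qed.

(** Integral elements of a fraction field are almost integral: all powers of [x]
    are combinations of the first ones, which have a common denominator. *)
Lemma integral_almost (A : idomainType) (x : {fraction A}) :
  integralOver (@FracField.tofrac A) x ->
  exists2 c : A, c != 0 &
    forall n, exists r, FracField.tofrac c * x ^+ n = FracField.tofrac r.
Proof.
move=> [p pm px]; have [a [b [b0 ex]]] := fraction_repr x.
have yb : FracField.tofrac b * x = FracField.tofrac a.
  by rewrite ex mulrC divfK // tofrac_eq0.
pose m := (size p).-1; exists (b ^+ m); first exact: expf_neq0.
move=> n; have [N] := ubnP n; elim: N n => // N IH n; rewrite ltnS => nN.
have [nm|mn] := leqP n m.
  exists (b ^+ (m - n) * a ^+ n).
  by rewrite -(subnK nm) exprD !tofracM !tofracXn -yb exprMn addnK mulrA.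
have p0 : (0 < size p)%N by rewrite size_poly_gt0 monic_neq0.
have ym : x ^+ m = - \sum_(i < m) FracField.tofrac p`_i * x ^+ i.
  move: px; rewrite /root (@horner_coef_wide _ (size p)); last exact: size_poly.
  rewrite -(prednK p0) -/m.
  rewrite big_ord_recr /= coef_map /= -lead_coefE (eqP pm) tofrac1 mul1r.
  rewrite addrC addr_eq0 => /eqP ->; congr (- _); apply: eq_bigr => i _.
  by rewrite coef_map.
have /choice [r hr] : forall i : 'I_m, exists r,
    FracField.tofrac (b ^+ m) * x ^+ (n - m + i) = FracField.tofrac r.
  move=> i; apply: IH; apply: leq_trans nN; rewrite -[X in (_ < X)%N](subnK (ltnW mn)).
  by rewrite ltn_add2l.
exists (- \sum_(i < m) p`_i * r i).
rewrite -(subnK (ltnW mn)) exprD ym mulrN mulrN tofracN rmorph_sum; congr (- _).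
rewrite mulr_sumr mulr_sumr; apply: eq_bigr => i _.
by rewrite /= tofracM -hr exprD; move: (FracField.tofrac _) (FracField.tofrac _) => z w; ring.
Qed.

(** The witness [c] of almost integrality over [RV V] is one inside [KV], where
    complete integral closedness is available. *)
Lemma RV_integrally_closed (F : finFieldType) (V : vectType F) :
  integrally_closed (RV V).
Proof.
move=> x /integral_almost [c c0 hc].
have [a [b [b0 ex]]] := fraction_repr x.
have v0 (z : RV V) : (RV_val z == 0) = (z == 0).
  by rewrite -(inj_eq val_inj) (rmorph0 (val : RV V -> _)).
have hK n : RV_val c * (RV_val a / RV_val b) ^+ n \in invU (V := V) fullv.
  have [r hr] := hc n; rewrite -RV_predE.
  have e : c * a ^+ n = r * b ^+ n.
    apply/eqP; rewrite -tofrac_eq !tofracM !tofracXn -hr ex; apply/eqP.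
    by rewrite expr_div_n -mulrA divfK // expf_neq0 // tofrac_eq0.
  have -> : RV_val c * (RV_val a / RV_val b) ^+ n = RV_val r; last exact: valP.
  rewrite expr_div_n; apply: (mulIf (expf_neq0 n (_ : RV_val b != 0))).
    by rewrite v0.
  rewrite mulrA divfK ?expf_neq0 ?v0 //.
  by have := congr1 (val : RV V -> _) e; rewrite !rmorphM !rmorphXn.
have := @completely_closed_invU F V fullv _ _ _ hK; rewrite v0 c0 -RV_predE => /(_ isT) zR.
exists (MkRV zR); have e : a = MkRV zR * b.
  by apply: val_inj; rewrite rmorphM /= divfK ?v0.
by rewrite ex {1}e tofracM mulfK // tofrac_eq0.
Qed.

(** * Homogeneous spectra of domains *)

Section ProjDomain.
Variables (A : idomainType) (G : grading A).

Definition zero_ideal : {pred A} := fun x => x == 0.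

Lemma zero_idealr_closed : idealr_closed zero_ideal.
Proof.
split; rewrite ?unfold_in /zero_ideal ?oner_eq0 // => a x y.
by rewrite !unfold_in => /eqP -> /eqP ->; rewrite mulr0 addr0.
Qed.

Lemma zero_ideal_prime : prime_idealr_closed zero_ideal.
Proof. by move=> x y; rewrite !unfold_in /zero_ideal mulf_eq0. Qed.

Definition zero_prime : prime_idealr A :=
  HB.pack zero_ideal (isIdealr.Build A zero_ideal zero_idealr_closed)
    (isPrimeIdealrClosed.Build A zero_ideal zero_ideal_prime).

Lemma in_zero_prime x : (x \in zero_prime) = (x == 0). Proof. by []. Qed.

Lemma zero_prime_homog n (c : nat -> A) : (forall i, G i (c i)) ->
  \sum_(i < n) c i \in zero_prime -> forall i, (i < n)%N -> c i \in zero_prime.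
Proof.
move=> hc; rewrite in_zero_prime => /eqP /(gpart_uniq hc) h i /h ->.
by rewrite in_zero_prime.
Qed.

Section Generic.
Variables (d0 : nat) (a0 : A).
Hypotheses (d0_gt0 : (0 < d0)%N) (Ga0 : G d0 a0) (a0_neq0 : a0 != 0).

Definition generic_point : proj_point G :=
  @ProjPoint A G zero_prime zero_prime_homog
    (ex_intro _ d0 (ex_intro _ a0 (And3 d0_gt0 Ga0 a0_neq0))).

Lemma proj_open_generic U x : @proj_open A G U -> U x -> U generic_point.
Proof.
move=> [E [_ hU]] /hU [a Ea ax]; apply/hU; exists a => //.
by rewrite in_zero_prime; apply: contraNneq ax => ->; apply: idealr0.
Qed.

Lemma hloc_generic_neq0 (h : hfrac generic_point) : num h != 0 ->
  \pi_(hloc generic_point) h != 0.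
Proof.
move=> h0; apply/eqP => /hloc_eq [k [_ kp]] /=.
rewrite mul0r subr0 mulr1 => /eqP; rewrite mulf_eq0 (negbTE h0) orbF.
by rewrite -in_zero_prime (negbTE kp).
Qed.

Lemma hloc_num0 (p : proj_point G) (h : hfrac p) : num h = 0 -> \pi_(hloc p) h = 0.
Proof. by move=> e; apply: hfrac_eq_pi; rewrite e /= mul0r mul0r. Qed.

(** Every non-empty open set contains the generic point, and the stalk there is a
    domain. *)
Lemma Proj_integral : integral (Proj G).
Proof.
split; first by exists generic_point.
move=> U Uopen [x0 Ux0] s t ss ts st0.
have Ug := proj_open_generic Uopen Ux0.
pose g : {x | U x} := exist _ _ Ug.
(* A non-zero section is locally [f / g] with [f] non-zero, so it is non-zero
   at the generic point. *)
have key (r : forall x : {x | U x}, hloc (sval x)) : @proj_section A G U r ->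
    ~ (forall x, r x = 0) ->
    exists h : hfrac (sval g), num h != 0 /\ r g = \pi h.
  move=> hr /existsNP [x rx]; have [W [Wo Wx [d [f [k [_ _ hW]]]]]] := hr x.
  have [h [hn _ e]] := hW x Wx.
  have [h' [hn' _ e']] := hW g (proj_open_generic Wo Wx).
  exists h'; split=> //; rewrite hn' -hn; apply/eqP => h0; apply: rx.
  by rewrite e hloc_num0.
apply: contrapT => /not_orP [/(key s ss) [h [h0 eh]] /(key t ts) [k [k0 ek]]].
have := st0 g; rewrite eh ek => e.
have : \pi_(hloc generic_point) (hfrac_mul h k) != 0.
  by apply: hloc_generic_neq0; rewrite mulf_neq0.
by rewrite pi_hloc_mul => /eqP.
Qed.

End Generic.

Section Embedding.
Variables (p : proj_point G) (K : fieldType) (j : {rmorphism A -> K}).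
Hypothesis j_inj : injective j.

Let j0 x : (j x == 0) = (x == 0).
Proof. by rewrite -(rmorph0 j) (inj_eq j_inj). Qed.

Let den0 (h : hfrac p) : den h != 0.
Proof. by have [_] := hfracP h; apply: contraNneq => ->; apply: idealr0. Qed.

(** The homogeneous localizations of a domain embed into any field that contains
    it; working there avoids the quotient type. *)
Definition hloc_val (z : hloc p) : K := j (num (repr z)) / j (den (repr z)).

Lemma hloc_valE h : hloc_val (\pi_(hloc p) h) = j (num h) / j (den h).
Proof.
have /hloc_eq [k [_ kp e]] : \pi_(hloc p) (repr (\pi_(hloc p) h)) = \pi_(hloc p) h.
  by rewrite reprK.
rewrite /hloc_val; apply/eqP; rewrite eqr_div ?j0 // -!rmorphM (inj_eq j_inj).
move/eqP: e; rewrite mulf_eq0 subr_eq0 => /orP [/eqP k0|//].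
by move: kp; rewrite k0 idealr0.
Qed.

Lemma hloc_val_inj : injective hloc_val.
Proof.
elim/quotW => x; elim/quotW => y; rewrite !hloc_valE => /eqP.
rewrite eqr_div ?j0 // -!rmorphM (inj_eq j_inj) => /eqP e.
exact: hfrac_eq_pi.
Qed.

Lemma hloc_val_zmod : zmod_morphism hloc_val.
Proof.
elim/quotW => x; elim/quotW => y.
rewrite -[X in hloc_val X]/(hloc_add (\pi x) (hloc_opp (\pi y))).
rewrite -pi_hloc_opp -pi_hloc_add !hloc_valE /= !(rmorphD, rmorphM, rmorphN) /=.
by field; rewrite !j0 !den0.
Qed.

Lemma hloc_val_monoid : monoid_morphism hloc_val.
Proof.
split; first by rewrite hloc_valE /= rmorph1 divr1.
elim/quotW => x; elim/quotW => y.
rewrite -[X in hloc_val X]/(hloc_mul (\pi x) (\pi y)).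
rewrite -pi_hloc_mul !hloc_valE /= !rmorphM /=.
by field; rewrite !j0 !den0.
Qed.

Definition hloc_emb : {rmorphism hloc p -> K} :=
  HB.pack hloc_val (GRing.isZmodMorphism.Build _ _ hloc_val hloc_val_zmod)
    (GRing.isMonoidMorphism.Build _ _ hloc_val hloc_val_monoid).

Lemma hloc_unitP h : is_unit (\pi_(hloc p) h) <-> num h \notin p.
Proof.
split=> [[]|hn].
  elim/quotW => k; rewrite -[LHS]/(hloc_mul (\pi h) (\pi k)) -pi_hloc_mul.
  move/hloc_eq => [u [_ up]] /= /eqP; rewrite mulr1 mul1r mulf_eq0.
  have [e|_] := eqVneq u 0; first by move: up; rewrite e idealr0.
  rewrite subr_eq0 /= => /eqP e.
  have [_ dh] := hfracP h; have [_ dk] := hfracP k.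
  have : den h * den k \notin p by rewrite prime_idealrM negb_or dh.
  by rewrite -e prime_idealrM negb_or => /andP [].
have [[d nh dh] hp] := hfracP h.
have hk : (exists2 d, G d (den h) & G d (num h)) /\ num h \notin p by split=> //; exists d.
pose k : hfrac p := HFrac hk; exists (\pi_(hloc p) k).
rewrite -[LHS]/(hloc_mul (\pi h) (\pi k)) -pi_hloc_mul.
by apply: hfrac_eq_pi; rewrite /= mulr1 mul1r mulrC.
Qed.

Lemma hloc_local : is_local (hloc p).
Proof.
elim/quotW => x; elim/quotW => y.
rewrite !hloc_unitP -[X in is_unit X]/(hloc_add (\pi x) (\pi y)) -pi_hloc_add hloc_unitP /=.
move=> /negP; rewrite negbK => hx /negP; rewrite negbK => hy.
apply/negP; rewrite negbK; apply: rpredD.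
  by rewrite mulrC idealMr.
by rewrite mulrC idealMr.
Qed.

End Embedding.
End ProjDomain.

(** * A criterion for the Cohen-Macaulay property *)

Section Criterion.
Variable R : comNzRingType.

Lemma local_max_ideal : is_local R ->
  exists M : prime_idealr R, forall x, x \in M <-> ~ is_unit x.
Proof.
move=> loc; pose M : {pred R} := fun x => `[< ~ is_unit x >].
have unitM (a x : R) : is_unit (a * x) -> is_unit x.
  by move=> [b e]; exists (a * b); rewrite -e; ring.
have Mi : idealr_closed M.
  split.
  - by apply/asboolP => [[y]]; rewrite mul0r => /eqP; rewrite eq_sym oner_eq0.
  - by apply/asboolP => h; apply: h; exists 1; rewrite mulr1.
  - move=> a x y /asboolP hx /asboolP hy; apply/asboolP; apply: loc => //.
    by move/unitM.
have Mp : prime_idealr_closed M.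
  move=> x y /asboolP hxy; apply/orP; apply: contrapT => /not_orP [nx ny].
  have /contrapT [u eu] : ~ ~ is_unit x by move/asboolP.
  have /contrapT [v ev] : ~ ~ is_unit y by move/asboolP.
  apply: hxy; exists (u * v).
  have -> : x * y * (u * v) = (x * u) * (y * v) by ring.
  by rewrite eu ev mulr1.
pose MM : prime_idealr R :=
  HB.pack M (isIdealr.Build R M Mi) (isPrimeIdealrClosed.Build R M Mp).
exists MM.
by move=> x; split=> [/asboolP|] // h; apply/asboolP.
Qed.

(** A regular sequence of length [size s] and [e] elements independent modulo
    the maximal ideal force Cohen-Macaulayness as soon as [size s + e] bounds
    the number of independent elements: every chain of primes extends the
    independent family, and every regular sequence yields a chain. *)
Lemma cohen_macaulay_criterion (F : comNzRingType) (f : {rmorphism F -> R}) N (s : seq R) x e :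
  is_local R -> noetherian R ->
  weakly_regular s -> (forall a, a \in s -> ~ is_unit a) ->
  indep_mod f (fun a => ~ is_unit a) x e -> (size s + e = N)%N ->
  (forall y n, indep_mod f (fun a => a = 0) y n -> (n <= N)%N) ->
  cohen_macaulay_local R.
Proof.
move=> loc noe reg nu ind sN bound; split=> //.
have [M MP] := local_max_ideal loc.
have bnd m (C : nat -> prime_idealr R) : prime_chain m C -> (m <= size s)%N.
  move=> chC; have [||y hy] := @chain_indep _ _ f C m M x e chC.
  - move=> a aC; apply/MP => [[b ab]].
    have : a * b \in C m by rewrite mulrC idealMr.
    by rewrite ab idealr1.
  - by move=> q /MP hq; apply: ind.
  have : (e + m <= N)%N by apply: (bound y) => q e0; apply: hy; rewrite e0 idealr0.
  by rewrite -sN addnC leq_add2r.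
have chain (t : seq R) : weakly_regular t -> (forall a, a \in t -> ~ is_unit a) ->
    exists C : nat -> prime_idealr R, prime_chain (size t) C.
  move=> rt nt; have [|C []] := @weakly_regular_chain _ t M rt; last by exists C.
  by move=> a /nt /MP.
exists (size s); first by split; [exact: chain|exact: bnd].
split; first by exists s.
by move=> t [nt rt]; have [C /bnd] := chain t rt nt.
Qed.

End Criterion.

Lemma npeval_closed (R A : comNzRingType) (f : {rmorphism R -> A}) (D : subringClosed A)
    x n p : (forall a, f a \in D) -> (forall i, (i < n)%N -> x i \in D) ->
  npeval f x n p \in D.
Proof.
move=> fD; elim: n p => [|n IH] p xD; first exact: fD.
rewrite npevalS; apply: rpred_horner; last exact: xD.
apply/polyOverP => i; rewrite coef_map; apply: IH => j hj; apply: xD.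
exact: ltnW.
Qed.

Section Tower.
Variables (K : fieldType) (A : subringClosed K) (mm : zmodClosed K).
Hypothesis mmM : forall a x, a \in A -> x \in mm -> a * x \in mm.
Hypothesis mmV : forall u, u \in A -> u \notin mm -> u^-1 \in A.
Hypothesis mm1 : 1 \notin mm.

Lemma notin_mm_neq0 u : u \notin mm -> u != 0.
Proof. by apply: contraNneq => ->; apply: rpred0. Qed.

Lemma notin_mmM u v : u \in A -> v \in A -> u \notin mm -> v \notin mm -> u * v \notin mm.
Proof.
move=> uA vA um vm; apply: contra mm1 => uv.
have -> : 1 = u^-1 * v^-1 * (u * v).
  by field; rewrite !notin_mm_neq0.
by apply: mmM => //; apply: rpredM; apply: mmV.
Qed.

Lemma notin_mmV u : u \in A -> u \notin mm -> u^-1 \notin mm.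
Proof.
move=> uA um; apply: contra mm1 => h.
by rewrite -(divff (notin_mm_neq0 um)); apply: mmM.
Qed.

Definition localize (B : {pred K}) : {pred K} := fun z =>
  `[< exists a b, [/\ a \in B, b \in B, b \notin mm & z = a / b] >].

Section Localize.
Variable B : subringClosed K.
Hypothesis BA : {subset B <= A}.

Lemma localize_closed : subring_closed (localize B).
Proof.
split.
- by apply/asboolP; exists 1, 1; rewrite rpred1 divr1.
- move=> _ _ /asboolP [a [b [aB bB bm ->]]] /asboolP [c [d [cB dB dm ->]]].
  apply/asboolP; exists (a * d - c * b), (b * d); split.
  + by rewrite rpredB ?rpredM.
  + exact: rpredM.
  + by apply: notin_mmM => //; apply: BA.
  + by field; rewrite !notin_mm_neq0.
- move=> _ _ /asboolP [a [b [aB bB bm ->]]] /asboolP [c [d [cB dB dm ->]]].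
  apply/asboolP; exists (a * c), (b * d); split.
  + exact: rpredM.
  + exact: rpredM.
  + by apply: notin_mmM => //; apply: BA.
  + by field; rewrite !notin_mm_neq0.
Qed.

Lemma localize_sub : {subset B <= localize B}.
Proof. by move=> z zB; apply/asboolP; exists z, 1; rewrite rpred1 divr1. Qed.

Lemma localize_subA : {subset localize B <= A}.
Proof.
move=> _ /asboolP [a [b [aB bB bm ->]]]; apply: rpredM; first exact: BA.
by apply: mmV => //; apply: BA.
Qed.

Lemma localizeV z : z \in localize B -> z \notin mm -> z^-1 \in localize B.
Proof.
move=> /asboolP [a [b [aB bB bm ->]]] zm; apply/asboolP; exists b, a; split=> //.
  apply: contra zm => am; rewrite mulrC; apply: mmM => //.
  by apply: mmV => //; apply: BA.
by rewrite invfM invrK mulrC.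
Qed.

Lemma localize_min (C : {pred K}) : {subset C <= localize B} ->
  {subset localize C <= localize B}.
Proof.
move=> CB _ /asboolP [a [b [/CB aB /CB bB bm ->]]].
have [_ _ h] := localize_closed; apply: h => //; exact: localizeV.
Qed.

End Localize.

Variables (F : comNzRingType) (f : {rmorphism F -> K}).

(** The invariant carried up the flag: parameters and independent residues are
    counted together, since each step produces one or the other. *)
Definition parameters (D : {pred K}) n := exists s x e,
  [/\ sub_regular D s, {subset s <= mm}, forall i, (i < e)%N -> x i \in D,
      indep_mod f (fun a => a \in mm) x e & (size s + e = n)%N].

Section Step.
Variables (K' : divringClosed K) (X : K) (S : seq K) (D A' : subringClosed K).
Hypothesis trX : transc K' X.
Hypothesis uS : uniq S.
Hypothesis SK : forall a, a \in S -> a \in K'.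
Hypothesis DS : forall a b, a \in S -> b \in S -> a != b -> (a - b)^-1 \in D.
Hypothesis DK : {subset D <= K'}.
Hypothesis fD : forall a, f a \in D.
Hypothesis DV : forall u, u \in D -> u \notin mm -> u^-1 \in D.
Hypothesis A'A : {subset A' <= A}.
Hypothesis A'V : forall u, u \in A' -> u \notin mm -> u^-1 \in A'.
Hypothesis EA : {subset poles X S D <= A'}.
Hypothesis A'E : {subset A' <= localize (poles X S D)}.

Let locA' y : y \in A' -> exists u,
  [/\ u \in poles X S D, u != 0, u^-1 \in A' & u * y \in poles X S D].
Proof.
move=> /A'E /asboolP [a [b [aE bE bm ->]]]; exists b.
rewrite notin_mm_neq0 // mulrC divfK ?notin_mm_neq0 //; split=> //.
by apply: A'V => //; apply: EA.
Qed.

Let DA' : {subset D <= A'}.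
Proof. by move=> z zD; apply: EA; apply: poles_const. Qed.

(** [A'] is a localization of a free [D]-module, and an element of the pole ring
    monic at every pole prolongs regular sequences. *)
Lemma parameters_monic n cg pg : S != [::] -> cg \in D ->
  (forall a, pg a \is a polyOver D) -> (forall a, a \in S -> pg a \is monic) ->
  pexp X S cg pg \in mm -> parameters D n -> parameters A' n.+1.
Proof.
move=> S0 hcg hpg mon gm [s [x [e [reg sm xD ind <-]]]].
exists (rcons s (pexp X S cg pg)), x, e; split=> //.
- exact: (@sub_regular_rcons _ K' X S trX uS SK D A' DS DK EA locA').
- by move=> y; rewrite mem_rcons inE => /orP [/eqP ->|/sm].
- by move=> i /xD /DA'.
- by rewrite size_rcons addSn.
Qed.

(** The sum of the [(X - a)^-1] is monic at every pole, and it lies in the maximal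
    ideal because each of its terms does. *)
Lemma parameters_vertex n : S != [::] -> (forall a, a \in S -> (X - a)^-1 \in mm) ->
  parameters D n -> parameters A' n.+1.
Proof.
move=> S0 Sm; apply: (@parameters_monic n 0 (fun=> 1)) => //.
- exact: rpred0.
- by move=> _; apply: rpred1.
- by move=> a _; apply: monic1.
rewrite /pexp add0r big_seq; apply: rpred_sum => a aS.
by rewrite hornerC mulr1 Sm.
Qed.

(** With a single pole the residue of [X^-1] is either algebraic over that of
    [D], and a polynomial with unit leading coefficient gives a new parameter, or
    transcendental. *)
Lemma parameters_torus n : S = [:: 0] -> parameters D n -> parameters A' n.+1.
Proof.
move=> S0 par; pose T := (X - 0)^-1.
have gE c q : pexp X S c (fun=> q) = c + T * q.[T] by rewrite /pexp S0 big_seq1.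
have TA' : T \in A'.
  apply: EA; rewrite /T -[_^-1]mul1r -[X - 0]expr1; apply: poles_monom => //.
    exact: rpred1.
  by rewrite S0 mem_head.
(* Algebraic relations of the residue of [T], by degree. *)
pose cand m := `[< exists c (q : {poly K}), [/\ c \in D, q \is a polyOver D,
   size q = m, c + T * q.[T] \in mm & c \notin mm \/ exists i, q`_i \notin mm] >].
have [exm|nom] := pselect (exists m, cand m).
  case: (ex_minnP exm) => m /asboolP [c [q [cD qD sq gm cq]]] minm.
  have q0 : q != 0.
    apply/eqP => e; case: cq => [/negP|[i /negP]]; apply.
      by move: gm; rewrite e horner0 mulr0 addr0.
    by rewrite e coef0 rpred0.
  have lD : lead_coef q \in D by rewrite lead_coefE polyOver_coef.
  have lm : lead_coef q \notin mm.
    apply/negP => lm; have sq0 : (0 < size q)%N by rewrite size_poly_gt0.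
    pose q' := q - lead_coef q *: 'X^((size q).-1).
    have sq' : (size q' < m)%N.
      rewrite -sq -[X in (_ < X)%N](prednK sq0) ltnS; apply/leq_sizeP => j.
      rewrite /q' coefB coefZ coefXn leq_eqVlt => /orP [/eqP <-|hj].
        by rewrite eqxx mulr1 lead_coefE subrr.
      by rewrite gtn_eqF // mulr0 subr0 nth_default // -(prednK sq0).
    move: sq'; rewrite ltnNge minm //; apply/asboolP; exists c, q'; split=> //.
    - by rewrite rpredB // polyOverZ // polyOverXn.
    - have -> : c + T * q'.[T] = c + T * q.[T] - T * T ^+ (size q).-1 * lead_coef q.
        by rewrite /q' hornerD hornerN hornerZ hornerXn; ring.
      apply: rpredB => //; apply: mmM => //.
      by rewrite -exprS rpredX // A'A.
    - case: cq => [|[i im]]; first by left.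
      right; exists i; rewrite /q' coefB coefZ coefXn.
      case: eqP => [ei|_]; last by rewrite mulr0 subr0.
      by move: im; rewrite ei -lead_coefE lm.
  have l0 : lead_coef q != 0 by rewrite lead_coef_eq0.
  have liD := DV lD lm.
  apply: (@parameters_monic n ((lead_coef q)^-1 * c) (fun=> (lead_coef q)^-1 *: q)).
  - by rewrite S0.
  - exact: rpredM.
  - by move=> _; apply: polyOverZ.
  - by move=> a _; rewrite monicE lead_coefZ mulVf.
  - rewrite gE hornerZ.
    have -> : (lead_coef q)^-1 * c + T * ((lead_coef q)^-1 * q.[T]) =
      (lead_coef q)^-1 * (c + T * q.[T]) by ring.
    by apply: mmM => //; apply/A'A/DA'.
  - exact: par.
case: par => s [x [e [reg sm xD ind <-]]].
pose y i := if i == e then T else x i.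
have ye : y e = T by rewrite /y eqxx.
have yx i : (i < e)%N -> y i = x i by move=> h; rewrite /y ltn_eqF.
(* No relation: [T] prolongs the independent family. *)
exists s, y, e.+1; split=> //.
- exact: (@sub_regular_flat _ K' X S trX uS SK D A' DS DK EA locA').
- move=> i; rewrite ltnS leq_eqVlt => /orP [/eqP ->|hi]; first by rewrite ye.
  by rewrite yx // DA' // xD.
- apply: indep_mod_transc; last first.
    by apply: indep_mod_ext ind => i /yx.
  have yD p : npeval f y e p \in D.
    by apply: npeval_closed => // i hi; rewrite yx // xD.
  elim/poly_ind => [|p c _].
    by move=> _ i; rewrite coef0 rmorph0 rpred0.
  have -> : npeval f y e.+1 (p * 'X + c%:P) =
      npeval f y e c + T * (map_poly (npeval f y e) p).[T].
    by rewrite npevalS rmorphD rmorphM /= map_polyX map_polyC hornerMXaddC ye addrC mulrC.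
  move=> hm; apply: contrapT => /existsNP [i /negP im].
  apply: nom; exists (size (map_poly (npeval f y e) p)); apply/asboolP.
  exists (npeval f y e c), (map_poly (npeval f y e) p); split=> //.
    by apply/polyOverP => k; rewrite coef_map; apply: yD.
  move: im; rewrite coefD coefMX coefC; case: i => [|i] /=.
    by rewrite add0r; left.
  by rewrite addr0 => im; right; exists i; rewrite coef_map.
- by rewrite addnS.
Qed.

End Step.
End Tower.

(** * Parameters along a flag of subspaces *)

Lemma torus_unit (K : fieldType) (k x y u : K) : x != 0 -> y != 0 ->
  k + (x * y^-1)^-1 * (u * y^-1) = y * x^-1 * (y * (k * x + u)^-1)^-1.
Proof. by move=> x0 y0; rewrite !invfM !invrK; field; rewrite x0 y0. Qed.

Lemma torus_ratio (K : fieldType) (k x y u : K) : x != 0 -> y != 0 -> k * x + u != 0 ->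
  y * (k * x + u)^-1 = (x * y^-1)^-1 / (k + (x * y^-1)^-1 * (u * y^-1)).
Proof.
move=> x0 y0 v0; rewrite torus_unit // !invfM !invrK.
by field; rewrite x0 y0 v0.
Qed.

Section RatioTower.
Variables (F : finFieldType) (V : vectType F) (K : fieldType).
Variables (lin : V -> K) (cst : {rmorphism F -> K}) (KU : {vspace V} -> divringClosed K).
Implicit Types (U W : {vspace V}) (u v x : V) (k : F).
Hypothesis linD : forall u v, lin (u + v) = lin u + lin v.
Hypothesis linZ : forall k v, lin (k *: v) = cst k * lin v.
Hypothesis lin_eq0 : forall v, (lin v == 0) = (v == 0).
Hypothesis KU_lin : forall U u, u \in U -> lin u \in KU U.
Hypothesis KU_cst : forall U k, cst k \in KU U.
Hypothesis KU_transc : forall U x, x \notin U -> transc (KU U) (lin x).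

Variables (A : subringClosed K) (mm : zmodClosed K).
Hypothesis mmM : forall (a x : K), a \in A -> x \in mm -> a * x \in mm.
Hypothesis mmV : forall (u : K), u \in A -> u \notin mm -> u^-1 \in A.
Hypothesis mm1 : 1 \notin mm.

Variable x1 : V.
Hypothesis x1_neq0 : x1 != 0.
Definition ratio v := lin x1 / lin v.
Hypothesis ratioA : forall v, ratio v \in A.
Hypothesis cstA : forall k, cst k \in A.

Let lx1 : lin x1 != 0. Proof. by rewrite lin_eq0. Qed.

Let lin0 : lin 0 = 0. Proof. by apply/eqP; rewrite lin_eq0. Qed.

Let linN u : lin (- u) = - lin u.
Proof. by rewrite -scaleN1r linZ rmorphN1 mulN1r. Qed.

Lemma ratio0 : ratio 0 = 0.
Proof. by rewrite /ratio lin0 invr0 mulr0. Qed.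

(** Since [1/x1] is a unit at the given point, these are the vectors whose inverse
    does not vanish there. *)
Definition visible v := (v == 0) || (ratio v \notin mm).

Lemma visibleE v : v != 0 -> visible v = (ratio v \notin mm).
Proof. by rewrite /visible => /negbTE ->. Qed.

(** By the relation [1/u * 1/v = (1/u + 1/v) * 1/(u + v)], the last factor does not
    vanish at a point where the left side does not. *)
Lemma visibleD u v : visible u -> visible v -> visible (u + v).
Proof.
have [->|u0] := eqVneq u 0; first by rewrite add0r.
have [->|v0] := eqVneq v 0; first by rewrite addr0.
have [->|uv0] := eqVneq (u + v) 0; first by rewrite /visible eqxx.
rewrite !visibleE // => um vm.
have e : ratio u * ratio v = (ratio u + ratio v) * ratio (u + v).
  have h : lin u + lin v != 0 by rewrite -linD lin_eq0.
  by rewrite /ratio linD; field; rewrite h !lin_eq0 u0 v0.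
have : ratio u * ratio v \notin mm by apply: (notin_mmM mmM mmV mm1).
by rewrite e; apply: contra; apply: mmM; apply: rpredD.
Qed.

Lemma visibleZ k v : visible v -> visible (k *: v).
Proof.
have [->|k0] := eqVneq k 0; first by rewrite scale0r /visible eqxx.
have [->|v0] := eqVneq v 0; first by rewrite scaler0 /visible eqxx.
rewrite !visibleE ?scaler_eq0 ?negb_or ?k0 //.
apply: contra => km; have -> : ratio v = cst k * ratio (k *: v).
  have ck : cst k != 0 by rewrite fmorph_eq0.
  by rewrite /ratio linZ; field; rewrite ck lin_eq0 v0.
exact: mmM.
Qed.

Definition ratios U := subring_gen (fun z => (exists k, z = cst k) \/ exists2 u, u \in U & z = ratio u).
HB.instance Definition _ U := GRing.SubringClosed.on (ratios U).

Lemma ratiosA U : {subset ratios U <= A}.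
Proof.
apply: subring_gen_min; first exact: subringP.
by move=> z [[k ->]|[u _ ->]].
Qed.

Definition local_ratios U := localize mm (ratios U).

Lemma local_ratios_closed U : subring_closed (local_ratios U).
Proof. exact: (localize_closed mmM mmV mm1 (@ratiosA U)). Qed.
HB.instance Definition _ U :=
  GRing.isSubringClosed.Build K (local_ratios U) (local_ratios_closed U).

Lemma local_ratios_sub U : {subset ratios U <= local_ratios U}.
Proof. by move=> z; apply: (localize_sub mm1). Qed.

Lemma local_ratiosA U : {subset local_ratios U <= A}.
Proof. exact: (localize_subA mmV (@ratiosA U)). Qed.

Lemma local_ratiosV U z : z \in local_ratios U -> z \notin mm -> z^-1 \in local_ratios U.
Proof. exact: (localizeV mmM mmV (@ratiosA U)). Qed.

Lemma ratio_local U u : u \in U -> ratio u \in local_ratios U.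
Proof. by move=> uU; apply/local_ratios_sub/mem_subring_gen; right; exists u. Qed.

Lemma const_local U a : cst a \in local_ratios U.
Proof. by apply/local_ratios_sub/mem_subring_gen; left; exists a. Qed.

Lemma local_ratios_mono U W : (U <= W)%VS -> {subset local_ratios U <= local_ratios W}.
Proof.
move=> UW; have h : {subset ratios U <= ratios W}.
  apply: subring_gen_min; first exact: subringP.
  move=> z [[a ->]|[u uU ->]]; apply: mem_subring_gen; first by left; exists a.
  by right; exists u => //; apply: (subvP UW).
move=> z /asboolP [a [b [aU bU bm ->]]]; apply/asboolP; exists a, b.
by split=> //; apply: h.
Qed.

Lemma local_ratios_field U : x1 \in U -> {subset local_ratios U <= KU U}.
Proof.
move=> x1U; have h : {subset ratios U <= KU U}.
  apply: subring_gen_min; first exact: subringP.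
  move=> z [[a ->]|[u uU ->]]; first exact: KU_cst.
  by rewrite rpredM ?rpredV ?KU_lin.
by move=> z /asboolP [a [b [/h aU /h bU _ ->]]]; rewrite rpredM ?rpredV.
Qed.

Local Notation params U n := (parameters mm cst (local_ratios U) n).

Section Step.
Variables (U : {vspace V}) (x : V) (n : nat).
Hypotheses (x1U : x1 \in U) (xU : x \notin U).
Let W := (<[x]> + U)%VS.
Let X := lin x / lin x1.

Let UW : (U <= W)%VS. Proof. exact: addvSr. Qed.
Let xW : x \in W. Proof. by rewrite (subvP (addvSl _ _)) ?memv_line. Qed.
Let x0 : x != 0. Proof. by apply: contraNneq xU => ->; apply: mem0v. Qed.
Let lx0 : lin x != 0. Proof. by rewrite lin_eq0. Qed.

Let trX : transc (KU U) X.
Proof.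
have h : (lin x1)^-1 \in KU U by rewrite rpredV KU_lin.
have h0 : (lin x1)^-1 != 0 by rewrite invr_eq0.
have -> : X = (lin x1)^-1 * lin x by exact: mulrC.
exact: (transcZ h h0 (KU_transc xU)).
Qed.

(** Here [X] and all the [X + u / x1] are units, so that
    [x1 / (k x + u) = X^-1 / (k + X^-1 * (u / x1))] needs the single pole [X^-1]. *)
Lemma params_visible : (forall u, u \in U -> visible u) -> visible x ->
  params U n -> params W n.+1.
Proof.
move=> Uv xv.
have X0 : X - 0 = X by rewrite subr0.
have XV : X^-1 = ratio x by rewrite /X invfM invrK mulrC.
have E0 : {subset [:: 0] <= KU U} by move=> z; rewrite inE => /eqP ->; apply: rpred0.
have DS (a b : K) : a \in [:: 0] -> b \in [:: 0] -> a != b -> (a - b)^-1 \in local_ratios U.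
  by rewrite !inE => /eqP -> /eqP ->; rewrite eqxx.
have sub := poles_subring trX (erefl : uniq [:: 0]) E0 DS.
have DE z : z \in local_ratios U -> z \in poles X [:: 0] (local_ratios U).
  exact: poles_const.
have EW : {subset poles X [:: 0] (local_ratios U) <= local_ratios W}.
  apply: poles_ind => [c|c a m]; first exact: local_ratios_mono.
  move=> cU; rewrite inE => /eqP ->; rewrite X0; apply: rpredM; first exact: (local_ratios_mono UW).
  by rewrite -exprVn rpredX // XV ratio_local.
have ES : {subset poles X [:: 0] (local_ratios U) <= A}.
  by move=> z /EW; apply: local_ratiosA.
have XE : X^-1 \in poles X [:: 0] (local_ratios U).
  have h : 1 * (X - 0) ^- 1 \in poles X [:: 0] (local_ratios U).
    by apply: poles_monom; [|exact: rpred1|exact: mem_head].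
  by rewrite mul1r expr1 X0 in h.
pose E : subringClosed K := HB.pack (poles X [:: 0] (local_ratios U))
  (GRing.isSubringClosed.Build K _ sub).
have [_ polB polM] := sub.
have ratE : {subset ratios W <= localize mm E}.
  apply: subring_gen_min.
    exact: (localize_closed mmM mmV mm1 (B := E)).
  move=> z [[a ->]|[v vW ->]].
    by apply: (localize_sub mm1 (B := E)); apply/DE/const_local.
  have [->|v0] := eqVneq v 0.
    rewrite ratio0; apply: (localize_sub mm1 (B := E)); exact: rpred0.
  case/memv_addP: vW v0 => _ /vlineP [k ->] [u uU ->] v0.
  have vv : visible (k *: x + u) by apply: visibleD (visibleZ k xv) (Uv _ uU).
  apply/asboolP; exists X^-1, (cst k + X^-1 * (lin u * (lin x1)^-1)); split=> //.
  - apply: rpredD; first exact/DE/const_local.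
    apply: polM => //; apply: DE.
    have [->|u0] := eqVneq u 0; first by rewrite lin0 mul0r rpred0.
    have -> : lin u * (lin x1)^-1 = (ratio u)^-1 by rewrite /ratio invfM invrK mulrC.
    by apply: local_ratiosV; [apply: ratio_local|rewrite -visibleE // Uv].
  - have -> : cst k + X^-1 * (lin u * (lin x1)^-1) = ratio x * (ratio (k *: x + u))^-1.
      by rewrite /ratio linD linZ /X; apply: torus_unit.
    apply: (notin_mmM mmM mmV mm1).
    + exact: ratioA.
    + by apply: mmV; [apply: ratioA|rewrite -visibleE].
    + by rewrite -visibleE.
    + apply: (notin_mmV mmM mm1); first exact: ratioA.
      by rewrite -visibleE.
  - rewrite /ratio linD linZ /X; apply: torus_ratio => //.
    by rewrite -linZ -linD lin_eq0.
apply: (parameters_torus mmM trX (erefl : uniq [:: 0]) E0 DS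
  (local_ratios_field x1U) (const_local U) (@local_ratiosV U)
  (@local_ratiosA W) (@local_ratiosV W) EW) => //.
exact: (localize_min mmM mmV mm1 (B := E) ES ratE).
Qed.

(** Here all the [x1 / (x + u)] lie in the maximal ideal: transversally to the
    stratum of the point one is near the vertex of a cone, and the poles are
    genuine. *)
Lemma params_invisible : (forall u, visible u -> u \in U) ->
  params U n -> params W n.+1.
Proof.
move=> vU; pose S := images (fun u => - (lin u / lin x1)) U.
have XS a : a \in S -> exists2 u, u \in U & (X - a)^-1 = ratio (x + u).
  case/imagesP => u uU ->; exists u => //.
  by rewrite opprK /X -mulrDl -linD invfM invrK mulrC.
have SK a : a \in S -> a \in KU U.
  by case/imagesP => u uU ->; rewrite rpredN rpredM ?rpredV ?KU_lin.
have DS a b : a \in S -> b \in S -> a != b -> (a - b)^-1 \in local_ratios U.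
  case/imagesP => u uU -> /imagesP [v vV ->] _.
  rewrite opprK addrC -mulrBl -linN -linD invfM invrK mulrC.
  by apply: ratio_local; rewrite rpredB.
have uS : uniq S := undup_uniq _.
have sub := poles_subring trX uS SK DS.
have DE z : z \in local_ratios U -> z \in poles X S (local_ratios U).
  exact: poles_const.
have xuW u : u \in U -> x + u \in W.
  by move=> uU; apply: rpredD => //; apply: (subvP UW).
have EW : {subset poles X S (local_ratios U) <= local_ratios W}.
  apply: poles_ind => [c|c a m]; first exact: local_ratios_mono.
  move=> cU /XS [u uU e]; apply: rpredM; first exact: (local_ratios_mono UW).
  by rewrite -exprVn rpredX // e ratio_local // xuW.
have ES : {subset poles X S (local_ratios U) <= A}.
  by move=> z /EW; apply: local_ratiosA.
pose E : subringClosed K := HB.pack (poles X S (local_ratios U))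
  (GRing.isSubringClosed.Build K _ sub).
have [_ polB polM] := sub.
have ratE : {subset ratios W <= E}.
  apply: subring_gen_min => // z [[a ->]|[v /memv_addP [_ /vlineP [k ->] [u uU ->]] ->]].
    exact/DE/const_local.
  have [->|k0] := eqVneq k 0.
    by rewrite scale0r add0r; apply/DE/ratio_local.
  have -> : k *: x + u = k *: (x + k^-1 *: u).
    by rewrite scalerDr scalerA divff // scale1r.
  have -> : ratio (k *: (x + k^-1 *: u)) = cst k^-1 * ratio (x + k^-1 *: u).
    by rewrite /ratio linZ invfM -fmorphV mulrCA.
  apply: polM; first exact/DE/const_local.
  pose w := - (lin (k^-1 *: u) * (lin x1)^-1).
  have wS : w \in S by apply/imagesP; exists (k^-1 *: u); rewrite ?memvZ.
  have -> : ratio (x + k^-1 *: u) = (X - w)^-1.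
    by rewrite /w opprK /X -mulrDl -linD invfM invrK mulrC.
  rewrite -[_^-1]mul1r -[X - w]expr1; apply: poles_monom => //.
  exact: rpred1.
have mS a : a \in S -> (X - a)^-1 \in mm.
  move=> /XS [u uU ->].
  have xu : x + u \notin U.
    by apply: contra xU => h; rewrite -(addrK u x) rpredB.
  have xu0 : x + u != 0 by apply: contraNneq xu => ->; apply: mem0v.
  have : ~~ visible (x + u) by apply: contra xu; apply: vU.
  by rewrite visibleE // negbK.
have S0 : S != [::].
  have : 0 \in S by apply/imagesP; exists 0; rewrite ?mem0v // lin0 mul0r oppr0.
  by case: (S).
apply: (parameters_vertex trX uS SK DS (local_ratios_field x1U) (@local_ratiosV W) EW) => //.
apply: (localize_min mmM mmV mm1 (B := E) ES).
by move=> z /ratE; apply: (localize_sub mm1 (B := E)).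
Qed.

End Step.

Lemma params_line : params <[x1]>%VS 0.
Proof.
exists [::], (fun=> 0), 0; split=> // k km.
apply: contrapT => /eqP k0; move/negP: mm1; apply.
have ck : cst k != 0 by rewrite fmorph_eq0.
by rewrite -(mulVf ck) -fmorphV; apply: mmM.
Qed.

(** The flag goes from the line of [x1] up to the subspace of visible vectors
    before it leaves it, so that each step is of one of the two kinds. *)
Lemma params_full : params fullv (\dim {:V}).-1.
Proof.
have tower n : (n < \dim {:V})%N -> exists U, [/\ x1 \in U, \dim U = n.+1,
    (forall u, u \in U -> visible u) \/ (forall u, visible u -> u \in U) & params U n].
  elim: n => [|n IH] hn.
    exists <[x1]>%VS; split; [exact: memv_line|by rewrite dim_vline x1_neq0| |exact: params_line].
    left=> _ /vlineP [k ->]; apply: visibleZ; rewrite visibleE //.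
    by rewrite /ratio divff.
  have [U [x1U dU good pU]] := IH (ltnW hn).
  have dW x : x \notin U -> \dim (<[x]> + U)%VS = n.+2.
    move=> xU; rewrite dimv_disjoint_sum; last exact: line_cap0.
    by rewrite dim_vline dU (contraNneq _ xU) // => ->; apply: mem0v.
  have x1W x : x1 \in (<[x]> + U)%VS by rewrite (subvP (addvSr _ _)).
  have [[x [xv xU]]|nov] := pselect (exists x, visible x /\ x \notin U).
    have Uv u : u \in U -> visible u.
      by case: good => [|h]; [apply|move: xU; rewrite h].
    exists (<[x]> + U)%VS; split=> //; first exact: dW.
      left=> _ /memv_addP [_ /vlineP [k ->] [u uU ->]].
      by apply: visibleD (visibleZ k xv) (Uv _ uU).
    exact: params_visible.
  have vU u : visible u -> u \in U.
    by move=> uv; apply: contrapT => /negP uU; apply: nov; exists u.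
  have [x _ xU] : exists2 x, x \in fullv & x \notin U.
    apply/subvPn; apply: contraL hn => /dimvS; rewrite dU -leqNgt.
    by move=> h; apply: h.
  exists (<[x]> + U)%VS; split=> //; first exact: dW.
    by right=> u /vU uU; rewrite (subvP (addvSr _ _)).
  exact: params_invisible.
have r0 : (0 < \dim {:V})%N.
  rewrite lt0n dimv_eq0; apply: contra x1_neq0 => /eqP e.
  by rewrite -memv0 -e memvf.
have [|U [_ dU _ pU]] := tower (\dim {:V}).-1; first by rewrite prednK.
have eU : U = fullv by apply/eqP; rewrite eqEdim subvf dU (prednK r0) leqnn.
by rewrite eU in pU.
Qed.

End RatioTower.

(** * The stalks and the theorem *)

Lemma frac_cross (K : fieldType) (a b q q' : K) : b != 0 ->
  a / b * (q * (b * q')) = a * q * q'.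
Proof. by move=> b0; field. Qed.

Lemma frac_scale (K : fieldType) (a b c : K) : c != 0 -> a / b = a * c / (b * c).
Proof. by move=> c0; rewrite -mulf_div divff // mulr1. Qed.

Section Stalk.
Variables (F : finFieldType) (V : vectType F).
Local Notation SV := {mpoly F[\dim {:V}]}.
Local Notation KV := {fraction SV}.
Local Notation lin := (@KV_in F V).
Local Notation cst := (@KV_const F V).
Implicit Types (U : {vspace V}) (u v x : V).

Definition RV_emb : {rmorphism RV V -> KV} := (val : RV V -> KV).

Lemma RV_emb_inj : injective RV_emb. Proof. exact: val_inj. Qed.

Lemma RV_pred_const a : cst a \in @RV_pred F V.
Proof. by rewrite RV_predE invU_cst. Qed.

Lemma RV_pred_inv v : (lin v)^-1 \in @RV_pred F V.
Proof. by rewrite RV_predE invU_inv // memvf. Qed.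

Definition constR a : RV V := MkRV (RV_pred_const a).
Definition invR v : RV V := MkRV (RV_pred_inv v).

Lemma constR_homog a : RV_homog 0 (constR a).
Proof.
exists [:: (a, [::])]; first by move=> t; rewrite inE => /eqP ->.
by rewrite big_seq1 /RV_term big_nil mulr1.
Qed.

Lemma invR_homog v : v != 0 -> RV_homog 1 (invR v).
Proof.
move=> v0; exists [:: (1, [:: v])].
  by move=> t; rewrite inE => /eqP -> /=; rewrite inE eq_sym.
by rewrite big_seq1 /RV_term big_seq1 /= KV_constE rmorph1 mul1r.
Qed.

Lemma invR_neq0 v : v != 0 -> invR v != 0.
Proof.
move=> v0; apply/eqP => /(congr1 (@RV_val F V)) /eqP.
by rewrite [RV_val 0](rmorph0 RV_emb) invr_eq0 KV_in_eq0 (negbTE v0).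
Qed.

Variable p : proj_point (RV_grading V).

(** Otherwise every homogeneous element of positive degree would lie in [p]. *)
Lemma exists_invR_notin : exists2 v, v != 0 & invR v \notin p.
Proof.
apply: contrapT => h.
have all_in v : v != 0 -> invR v \in p.
  by move=> v0; apply: contrapT => /negP vp; apply: h; exists v.
have [_ [d [a [d0 [s hs ea] ap]]]] : proj_ideal p = proj_ideal p /\
    exists d (a : RV V), [/\ (0 < d)%N, RV_homog d a & a \notin p].
  by split=> //; case: (p).
case/negP: ap.
pose B : {pred KV} := fun z => `[< exists2 b : RV V, b \in p & z = RV_val b >].
have : RV_val a \in B.
  rewrite ea big_seq; elim/big_rec: _ => [|t z /hs [st t0] /asboolP [b bp ->]].
    by apply/asboolP; exists 0; [exact: idealr0|rewrite [RV_val 0](rmorph0 RV_emb)].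
  case: t st t0 => c [|v w] /=; first by move=> d0'; rewrite -d0' in d0.
  rewrite inE negb_or eq_sym => _ /andP [v0 w0].
  pose r := MkRV (@RV_term_in F V (c, w) w0).
  apply/asboolP; exists (r * invR v + b).
    by apply: rpredD => //; apply: idealMr; apply: all_in.
  rewrite [RHS](rmorphD RV_emb) [RV_emb (_ * _)](rmorphM RV_emb); congr (_ + _).
  by rewrite /RV_term /= big_cons mulrA mulrAC.
by case/asboolP => b bp /val_inj ->.
Qed.

Section Chart.
Variable x1 : V.
Hypotheses (x1_neq0 : x1 != 0) (x1p : invR x1 \notin p).

Let emb := hloc_emb p RV_emb_inj.
Let lx1 : lin x1 != 0. Proof. by rewrite KV_in_eq0. Qed.

Lemma embE h : emb (\pi_(hloc p) h) = RV_val (num h) / RV_val (den h).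
Proof. exact: (hloc_valE RV_emb_inj h). Qed.

Lemma emb_inj : injective emb. Proof. exact: (hloc_val_inj RV_emb_inj). Qed.

Definition stalkA : {pred KV} := fun z => `[< exists h, z = emb h >].
Definition stalkM : {pred KV} := fun z => `[< exists2 h, ~ is_unit h & z = emb h >].

Lemma stalkA_closed : subring_closed stalkA.
Proof.
split; first by apply/asboolP; exists 1; rewrite rmorph1.
  move=> _ _ /asboolP [h ->] /asboolP [k ->]; apply/asboolP; exists (h - k).
  by rewrite rmorphB.
move=> _ _ /asboolP [h ->] /asboolP [k ->]; apply/asboolP; exists (h * k).
by rewrite rmorphM.
Qed.
HB.instance Definition _ := GRing.isSubringClosed.Build KV stalkA stalkA_closed.

Lemma stalkM_closed : zmod_closed stalkM.
Proof.
split.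
  apply/asboolP; exists 0; last by rewrite rmorph0.
  by move=> [y]; rewrite mul0r => /eqP; rewrite eq_sym oner_eq0.
move=> _ _ /asboolP [h hu ->] /asboolP [k ku ->]; apply/asboolP; exists (h - k).
  apply: hloc_local => // [[y e]]; apply: ku; exists (- y).
  by rewrite mulrN -mulNr.
by rewrite rmorphB.
Qed.
HB.instance Definition _ := GRing.isZmodClosed.Build KV stalkM stalkM_closed.

Lemma stalkM_emb h : (emb h \in stalkM) <-> ~ is_unit h.
Proof.
by split=> [/asboolP [k ku /emb_inj ->]|hu] //; apply/asboolP; exists h.
Qed.

Lemma stalkM_mul z w : z \in stalkA -> w \in stalkM -> z * w \in stalkM.
Proof.
move=> /asboolP [h ->] /asboolP [k ku ->]; apply/asboolP; exists (h * k).
  by move=> [y e]; apply: ku; exists (h * y); rewrite mulrCA mulrA.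
by rewrite rmorphM.
Qed.

Lemma stalkM_inv z : z \in stalkA -> z \notin stalkM -> z^-1 \in stalkA.
Proof.
move=> /asboolP [h ->] /negP hm.
have /contrapT [k hk] : ~ ~ is_unit h by move/stalkM_emb.
apply/asboolP; exists k; have e : emb h * emb k = 1 by rewrite -rmorphM hk rmorph1.
have h0 : emb h != 0.
  by apply/eqP => h0; move/eqP: e; rewrite h0 mul0r eq_sym oner_eq0.
by apply: (mulfI h0); rewrite e divff.
Qed.

Lemma stalkM1 : 1 \notin stalkM.
Proof. by apply/negP; rewrite -(rmorph1 emb) stalkM_emb; apply; exists 1; rewrite mulr1. Qed.

Lemma stalk_frac d (a b : RV V) z : RV_homog d a -> RV_homog d b -> b \notin p ->
  z = RV_val a / RV_val b -> z \in stalkA /\ (z \in stalkM <-> a \in p).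
Proof.
move=> ha hb bp ->.
have hk : (exists2 d, RV_grading V d a & RV_grading V d b) /\ b \notin p.
  by split=> //; exists d.
pose h : hfrac p := HFrac hk.
have e : RV_val a / RV_val b = emb (\pi_(hloc p) h) by rewrite embE.
split; first by apply/asboolP; exists (\pi_(hloc p) h).
rewrite e stalkM_emb hloc_unitP /=; split=> [/negP|ap]; first by rewrite negbK.
by rewrite ap.
Qed.


Let lratio := ratio lin x1.

Lemma ratio_stalk v : v != 0 -> lratio v \in stalkA.
Proof.
move=> v0; have e : lratio v = RV_val (invR v) / RV_val (invR x1).
  by rewrite /lratio /ratio /= invrK mulrC.
by case: (stalk_frac (invR_homog v0) (invR_homog x1_neq0) x1p e).
Qed.

Lemma ratio_in v : lratio v \in stalkA.
Proof.
have [->|v0] := eqVneq v 0; last exact: ratio_stalk.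
by rewrite /lratio /ratio KV_in0 invr0 mulr0 rpred0.
Qed.

Lemma one_notin : (1 : RV V) \notin p. Proof. by rewrite idealr1. Qed.

Lemma constR_frac a : cst a = RV_val (constR a) / RV_val 1.
Proof. by rewrite [RV_val 1](rmorph1 RV_emb) divr1. Qed.

Lemma const_stalk a : cst a \in stalkA.
Proof.
by case: (stalk_frac (constR_homog a) (RV_homog1 V) one_notin (constR_frac a)).
Qed.

Local Notation full_ratios := (ratios lin (KV_constf V) x1 fullv).
Local Notation full_local := (local_ratios lin (KV_constf V) stalkM x1 fullv).

(** Dehomogenization by the degree one element [1 / x1]. *)
Lemma homog_ratios d (a : RV V) : RV_homog d a -> RV_val a * lin x1 ^+ d \in full_ratios.
Proof.
move=> [s hs ->]; rewrite mulr_suml big_seq; apply: rpred_sum => t /hs [<- _].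
rewrite /RV_term -mulrA; apply: rpredM; first by apply: mem_subring_gen; left; exists t.1.
elim: t.2 => [|v w IH]; first by rewrite big_nil expr0 mulr1 rpred1.
rewrite big_cons exprS mulrACA; apply: rpredM => //.
by apply: mem_subring_gen; right; exists v; [exact: memvf|exact: mulrC].
Qed.

Lemma stalk_full : {subset stalkA <= full_local}.
Proof.
move=> _ /asboolP [z ->]; elim/quotW: z => h; rewrite embE.
have [[d nh dh] hp] := hfracP h.
apply/asboolP; exists (RV_val (num h) * lin x1 ^+ d), (RV_val (den h) * lin x1 ^+ d).
split; [exact: homog_ratios|exact: homog_ratios| |].
  have xh : RV_homog d (invR x1 ^+ d).
    elim: (d) => [|i IH]; first by rewrite expr0; apply: RV_homog1.
    by rewrite exprS -add1n; apply: RV_homogM (invR_homog x1_neq0) IH.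
  have xp : invR x1 ^+ d \notin p.
    elim: (d) => [|i IH]; first by rewrite expr0 one_notin.
    by rewrite exprS prime_idealrM negb_or x1p.
  have e : RV_val (den h) * lin x1 ^+ d = RV_val (den h) / RV_val (invR x1 ^+ d).
    by rewrite [RV_val (_ ^+ _)](rmorphXn RV_emb) /= exprVn invrK.
  have [_ im] := stalk_frac dh xh xp e.
  by apply/negP => /im; rewrite (negbTE hp).
by apply: frac_scale; apply: expf_neq0.
Qed.

(** That [P] and [Q] have the same degree is what makes the transcendence degree
    of the stalk one less than the dimension of [V]. *)
Lemma stalk_homog (z : hloc p) : exists D (P Q : SV),
  [/\ P \is D.-homog, Q \is D.-homog, Q != 0 &
      emb z * FracField.tofrac Q = FracField.tofrac P].
Proof.
elim/quotW: z => h; rewrite embE.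
have [[d nh dh] hp] := hfracP h.
have [m [e [P [Q [hP hQ Q0 PQ E]]]]] := RV_homog_shape nh.
have [m' [e' [P' [Q' [hP' hQ' Q0' PQ' E']]]]] := RV_homog_shape dh.
have d0 : RV_val (den h) != 0.
  rewrite -[X in _ != X](rmorph0 RV_emb) (inj_eq val_inj).
  by apply: contraNneq hp => ->; apply: idealr0.
have P0' : P' != 0.
  rewrite -tofrac_eq0 -E'; apply: mulf_neq0; first exact: d0.
  by rewrite tofrac_eq0; exact: Q0'.
have [P0|P0] := eqVneq P 0.
  have n0 : RV_val (num h) = 0.
    have Qf : FracField.tofrac Q != 0 by rewrite tofrac_eq0; exact: Q0.
    by apply: (mulIf Qf); rewrite E P0 tofrac0 mul0r.
  exists 0, 0, 1; rewrite rpred0 dhomog1 oner_neq0; split=> //.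
  by rewrite n0 !mul0r tofrac0.
exists (m + e')%N, (P * Q'), (Q * P'); split.
- exact: dhomogM.
- have -> : (m + e' = e + m')%N by rewrite PQ // PQ' // -addnA [(d + m')%N]addnC.
  exact: dhomogM.
- by rewrite mulf_neq0.
rewrite !tofracM -E -E'; exact: frac_cross.
Qed.

Lemma stalk_common_denom (y : nat -> hloc p) n : exists D (Q : SV),
  [/\ Q \is D.-homog, Q != 0 & forall i, (i < n)%N ->
    exists2 P : SV, P \is D.-homog & emb (y i) * FracField.tofrac Q = FracField.tofrac P].
Proof.
elim: n => [|n [D [Q [hQ Q0 IH]]]]; first by exists 0, 1; rewrite dhomog1 oner_neq0.
have [E [P [R [hP hR R0 e]]]] := stalk_homog (y n).
exists (D + E)%N, (Q * R); split; [exact: dhomogM|by rewrite mulf_neq0|].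
move=> i; rewrite ltnS leq_eqVlt => /orP [/eqP ->|/IH [P' hP' e']].
  exists (Q * P); first exact: dhomogM.
  by rewrite !tofracM mulrCA e.
exists (P' * R); first exact: dhomogM.
by rewrite !tofracM mulrA e'.
Qed.

Lemma stalk_const_subproof a :
  (exists2 d, RV_grading V d (constR a) & RV_grading V d 1) /\ (1 : RV V) \notin p.
Proof. by split; [exists 0; [exact: constR_homog|exact: RV_homog1]|exact: one_notin]. Qed.

Definition stalk_const a : hloc p := \pi_(hloc p) (HFrac (stalk_const_subproof a)).

Lemma stalk_constE a : emb (stalk_const a) = KV_constf V a.
Proof. by rewrite embE; exact: (esym (constR_frac a)). Qed.

Lemma stalk_const_zmod : zmod_morphism stalk_const.
Proof.
move=> a b; apply: emb_inj; rewrite rmorphB !stalk_constE; exact: rmorphB.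
Qed.

Lemma stalk_const_monoid : monoid_morphism stalk_const.
Proof.
split; first by apply: emb_inj; rewrite rmorph1 stalk_constE; exact: rmorph1.
by move=> a b; apply: emb_inj; rewrite rmorphM !stalk_constE; exact: rmorphM.
Qed.

Definition stalk_constf : {rmorphism F -> hloc p} :=
  HB.pack stalk_const (GRing.isZmodMorphism.Build _ _ stalk_const stalk_const_zmod)
    (GRing.isMonoidMorphism.Build _ _ stalk_const stalk_const_monoid).

Lemma emb_npeval (y : nat -> hloc p) n q :
  emb (npeval stalk_constf y n q) = npeval (KV_constf V) (emb \o y) n q.
Proof. by apply: npeval_comp => a; apply: stalk_constE. Qed.

Definition lift z : hloc p := if pselect (exists h, z = emb h) is left e
  then projT1 (cid e) else 0.

Lemma liftK z : z \in stalkA -> emb (lift z) = z.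
Proof. by rewrite /lift => /asboolP h; case: pselect => // e; case: (cid e). Qed.

(** The stalk is a localization of the algebra generated by the finitely many
    [x1 / v]. *)
Lemma stalk_noetherian : noetherian (hloc p).
Proof.
pose N := size (vectors V); pose y i := lift (lratio (nth 0 (vectors V) i)).
apply: (noetherian_fractions (f := npeval stalk_constf y N)); first exact: ideals_fg_npoly.
have im z : z \in full_ratios -> exists q, z = emb (npeval stalk_constf y N q).
  pose B : {pred KV} := fun z => `[< exists q, z = emb (npeval stalk_constf y N q) >].
  suff sub : {subset full_ratios <= B} by move=> /sub /asboolP.
  apply: subring_gen_min.
    split; first by apply/asboolP; exists 1; rewrite !rmorph1.
      move=> _ _ /asboolP [q ->] /asboolP [r ->]; apply/asboolP; exists (q - r).
      by rewrite !rmorphB.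
    move=> _ _ /asboolP [q ->] /asboolP [r ->]; apply/asboolP; exists (q * r).
    by rewrite !rmorphM.
  move=> w [[a ->]|[v _ ->]]; apply/asboolP.
    by have [q e] := npeval_const stalk_constf y N a; exists q; rewrite e -stalk_constE.
  have hi : (index v (vectors V) < N)%N by rewrite index_mem mem_vectors.
  have [q e] := npeval_var stalk_constf y hi; exists q; rewrite e /y liftK ?ratio_in //.
  by rewrite nth_index ?mem_vectors.
move=> a; have : emb a \in full_local by apply: stalk_full; apply/asboolP; exists a.
move=> /asboolP [g [h [/im [q ->] /im [r er] hm e]]].
have h0 : h != 0 by apply: contraNneq hm => ->; apply: rpred0.
exists q, r; split.
  by move: hm; rewrite er => /negP; rewrite stalkM_emb => /contrapT.
apply: emb_inj; rewrite rmorphM -[X in _ * X]er -[LHS]/(emb a * h) e.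
by rewrite divfK.
Qed.

(** The parameters found in the function field, transported to the stalk, match
    the bound on its transcendence degree. *)
Lemma stalk_cohen_macaulay : (0 < \dim {:V})%N -> cohen_macaulay_local (hloc p).
Proof.
move=> dV.
have [s [x [e [[sA reg] sm xA ind sN]]]] := @params_full F V KV lin (KV_constf V) (@fieldU F V)
  (@KV_inD F V) (@KV_inZ F V) (@KV_in_eq0 F V) (@fieldU_lin F V) (@fieldU_const F V)
  (@KV_in_transc F V) stalkA stalkM stalkM_mul stalkM_inv stalkM1 x1 x1_neq0 ratio_in const_stalk.
have locA : {subset full_local <= stalkA}.
  move=> z; exact: (@local_ratiosA F V KV lin (KV_constf V) stalkA stalkM stalkM_inv x1
    ratio_in const_stalk fullv z).
have xE i : (i < e)%N -> emb (lift (x i)) = x i by move=> /xA /locA /liftK.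
pose s' := map lift s.
have s'E : map emb s' = s.
  rewrite -map_comp -[RHS]map_id; apply/eq_in_map => z /sA /locA /liftK //.
have idealE t h : sub_ideal full_local (map emb t) (emb h) <-> ideal_gen t h.
  split=> [/asboolP [c [hc e1]]|[c ->]].
    exists (lift \o c); apply: emb_inj; rewrite e1 size_map rmorph_sum.
    apply: eq_bigr => i _; rewrite (nth_map 0) // [RHS]rmorphM.
    congr (_ * _); rewrite -[RHS]/(emb (lift (c i))) liftK //.
    exact/locA/hc.
  apply/asboolP; exists (emb \o c); split.
    by move=> i; apply: stalk_full; apply/asboolP; exists (c i).
  rewrite rmorph_sum size_map; apply: eq_bigr => i _.
  by rewrite (nth_map 0) // rmorphM.
apply: (@cohen_macaulay_criterion _ F stalk_constf (\dim {:V}).-1 s' (lift \o x) e).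
- exact: hloc_local.
- exact: stalk_noetherian.
- move=> i hi y; rewrite size_map in hi; rewrite -!idealE map_take s'E [emb (_ * _)]rmorphM.
  have -> : emb s'`_i = s`_i.
    by rewrite /s' (nth_map 0) // liftK //; apply/locA/sA/mem_nth.
  by apply: reg => //; apply: stalk_full; apply/asboolP; exists y.
- move=> a /mapP [z zs ->]; rewrite -stalkM_emb liftK ?sm //.
  by apply/locA/sA.
- move=> q hq; apply: ind; rewrite -(eq_npeval (KV_constf V) xE).
  by rewrite -emb_npeval stalkM_emb.
- by rewrite size_map.
move=> y n indy; have [D [Q [hQ Q0 hy]]] := stalk_common_denom y n.
apply: (@indep_homog_bound F _ D n (KV_constf V) Q (emb \o y) dV _ Q0 hQ hy) => // q hq.
by apply: indy; apply: emb_inj; rewrite emb_npeval hq rmorph0.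
Qed.

End Chart.
End Stalk.

Theorem theorem1p11 (F : finFieldType) (V : vectType F)
    (hV : (0 < \dim (fullv : {vspace V}))%N) :
  integral (QV V) /\ cohen_macaulay (QV V) /\ QV_projectively_normal V.
Proof.
have [v v0] : exists v : V, v != 0.
  exists (vpick fullv); rewrite vpick0 -dimv_eq0 -lt0n; exact: hV.
split; [|split].
- apply: (@Proj_integral _ (RV_grading V) 1 (invR v)) => //.
    exact: invR_homog.
  exact: invR_neq0.
- move=> p; have [x x0 xp] := exists_invR_notin p.
  exact: (stalk_cohen_macaulay x0 xp).
- exact: RV_integrally_closed.
Qed.
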